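(* Let $|q|=1$, and assume that $q$ is not a root of unity. Let $\rho(q)$ denote the radius of meromorphy of $H_q$. Then: (a) $H_q$ has a natural boundary on the circle $\{z:|z|=\rho(q)\}$ and $$1\ge\rho(q)\ge\max\left\{R(q),\frac{1}{2+|1+q|}\right\}\ge\frac14 .$$ (b) $G_q$ has a natural boundary on the circle $\{z:|z|=R(q)\}$. Moreover, as $q$ ranges over the unit circle (roots of unity excluded), $R(q)$ may assume any value in $[0,1]$; that is, for every $t\in[0,1]$ there is such a $q$ with $R(q)=t$. (c) For $q\notin\mathcal{G}$, $R(q)=\rho(q)=1$. In particular, this is true for almost every $q$ on the unit circle (with respect to linear measure).
   Context: For $|q|=1$, $q$ not a root of unity, $$G_q(z):=\sum_{j=0}^\infty\frac{q^{j^2}}{(1-q)(1-q^2)\cdots(1-q^j)}z^j ,$$ a formal power series whose radius of convergence is denoted $R(q)\in[0,1]$. Set $\mathcal{G}:=\{q : |q|=1,\ q \text{ not a root of unity},\ R(q)<1\}$. The function $H_q$: when $R(q)>0$, $H_q(z):=G_q(z)/G_q(qz)$; when $R(q)=0$, $H_q$ is defined as the function to which the continued fraction $1+\cfrac{qz}{1+\cfrac{q^2z}{1+\cfrac{q^3z}{1+\cdots}}}$ converges; this continued fraction converges uniformly in compact subsets of $\{|z|<\frac14\}$ for every $|q|=1$ (Worpitzky's theorem), and both definitions give the same Maclaurin series at $0$. Analytic or meromorphic continuations of $H_q$ are also denoted $H_q$. The radius of meromorphy $\rho(q)$ is the radius of the largest open disc centred at $0$ into which $H_q$ can be meromorphically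 continued. A function analytic (or meromorphic) in $\{|z|<r\}$, $r>0$, has a natural boundary on $\{|z|=r\}$ if no point of this circle is a point of analyticity, i.e. for no $z_0$ with $|z_0|=r$ does the function continue analytically to a neighbourhood of $z_0$. When $R(q)=0$, $G_q$ is only a formal series and the natural boundary assertion in (b) is void. *)

(* Defs.v *)
From HB Require Import structures.
From mathcomp Require Import all_boot all_order all_algebra.
From mathcomp Require Import complex.
From mathcomp Require Import all_classical all_reals all_analysis.
Set Implicit Arguments.
Unset Strict Implicit.
Unset Printing Implicit Defensive.
Import Order.TTheory GRing.Theory Num.Theory numFieldNormedType.Exports.
Import ComplexField.

Local Open Scope classical_set_scope.
Local Open Scope ring_scope.
Local Open Scope complex_scope.

                                                                               
                            
#[export, non_forgetful_inheritance]
HB.instance Definition _ (R : realType) := NormedModule.copy R[i] R[i]^o.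

Section complex_functions.
Context {R : realType}.
Implicit Types (a : nat -> R[i]) (f g h : R[i] -> R[i]) (z q : R[i]).
Implicit Types (r : \bar R).

                                                                           
Definition cmod z : R := Normc.normc z.

Definition disc r : set R[i] := [set z | ((cmod z)%:E < r)%E].

Definition psum a z : nat -> R[i] := series (fun j => a j * z ^+ j).

Definition convergence_radius a : \bar R :=
  ereal_sup [set (cmod z)%:E | z in [set z | cvgn (psum a z)]].

Definition analytic_at f z0 : Prop :=
  exists a, \forall z \near z0, psum a (z - z0) @ \oo --> f z.

                                                                        
Definition meromorphic_at f z0 : Prop :=
  exists (n : nat) g, analytic_at g z0 /\
    \forall z \near z0^', (z - z0) ^+ n * f z = g z.

Definition meromorphic_continuation f r h : Prop :=
  (forall z, disc r z -> meromorphic_at h z) /\ \forall z \near (0 : R[i]), h z = f z.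

Definition meromorphy_radius f : \bar R :=
  ereal_sup [set r | exists h, meromorphic_continuation f r h].

                                                                              
                                                                           
                                     
Definition natural_boundary f r : Prop :=
  forall z0, (cmod z0)%:E = r ->
    ~ exists g, analytic_at g z0 /\
        \forall z \near z0, disc r z -> analytic_at f z -> g z = f z.

Definition not_root_of_unity q : Prop := forall n : nat, (0 < n)%N -> q ^+ n != 1.

Definition Gcoef q (j : nat) : R[i] :=
  q ^+ (j ^ 2)%N / \prod_(1 <= k < j.+1) (1 - q ^+ k).

Definition Gq q z : R[i] := limn (psum (Gcoef q) z).

Definition Rq q : \bar R := convergence_radius (Gcoef q).

                                                                                
Fixpoint cfrac q z (k n : nat) : R[i] :=
  if n is n'.+1 then 1 + q ^+ k * z / cfrac q z k.+1 n' else 1.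

Definition Hq q z : R[i] :=
  if (0 < Rq q)%E then Gq q z / Gq q (q * z)
  else limn (fun n => cfrac q z 1 n).

Definition rho q : \bar R := meromorphy_radius (Hq q).

Definition calG : set R[i] :=
  [set q | [/\ `|q| = 1, not_root_of_unity q & (Rq q < 1)%E]].

                                                                        
                                                     
Definition ae_unit_circle (P : R[i] -> Prop) : Prop :=
  {ae lebesgue_measure, forall t : R, 0 <= t < 2 * pi -> P (cos t +i* sin t)}.

End complex_functions.

(* Main.v *)
Require Import Defs.
From HB Require Import structures.
From mathcomp Require Import all_boot all_order all_algebra.
From mathcomp Require Import fingroup perm complex.
From mathcomp Require Import all_classical all_reals all_analysis.
From mathcomp Require Import ring lra zify.
Import Order.TTheory GRing.Theory Num.Theory numFieldNormedType.Exports.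
Set Implicit Arguments.
Unset Strict Implicit.
Unset Printing Implicit Defensive.
Local Open Scope classical_set_scope.
Local Open Scope ring_scope.
Local Open Scope complex_scope.

(** The series [G] satisfies [G z = G (q z) + q z G (q^2 z)], so [H] satisfies
    [H z = 1 + q z / H (q z)], which is also the equation of the continued fraction.

    Bounds for [rho]. Two steps of the fraction show that [W z = H z + z] satisfies
    [W z = 1 + (1 + q) z - q^3 z^2 / W (q^2 z)]. The Maclaurin coefficients of [1 / W]
    then have a quadratic majorant, whose radius of convergence is
    [1 / (2 + |1 + q|)] ([jfraction_sum]); near the origin both definitions of [H]
    give the series of [W - z] ([Hq_near0]). The same equation shows that the Hankel
    determinants of [H], shifted by two, all have modulus one
    ([cmod_det_hankel_jden]). A function meromorphic in a disc of radius larger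
    than one has Hankel determinants tending to zero ([hankel_small]), hence
    [rho <= 1]. Below the radius of convergence of [G], [H] is a quotient of two
    analytic functions, hence [R <= rho].

    Natural boundaries. The orbits of the rotation by [q] are dense in circles.
    If [G] continues analytically across one point of its circle of convergence, it
    does so across an arc, hence across some pair of consecutive orbit points
    ([extends_pair]); the functional equation propagates this along the orbit, and
    by density to the whole circle, which by compactness and the Cauchy inequality
    contradicts the choice of the radius ([PS_extends]). For [H] the relation
    [H (q z) (H z - 1) = q z] propagates meromorphy across a point
    ([quotient_extends_step]), and a function meromorphic across the whole circle is
    meromorphic in a larger disc, because a polynomial clears its poles
    ([mero_disc], [mero_glue]).

    Values of [R]. Up to unimodular factors the coefficients of [G] are those of
    [F z = \sum_j z^j / ((1-q)...(1-q^j))], whose logarithmic derivative has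
    coefficients [1 / (1 - q^n)]; so the radius is governed by the single small
    divisors ([Rq_ge]). By Borel-Cantelli these are at least of order [1 / n^2] for
    almost every [q], which gives [R = 1] and then [rho = 1]. A prescribed radius [t]
    is obtained from a lacunary angle [2 pi \sum_i 2^(-a_i)]: with [b = 2^(a_i)], [q] is
    so close to a primitive [b]-th root of unity that [1 - q^b] is comparable to
    [t^b], up to powers of [b]. This gives the upper bound for [R] because
    the product of [1 - zeta^k] over [0 < k < b] is exactly [b] ([lac_Gcoef]); in between
    the divisors are not smaller, which gives the lower bound ([lac_Rq_ge]). *)

(** * The modulus of a complex number *)

Section modulus.
Context {R : realType}.
Implicit Types (z w u : R[i]) (e : R).

Lemma normE z : `|z| = (cmod z)%:C. Proof. by []. Qed.

Lemma cmod0 : cmod (0 : R[i]) = 0. Proof. exact: Normc.normc0. Qed.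

Lemma cmod1 : cmod (1 : R[i]) = 1. Proof. exact: Normc.normc1. Qed.

Lemma cmodM z w : cmod (z * w) = cmod z * cmod w.
Proof. exact: Normc.normcM. Qed.

Lemma cmodV z : cmod z^-1 = (cmod z)^-1. Proof. exact: Normc.normcV. Qed.

Lemma cmod_div z w : cmod (z / w) = cmod z / cmod w.
Proof. by rewrite cmodM cmodV. Qed.

Lemma cmodX z n : cmod (z ^+ n) = cmod z ^+ n.
Proof. by elim: n => [|n IH]; rewrite ?expr0 ?cmod1 // !exprS cmodM IH. Qed.

Lemma cmodN z : cmod (- z) = cmod z. Proof. exact: normcN. Qed.

Lemma cmodD z w : cmod (z + w) <= cmod z + cmod w.
Proof. exact: le_normcD. Qed.

Lemma cmodB z w : cmod (z - w) <= cmod z + cmod w.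
Proof. by rewrite (le_trans (cmodD _ _)) // cmodN. Qed.

Lemma cmodC z w : cmod (z - w) = cmod (w - z).
Proof. by rewrite -cmodN opprB. Qed.

Lemma cmod_tri u z w : cmod (z - w) <= cmod (z - u) + cmod (u - w).
Proof. by rewrite (le_trans _ (cmodD _ _)) // addrA subrK. Qed.

Lemma cmod_ge0 z : 0 <= cmod z. Proof. by rewrite -lecR -normE normr_ge0. Qed.

Lemma cmod_eq0 z : (cmod z == 0) = (z == 0).
Proof.
by apply/eqP/eqP => [/Normc.eq0_normc //|->]; rewrite cmod0.
Qed.

Lemma cmod_gt0 z : (0 < cmod z) = (z != 0).
Proof. by rewrite lt_neqAle eq_sym cmod_eq0 cmod_ge0 andbT. Qed.

Lemma cmodD_ge z w : cmod z - cmod w <= cmod (z + w).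
Proof. have := cmodB (z + w) w; rewrite addrK; lra. Qed.

Lemma cmodR e : cmod e%:C = `|e|.
Proof. by rewrite /cmod /= expr0n /= addr0 sqrtr_sqr. Qed.

Lemma cmodR_ge0 e : 0 <= e -> cmod e%:C = e.
Proof. by rewrite cmodR => /ger0_norm. Qed.

Lemma cmod_nat n : cmod (n%:R : R[i]) = n%:R.
Proof. by rewrite -[n%:R](rmorph_nat (real_complex R)) cmodR_ge0. Qed.

Lemma cmod_sum (I : Type) (r : seq I) (P : pred I) (F : I -> R[i]) :
  cmod (\sum_(i <- r | P i) F i) <= \sum_(i <- r | P i) cmod (F i).
Proof.
elim/big_ind2: _ => [|x y z w h k|i _]; rewrite ?cmod0 //.
by rewrite (le_trans (cmodD _ _)) ?lerD.
Qed.

Lemma cmod_prod (I : Type) (r : seq I) (P : pred I) (F : I -> R[i]) :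
  cmod (\prod_(i <- r | P i) F i) = \prod_(i <- r | P i) cmod (F i).
Proof. by elim/big_ind2: _ => [|x y z w <- <-|//]; rewrite ?cmod1 ?cmodM. Qed.

Lemma cmod_Re z : `|complex.Re z| <= cmod z.
Proof. by rewrite -lecR -normE normc_ge_Re. Qed.

Lemma cmod_Im z : `|complex.Im z| <= cmod z.
Proof.
case: z => x y /=; rewrite /cmod /= -sqrtr_sqr ler_wsqrtr // lerDr sqr_ge0 //.
Qed.

Lemma cmod_le z : cmod z <= `|complex.Re z| + `|complex.Im z|.
Proof.
case: z => x y; rewrite /cmod /=.
rewrite -[leRHS]ger0_norm ?addr_ge0 // -sqrtr_sqr ler_wsqrtr // sqrrD.
by rewrite !real_normK ?num_real // addrAC lerDl mulrn_wge0 ?mulr_ge0.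
Qed.

(** The radii of the balls of the normed space [R[i]] are complex numbers that
    happen to be nonnegative reals; here they become elements of [R]. *)
Lemma nearC z (P : set R[i]) :
  (\forall w \near z, P w) <-> exists2 e, 0 < e & forall w, cmod (w - z) < e -> P w.
Proof.
split.
  move=> /nbhs_ballP[[e e'] /= e0 h].
  move: e0; rewrite ltcE /= => /andP[/eqP e'0 e0]; exists e => // w wz; apply: h.
  by rewrite /ball /= distrC normE e'0 ltcR.
move=> [e e0 h]; apply/nbhs_ballP; exists e%:C => /=; first by rewrite ltcR.
by move=> w; rewrite /ball /= distrC normE ltcR; exact: h.
Qed.

Lemma dnearC z (P : set R[i]) :
  (\forall w \near z^', P w) <->
  exists2 e, 0 < e & forall w, cmod (w - z) < e -> w != z -> P w.
Proof. by rewrite -nearC; split. Qed.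

Lemma dnear_lt z w e : cmod (z - w) < e -> \forall v \near z^', cmod (v - w) < e.
Proof.
move=> zw; apply/dnearC; exists (e - cmod (z - w)); first by rewrite subr_gt0.
by move=> v vz _; have := cmod_tri z v w; lra.
Qed.

Lemma dnear_lt0 z e : cmod z < e -> \forall v \near z^', cmod v < e.
Proof. by rewrite -{1}[z]subr0 => /dnear_lt; apply: filterS => v; rewrite subr0. Qed.

Lemma ccvgP (u : nat -> R[i]) (l : R[i]) :
  u @ \oo --> l <->
  (forall e, 0 < e -> exists N, forall n, (N <= n)%N -> cmod (u n - l) < e).
Proof.
split.
  move=> /cvgrPdist_lt h e e0.
  have /h[N _ {}h] : 0 < e%:C by rewrite ltcR.
  by exists N => n /h /=; rewrite distrC normE ltcR.
move=> h; apply/cvgrPdist_lt => -[e e'].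
rewrite ltcE /= => /andP[/eqP -> /h[N {}h]]; exists N => // n /= /h.
by rewrite distrC normE -ltcR.
Qed.

End modulus.

(** * Geometric bounds and limits of complex sequences *)

Section geometric.
Context {R : realType}.
Implicit Types (x e : R).

Lemma eq_ler x e : x = e -> x <= e. Proof. by move=> ->. Qed.

Lemma geo_tail x M N : 0 <= x < 1 ->
  \sum_(M <= j < N) x ^+ j <= x ^+ M / (1 - x).
Proof.
move=> /andP[x0 x1]; have x1' : 0 < 1 - x by rewrite subr_gt0.
rewrite ler_pdivlMr //.
have [MN|NM] := leqP M N; last by rewrite big_geq ?mul0r ?exprn_ge0 // ltnW.
suff -> : (\sum_(M <= j < N) x ^+ j) * (1 - x) = x ^+ M - x ^+ N.
  by rewrite gerBl exprn_ge0.
elim: N MN => [|N IH]; first by rewrite leqn0 => /eqP ->; rewrite big_geq // mul0r subrr.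
rewrite leq_eqVlt => /predU1P[->|]; first by rewrite big_geq // mul0r subrr.
by rewrite ltnS => MN; rewrite big_nat_recr //= mulrDl IH // exprS; ring.
Qed.

Lemma geo_linear x n : 0 <= x < 1 -> n.+1%:R * x ^+ n <= (1 - x)^-1.
Proof.
move=> /andP[x0 x1]; have := @geo_tail x 0 n.+1; rewrite x0 x1 expr0 mul1r.
move=> /(_ isT); apply: le_trans; rewrite big_mkord -[n.+1 in X in X%:R]card_ord mulr_natl.
rewrite -sumr_const ler_sum // => i _; apply: ler_wiXn2l => //; first exact: ltW.
by rewrite -ltnS.
Qed.

Lemma expr_ratio x y n : 0 < y -> x ^+ n = y ^+ n * (x / y) ^+ n.
Proof. by move=> y0; rewrite -exprMn mulrCA divff ?mulr1 // gt_eqF. Qed.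

Lemma expr_small x e : 0 <= x < 1 -> 0 < e ->
  exists N, forall n, (N <= n)%N -> x ^+ n < e.
Proof.
move=> /andP[x0 x1] e0; have := @cvg_expr R x; rewrite ger0_norm // => /(_ x1).
move=> /cvgrPdist_lt /(_ _ e0)[N _ h]; exists N => n /h /=.
by rewrite sub0r normrN ger0_norm // exprn_ge0.
Qed.

Lemma linear_expr_small x e : 0 <= x < 1 -> 0 < e ->
  exists N, forall n, (N <= n)%N -> n%:R * x ^+ n < e.
Proof.
move=> /andP[x0 x1] e0; pose y := (1 + x) / 2.
have y0 : 0 < y by rewrite /y; lra.
have y1 : y < 1 by rewrite /y; lra.
have xy : 0 <= x / y < 1.
  apply/andP; split; first by rewrite divr_ge0 // ltW.
  by rewrite ltr_pdivrMr // mul1r /y; lra.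
have K0 : 0 < (1 - x / y)^-1 by rewrite invr_gt0 subr_gt0; case/andP: xy.
have [|N h] := @expr_small y (e / (1 - x / y)^-1) _ (divr_gt0 e0 K0).
  by rewrite ltW.
exists N => n /h; rewrite ltr_pdivlMr //; apply: le_lt_trans.
rewrite (expr_ratio x n y0) mulrCA; apply: ler_wpM2l; first by rewrite exprn_ge0 // ltW.
apply: le_trans (geo_linear n xy); rewrite ler_wpM2r ?ler_nat //.
by rewrite exprn_ge0; case/andP: xy.
Qed.

End geometric.

Section complex_limits.
Context {R : realType}.
Implicit Types (u v f : nat -> R[i]) (l c : R[i]).

Lemma ccvg_unique u l c : u @ \oo --> l -> u @ \oo --> c -> l = c.
Proof. exact: cvg_unique. Qed.

Lemma ccvg_le u l c (B : R) N : u @ \oo --> l ->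
  (forall n, (N <= n)%N -> cmod (u n - c) <= B) -> cmod (l - c) <= B.
Proof.
move=> /ccvgP h k; apply/ler_addgt0Pr => e /h[M {}h].
have := h _ (leq_maxr N M); have := k _ (leq_maxl N M).
have := cmod_tri (u (maxn N M)) l c; rewrite [cmod (l - u _)]cmodC; lra.
Qed.

Lemma ccvg_squeeze u v l (b : nat -> R) : u @ \oo --> l ->
  (forall n, cmod (v n - u n) <= b n) ->
  (forall e, 0 < e -> exists N, forall n, (N <= n)%N -> b n < e) ->
  v @ \oo --> l.
Proof.
move=> /ccvgP hu hv hb; apply/ccvgP => e e0.
have e20 : 0 < e / 2 by lra.
have [N1 h1] := hu _ e20; have [N2 h2] := hb _ e20.
exists (maxn N1 N2) => n; rewrite geq_max => /andP[/h1 k1 /h2 k2].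
have := cmod_tri (u n) (v n) l; have := hv n; lra.
Qed.

(** Absolute convergence is reduced to real series, one for each component. *)
Lemma ccvg_series f (A x : R) : 0 <= x < 1 ->
  (forall j, cmod (f j) <= A * x ^+ j) -> cvgn (series f).
Proof.
move=> xb h.
have cvgR (g : nat -> R) : (forall j, `|g j| <= A * x ^+ j) -> cvgn (series g).
  move=> hg; apply: normed_cvg; apply: (series_le_cvg _ _ hg) => //.
  - by move=> n /=; rewrite (le_trans (normr_ge0 (g n))).
  - by apply: is_cvg_geometric_series; rewrite ger0_norm; case/andP: xb.
have /cvgrPdist_lt hR : cvgn (series (fun j => complex.Re (f j))).
  by apply: cvgR => j; exact: le_trans (cmod_Re _) (h j).
have /cvgrPdist_lt hI : cvgn (series (fun j => complex.Im (f j))).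
  by apply: cvgR => j; exact: le_trans (cmod_Im _) (h j).
set lR := limn _ in hR; set lI := limn _ in hI.
apply/cvg_ex; exists (lR +i* lI); apply/ccvgP => e e0.
have e20 : 0 < e / 2 by lra.
have [N1 _ h1] := hR _ e20; have [N2 _ h2] := hI _ e20.
exists (maxn N1 N2) => n; rewrite geq_max => /andP[/h1 /= k1 /h2 /= k2].
rewrite (le_lt_trans (cmod_le _)) //.
have E : series f n = series (fun j => complex.Re (f j)) n +i*
                      series (fun j => complex.Im (f j)) n.
  rewrite /series /=; elim: n {k1 k2} => [|n IH]; first by rewrite !big_geq.
  by rewrite !big_nat_recr //= IH; case: (f n).
rewrite E /=; rewrite distrC in k1; rewrite distrC in k2; lra.
Qed.

End complex_limits.

(** * Sums and products of power series *)

Section power_series.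
Context {R : realType}.
Implicit Types (a b : nat -> R[i]) (z w u : R[i]) (s t A B : R).

Definition PS a z : R[i] := limn (psum a z).

Definition gbound a s A := forall j, cmod (a j) * s ^+ j <= A.

(** Geometric boundedness of the coefficients stands for convergence: [geo a s]
    holds for every [s] below the radius of convergence and for none above it. *)
Definition geo a s := exists A, gbound a s A.

Lemma psumE a z n : psum a z n = \sum_(j < n) a j * z ^+ j.
Proof. by rewrite /psum /series /= big_mkord. Qed.

Lemma psumS a z n : psum a z n.+1 = psum a z n + a n * z ^+ n.
Proof. by rewrite !psumE big_ord_recr. Qed.

Lemma PS_lim a z l : psum a z @ \oo --> l -> PS a z = l.
Proof. by move=> h; apply: cvg_lim. Qed.

Lemma gbound_ge0 a s A : gbound a s A -> 0 <= A.
Proof. by move/(_ 0%N); rewrite expr0 mulr1; apply: le_trans; exact: cmod_ge0. Qed.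

Lemma gbound_le a s t A : 0 <= t <= s -> gbound a s A -> gbound a t A.
Proof.
move=> /andP[t0 ts] h j; apply: le_trans (h j).
by apply: ler_wpM2l; rewrite ?cmod_ge0 // lerXn2r ?nnegrE // (le_trans t0).
Qed.

Lemma geo_le a s t : 0 <= t <= s -> geo a s -> geo a t.
Proof. by move=> ts [A h]; exists A; exact: gbound_le h. Qed.

Lemma ratio_lt1 s z : cmod z < s -> 0 <= cmod z / s < 1.
Proof.
move=> zs; have s0 := le_lt_trans (cmod_ge0 z) zs.
by rewrite ltr_pdivrMr // mul1r zs divr_ge0 ?cmod_ge0 // ltW.
Qed.

Lemma term_bound a s A z j : 0 < s -> gbound a s A ->
  cmod (a j * z ^+ j) <= A * (cmod z / s) ^+ j.
Proof.
move=> s0 h; rewrite cmodM cmodX expr_div_n mulrA ler_pdivlMr ?exprn_gt0 //.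
by rewrite mulrAC; apply: ler_wpM2r; rewrite ?exprn_ge0 ?cmod_ge0.
Qed.

Lemma PS_cvg a s A z : gbound a s A -> cmod z < s -> psum a z @ \oo --> PS a z.
Proof.
move=> h zs; have s0 := le_lt_trans (cmod_ge0 z) zs.
apply: (@ccvg_series _ _ A _ (ratio_lt1 zs)) => j; exact: term_bound.
Qed.

Lemma PS_tail a s A z n : gbound a s A -> cmod z < s ->
  cmod (PS a z - psum a z n) <= A * ((cmod z / s) ^+ n / (1 - cmod z / s)).
Proof.
move=> h zs; have s0 := le_lt_trans (cmod_ge0 z) zs.
apply: (ccvg_le (N := n) (PS_cvg h zs)) => m nm.
rewrite !psumE -!(big_mkord xpredT (fun j => a j * z ^+ j)).
rewrite (big_cat_nat (n := n)) //= addrAC subrr add0r.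
apply: le_trans (cmod_sum _ _ _) _.
apply: (le_trans (y := \sum_(n <= i < m) A * (cmod z / s) ^+ i)).
  by apply: ler_sum => i _; exact: term_bound.
rewrite -big_distrr /=; apply: ler_wpM2l; first exact: gbound_ge0 h.
exact: geo_tail (ratio_lt1 zs).
Qed.

Lemma PS_bound a s A z : gbound a s A -> cmod z < s ->
  cmod (PS a z) <= A / (1 - cmod z / s).
Proof.
move=> h zs; have := PS_tail 0 h zs.
by rewrite psumE big_ord0 subr0 expr0 mul1r.
Qed.

Lemma PS_ext a b z : a =1 b -> PS a z = PS b z.
Proof. by move=> ab; congr (PS _ z); apply/funext. Qed.

Lemma PS0 a : PS a 0 = a 0%N.
Proof.
apply: PS_lim; apply/ccvgP => e e0; exists 1%N => -[//|n] _.
rewrite psumE big_ord_recl /= expr0 mulr1 big1 ?addr0 ?subrr ?cmod0 // => i _.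
by rewrite expr0n mulr0.
Qed.

Lemma PSD a b s z : geo a s -> geo b s -> cmod z < s ->
  PS (fun j => a j + b j) z = PS a z + PS b z.
Proof.
move=> [A ha] [B hb] zs; apply: PS_lim.
have -> : psum (fun j => a j + b j) z = psum a z \+ psum b z.
  apply/funext => n /=; rewrite !psumE -big_split /=.
  by apply: eq_bigr => j _; rewrite mulrDl.
by apply: cvgD; [exact: PS_cvg ha zs|exact: PS_cvg hb zs].
Qed.

Lemma PSZ c a s z : geo a s -> cmod z < s -> PS (fun j => c * a j) z = c * PS a z.
Proof.
move=> [A ha] zs; apply: PS_lim.
have -> : psum (fun j => c * a j) z = (fun n => c * psum a z n).
  apply/funext => n /=; rewrite !psumE big_distrr /=.
  by apply: eq_bigr => j _; rewrite mulrA.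
apply: cvgM; [exact: cvg_cst|exact: PS_cvg ha zs].
Qed.

Lemma PS_rot c a z : PS (fun j => a j * c ^+ j) z = PS a (c * z).
Proof.
congr (limn _); apply/funext => n; rewrite !psumE.
by apply: eq_bigr => j _; rewrite exprMn mulrA.
Qed.

Lemma geoD a b s : geo a s -> geo b s -> 0 <= s -> geo (fun j => a j + b j) s.
Proof.
move=> [A ha] [B hb] s0; exists (A + B) => j.
apply: le_trans (lerD (ha j) (hb j)); rewrite -mulrDl.
by apply: ler_wpM2r; rewrite ?exprn_ge0 ?cmodD.
Qed.

Lemma geoZ c a s : geo a s -> geo (fun j => c * a j) s.
Proof.
move=> [A ha]; exists (cmod c * A) => j.
by rewrite cmodM -mulrA; apply: ler_wpM2l; rewrite ?cmod_ge0.
Qed.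

Lemma geo_rot c a s : cmod c = 1 -> geo a s -> geo (fun j => a j * c ^+ j) s.
Proof.
by move=> c1 [A ha]; exists A => j; rewrite cmodM cmodX c1 expr1n mulr1.
Qed.

Definition cprod a b n : R[i] := \sum_(i < n.+1) a i * b (n - i)%N.

Lemma gbound_cprod a b s t A B : gbound a s A -> gbound b s B -> 0 <= t < s ->
  gbound (cprod a b) t (A * B / (1 - t / s)).
Proof.
move=> ha hb /andP[t0 ts] n; have s0 := le_lt_trans t0 ts.
have x01 : 0 <= t / s < 1.
  by rewrite ltr_pdivrMr // mul1r ts andbT divr_ge0 // ltW.
have h1 : cmod (cprod a b n) * s ^+ n <= n.+1%:R * (A * B).
  apply: (le_trans (y := \sum_(i < n.+1) A * B)); last first.
    by rewrite sumr_const card_ord mulr_natl.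
  apply: (le_trans (y := \sum_(i < n.+1) cmod (a i * b (n - i)%N) * s ^+ n)).
    by rewrite -big_distrl /=; apply: ler_wpM2r; rewrite ?cmod_sum // exprn_ge0 // ltW.
  apply: ler_sum => i _.
  have -> : s ^+ n = s ^+ i * s ^+ (n - i) by rewrite -exprD subnKC // -ltnS.
  rewrite cmodM mulrACA; apply: ler_pM => //;
    by rewrite mulr_ge0 ?cmod_ge0 // exprn_ge0 // ltW.
apply: (le_trans (y := n.+1%:R * (A * B) * (t / s) ^+ n)).
  by rewrite (expr_ratio t n s0) [leLHS]mulrA; apply: ler_wpM2r => //; rewrite exprn_ge0 //; case/andP: x01.
rewrite [n.+1%:R * _]mulrC -[leLHS]mulrA; apply: ler_wpM2l.
  by rewrite mulr_ge0 ?(gbound_ge0 ha) ?(gbound_ge0 hb).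
exact: geo_linear.
Qed.

Lemma geo_cprod a b s t : geo a s -> geo b s -> 0 <= t < s -> geo (cprod a b) t.
Proof. by move=> [A ha] [B hb] ts; eexists; exact: gbound_cprod ha hb ts. Qed.

Lemma psum_cprod a b z n :
  psum (cprod a b) z n = \sum_(i < n) a i * z ^+ i * psum b z (n - i)%N.
Proof.
elim: n => [|n IH]; first by rewrite psumE !big_ord0.
rewrite psumS IH big_ord_recr /= subSnn psumS [psum b z 0]psumE big_ord0 add0r.
rewrite /cprod big_ord_recr /= subnn mulrDl addrA; congr (_ + _); last first.
  by rewrite expr0 mulr1 mulrAC.
rewrite big_distrl /= -big_split /=; apply: eq_bigr => i _.
rewrite subSn; last exact: ltnW.
rewrite psumS mulrDr; congr (_ + _); rewrite mulrACA -exprD subnKC //; exact: ltnW.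
Qed.

(** Mertens' theorem with a rate: the error of the partial sums is at most the
    number of terms times a geometric term. *)
Lemma PS_cprod a b s z : geo a s -> geo b s -> cmod z < s ->
  PS (cprod a b) z = PS a z * PS b z.
Proof.
move=> [A ha] [B hb] zs; apply: PS_lim.
set x := cmod z / s; have x01 : 0 <= x < 1 by exact: ratio_lt1.
have x1 : 0 < 1 - x by rewrite subr_gt0; case/andP: x01.
have s0 := le_lt_trans (cmod_ge0 z) zs.
have A0 := gbound_ge0 ha; have B0 := gbound_ge0 hb.
apply: (@ccvg_squeeze _ (fun n => psum a z n * PS b z) _ _
          (fun n => n%:R * x ^+ n * (A * B / (1 - x)))).
- by apply: cvgM; [exact: PS_cvg ha zs|exact: cvg_cst].
- move=> n; rewrite psum_cprod psumE big_distrl /= -sumrB.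
  apply: le_trans (cmod_sum _ _ _) _.
  apply: (le_trans (y := \sum_(i < n) x ^+ n * (A * B / (1 - x)))); last first.
    by rewrite sumr_const card_ord -[leRHS]mulrA mulr_natl.
  apply: ler_sum => i _; rewrite -mulrBr cmodM.
  apply: (le_trans (y := A * x ^+ i * (B * (x ^+ (n - i) / (1 - x))))).
    apply: ler_pM; rewrite ?cmod_ge0 //; first exact: term_bound.
    by rewrite cmodC; exact: PS_tail.
  have -> : x ^+ n = x ^+ i * x ^+ (n - i) by rewrite -exprD subnKC // ltnW.
  apply: eq_ler.
  by move: (x ^+ i) (x ^+ (n - i)) => p r; ring.
- move=> e e0; have C0 : 0 < A * B / (1 - x) + 1.
    by rewrite ltr_wpDl // divr_ge0 ?mulr_ge0 // ltW.
  have [N h] := linear_expr_small x01 (divr_gt0 e0 C0); exists N => n /h.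
  rewrite ltr_pdivlMr //; apply: le_lt_trans; apply: ler_wpM2l; last by rewrite lerDl.
  by rewrite mulr_ge0 // exprn_ge0 //; case/andP: x01.
Qed.

End power_series.

(** * Re-expansion of power series *)

Section recentering.
Context {R : realType}.
Implicit Types (a b : nat -> R[i]) (z w u : R[i]) (s t A B : R).

(** Coefficients of the [n]-th derivative divided by [n!]. *)
Definition dcoef a n j : R[i] := 'C(j + n, n)%:R * a (j + n)%N.

Definition recenter a w n : R[i] := PS (dcoef a n) w.

Lemma binomial_term_le (x y : R) m n : 0 <= x -> 0 <= y -> (n <= m)%N ->
  'C(m, n)%:R * x ^+ (m - n) * y ^+ n <= (x + y) ^+ m.
Proof.
move=> x0 y0 nm; rewrite exprDn (bigD1 (Ordinal (nm : (n < m.+1)%N))) //=.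
rewrite -mulrA mulr_natl lerDl sumr_ge0 // => i _.
by rewrite mulrn_wge0 // mulr_ge0 // exprn_ge0.
Qed.

Lemma gbound_dcoef a s t A n : gbound a s A -> 0 <= t < s ->
  gbound (dcoef a n) t (A / (s - t) ^+ n).
Proof.
move=> h /andP[t0 ts] j; have st0 : 0 < s - t by rewrite subr_gt0.
rewrite ler_pdivlMr ?exprn_gt0 // /dcoef cmodM cmod_nat; apply: le_trans (h (j + n)%N).
rewrite [_%:R * _]mulrC -!mulrA; apply: ler_wpM2l; rewrite ?cmod_ge0 //.
have := @binomial_term_le t (s - t) (j + n) n t0 (ltW st0) (leq_addl _ _).
by rewrite addnK mulrA [t + _]addrC subrK.
Qed.

Lemma psum_recenter a w u N :
  psum a (w + u) N = \sum_(n < N) u ^+ n * psum (dcoef a n) w (N - n)%N.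
Proof.
elim: N => [|N IH]; first by rewrite psumE !big_ord0.
rewrite psumS IH; transitivity (\sum_(n < N.+1) (u ^+ n * psum (dcoef a n) w (N - n)%N
    + u ^+ n * (dcoef a n (N - n)%N * w ^+ (N - n)))); last first.
  apply: eq_bigr => n _; rewrite -mulrDr -psumS subSn //; exact: (ltn_ord n).
rewrite big_split /= [X in _ = X + _]big_ord_recr /= subnn [psum _ _ 0]psumE.
rewrite big_ord0 mulr0 addr0; congr (_ + _).
rewrite exprDn big_distrr /=; apply: eq_bigr => n _.
rewrite /dcoef subnK; last exact: (ltn_ord n).
rewrite -mulr_natl; move: (w ^+ _) (u ^+ _) => x y; ring.
Qed.

Lemma gbound_dcoefC a s t A n : gbound a s A -> 0 < t <= s ->
  gbound (dcoef a n) (s - t) (A / t ^+ n).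
Proof.
move=> h ts; have := @gbound_dcoef a s (s - t) A n h; rewrite opprB addrCA subrr.
by rewrite addr0; apply; case/andP: ts => t0 ts; rewrite subr_ge0 ts gtrBl.
Qed.

Lemma gbound_recenter a s t A w : gbound a s A -> 0 < t -> cmod w + t < s ->
  gbound (recenter a w) t (A / (1 - cmod w / (s - t))).
Proof.
move=> h t0 wts n; have w0 := cmod_ge0 w.
have ts : 0 < t <= s by rewrite t0 /=; lra.
have stw : cmod w < s - t by lra.
rewrite -ler_pdivlMr ?exprn_gt0 // mulrAC.
exact: PS_bound (gbound_dcoefC n h ts) stw.
Qed.

(** Re-expanding a power series at a point [w] of its disc: the double series
    converges absolutely as soon as [cmod w + cmod u < s]. *)
Lemma PS_recenter a s w u : geo a s -> cmod w + cmod u < s ->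
  PS a (w + u) = PS (recenter a w) u.
Proof.
move=> [A h] wus; have w0 := cmod_ge0 w; have u0 := cmod_ge0 u.
have A0 := gbound_ge0 h.
pose t := (s - cmod w + cmod u) / 2.
have ut : cmod u < t by rewrite /t; lra.
have t0 : 0 < t by lra.
have wt : cmod w < s - t by rewrite /t; lra.
have ts : 0 < t <= s by rewrite t0 /=; lra.
have wu : cmod (w + u) < s by exact: le_lt_trans (cmodD _ _) wus.
set x := cmod u / t; set y := cmod w / (s - t).
have x01 : 0 <= x < 1 by exact: ratio_lt1.
have y01 : 0 <= y < 1 by exact: ratio_lt1.
(* Common ratio for the tails in [u] and in [w]. *)
pose m := Num.max x y.
have m01 : 0 <= m < 1.
  by case/andP: x01 => x0 x1; case/andP: y01 => y0 y1; rewrite le_max x0 gt_max x1.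
have y1 : 0 < 1 - y by rewrite subr_gt0; case/andP: y01.
symmetry; apply: PS_lim.
apply: (@ccvg_squeeze _ (psum a (w + u)) _ _ (fun n => n%:R * m ^+ n * (A / (1 - y)))).
- exact: PS_cvg h wu.
- move=> N; rewrite psum_recenter psumE -sumrB; apply: le_trans (cmod_sum _ _ _) _.
  apply: (le_trans (y := \sum_(i < N) m ^+ N * (A / (1 - y)))); last first.
    by rewrite sumr_const card_ord -[leRHS]mulrA mulr_natl.
  apply: ler_sum => n _; rewrite mulrC -mulrBr cmodM cmodX.
  apply: (le_trans (y := cmod u ^+ n * (A / t ^+ n * (y ^+ (N - n) / (1 - y))))).
    apply: ler_wpM2l; first by rewrite exprn_ge0.
    exact: PS_tail (gbound_dcoefC n h ts) wt.
  apply: (le_trans (y := x ^+ n * y ^+ (N - n) * (A / (1 - y)))).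
    apply: eq_ler.
    have -> : x ^+ n = cmod u ^+ n / t ^+ n by rewrite /x expr_div_n.
    move: (cmod u ^+ n) (t ^+ n)^-1 (y ^+ (N - n)) (1 - y)^-1 => p r q v.
    ring.
  apply: ler_wpM2r; first by rewrite divr_ge0 // ltW.
  have -> : m ^+ N = m ^+ n * m ^+ (N - n) by rewrite -exprD subnKC // ltnW.
  case/andP: x01 => x0 _; case/andP: y01 => y0 _; case/andP: m01 => m0 _.
  by apply: ler_pM; rewrite ?exprn_ge0 // lerXn2r ?nnegrE // /m le_max lexx ?orbT.
- move=> e e0; have C0 : 0 < A / (1 - y) + 1 by rewrite ltr_wpDl // divr_ge0 // ltW.
  have [N hN] := linear_expr_small m01 (divr_gt0 e0 C0); exists N => n /hN.
  rewrite ltr_pdivlMr //; apply: le_lt_trans; apply: ler_wpM2l; last by rewrite lerDl.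
  by rewrite mulr_ge0 // exprn_ge0 //; case/andP: m01.
Qed.

End recentering.

(** * Zeros and inverses of power series *)

Section local_behaviour.
Context {R : realType}.
Implicit Types (a b : nat -> R[i]) (z w u : R[i]) (s t A B e : R).

Lemma gbound_shift a s A m : 0 < s -> gbound a s A ->
  gbound (fun j => a (j + m)%N) s (A / s ^+ m).
Proof. by move=> s0 h j; rewrite ler_pdivlMr ?exprn_gt0 // -mulrA -exprD. Qed.

Lemma psum_shift a m z N :
  psum a z (N + m) = psum a z m + z ^+ m * psum (fun j => a (j + m)%N) z N.
Proof.
elim: N => [|N IH]; first by rewrite [X in _ * X]psumE big_ord0 mulr0 addr0.
by rewrite addSn !psumS IH exprD; ring.
Qed.

Lemma PS_shift a s m z : geo a s -> cmod z < s ->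
  PS a z = psum a z m + z ^+ m * PS (fun j => a (j + m)%N) z.
Proof.
move=> [A h] zs; have s0 := le_lt_trans (cmod_ge0 z) zs.
apply: PS_lim; rewrite -(cvg_shiftn m) /=.
under eq_fun do rewrite psum_shift.
apply: cvgD; first exact: cvg_cst.
apply: cvgM; first exact: cvg_cst.
exact: PS_cvg (gbound_shift m s0 h) zs.
Qed.

Lemma PS_near0 a s : 0 < s -> geo a s -> forall e, 0 < e ->
  exists2 d, 0 < d <= s & forall z, cmod z < d -> cmod (PS a z - a 0%N) < e.
Proof.
move=> s0 [A h] e e0; have A0 := gbound_ge0 h.
pose x := e / (A + A + e).
have x0 : 0 < x by rewrite divr_gt0 //; lra.
have x1 : x <= 1 by rewrite ler_pdivrMr; lra.
exists (s * (x / 2)).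
  by apply/andP; split; [apply: mulr_gt0; lra|rewrite ler_piMr; lra].
move=> z zd; have zs : cmod z < s.
  by apply: lt_le_trans zd _; rewrite ler_piMr; lra.
have := PS_tail 1 h zs; rewrite psumE big_ord1 expr0 expr1 mulr1.
move=> H; apply: le_lt_trans H _.
set y := cmod z / s; have yx : y < x / 2 by rewrite ltr_pdivrMr // mulrC.
have y0 : 0 <= y by rewrite divr_ge0 ?cmod_ge0 // ltW.
rewrite mulrA ltr_pdivrMr; last by lra.
have xE : x * (A + A + e) = e by rewrite /x divfK // gt_eqF //; lra.
have : y * A <= x / 2 * A by apply: ler_wpM2r => //; exact: ltW.
have : e * y <= e * (x / 2) by apply: ler_wpM2l => //; exact: ltW.
nra.
Qed.

(** The exponent is the index of the first nonvanishing coefficient. *)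
Lemma PS_factor a s : 0 < s -> geo a s -> (exists j, a j != 0) ->
  exists m b, [/\ geo b s, b 0%N != 0 &
    forall z, cmod z < s -> PS a z = z ^+ m * PS b z].
Proof.
move=> s0 h; have [A hA] := h => ex; pose m := ex_minn ex.
have [am mmin] : a m != 0 /\ forall j, a j != 0 -> (m <= j)%N.
  by rewrite /m; case: ex_minnP.
exists m, (fun j => a (j + m)%N); split => //.
  by eexists; exact: gbound_shift hA.
move=> z zs; rewrite (PS_shift m h zs) psumE big1 ?add0r // => i _.
by case: (eqVneq (a i) 0) => [->|/mmin]; rewrite ?mul0r // leqNgt ltn_ord.
Qed.

Lemma PS_neq0_near0 a s : 0 < s -> geo a s -> a 0%N != 0 ->
  exists2 d, 0 < d <= s & forall z, cmod z < d -> PS a z != 0.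
Proof.
move=> s0 h a0; have [|d ds hd] := PS_near0 s0 h (e := cmod (a 0%N)).
  by rewrite cmod_gt0.
exists d => // z /hd; apply: contraTneq => ->.
by rewrite sub0r cmodN ltxx.
Qed.

Lemma PS_neq0_punctured a s : 0 < s -> geo a s -> (exists j, a j != 0) ->
  exists2 d, 0 < d <= s & forall z, cmod z < d -> z != 0 -> PS a z != 0.
Proof.
move=> s0 h /(PS_factor s0 h)[m [b [hb b0 E]]].
have [d ds hd] := PS_neq0_near0 s0 hb b0; exists d => // z zd z0.
rewrite E; last by apply: lt_le_trans zd _; case/andP: ds.
by rewrite mulf_neq0 ?expf_neq0 ?hd.
Qed.

Lemma PS_eq0 a s e : 0 < s -> 0 < e -> geo a s ->
  (forall z, cmod z < e -> PS a z = 0) -> a =1 (fun=> 0).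
Proof.
move=> s0 e0 h hz j; apply/eqP; apply: contraT => aj.
have [|d /andP[d0 ds] hd] := PS_neq0_punctured s0 h; first by exists j.
pose z : R[i] := ((Num.min d e) / 2)%:C.
have m0 : 0 < Num.min d e by rewrite lt_min d0.
have zm : cmod z = Num.min d e / 2 by rewrite cmodR_ge0 // ltW // divr_gt0.
have zlt : cmod z < Num.min d e by rewrite zm; lra.
move: zlt; rewrite lt_min => /andP[zd ze].
have := hd _ zd; rewrite hz // eqxx -cmod_gt0 zm divr_gt0 //.
by move/(_ isT).
Qed.

(** The difference has a zero of infinite order. *)
Lemma PS_unique a b s e : 0 < s -> 0 < e -> geo a s -> geo b s ->
  (forall z, cmod z < e -> PS a z = PS b z) -> a =1 b.
Proof.
move=> s0 e0 ha hb hz j.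
have hN := geoZ (-1) hb; have hD := geoD ha hN (ltW s0).
have := @PS_eq0 _ s (Num.min e s) s0 _ hD; rewrite lt_min e0 s0 => /(_ isT).
have E z : cmod z < Num.min e s -> PS (fun j => a j + -1 * b j) z = 0.
  rewrite lt_min => /andP[ze zs].
  by rewrite (PSD ha hN zs) (PSZ _ hb zs) hz // mulN1r subrr.
by move=> /(_ E j) /eqP; rewrite mulN1r subr_eq0 => /eqP.
Qed.

Lemma PS_poly (p : {poly R[i]}) z : PS (fun j => p`_j) z = p.[z].
Proof.
apply: PS_lim; apply/ccvgP => e e0; exists (size p) => n pn.
by rewrite psumE (horner_coef_wide z pn) subrr cmod0.
Qed.

Lemma geo_poly (p : {poly R[i]}) s : 0 <= s -> geo (fun j => p`_j) s.
Proof.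
move=> s0; exists (\sum_(i < size p) cmod p`_i * s ^+ i) => j.
have [pj|jp] := leqP (size p) j.
  rewrite nth_default // cmod0 mul0r sumr_ge0 // => i _.
  by rewrite mulr_ge0 ?cmod_ge0 ?exprn_ge0.
rewrite (bigD1 (Ordinal jp)) //= lerDl sumr_ge0 // => i _.
by rewrite mulr_ge0 ?cmod_ge0 ?exprn_ge0.
Qed.

(** Course-of-values recursion, for sequences of coefficients that solve a
    functional equation. *)
Lemma strong_recursion (T : Type) (x0 : T) (F : nat -> (nat -> T) -> T) :
  (forall n f g, (forall i, (i < n)%N -> f i = g i) -> F n f = F n g) ->
  exists f, forall n, f n = F n f.
Proof.
move=> hF; pose fix build n : seq T :=
  if n is n'.+1 then rcons (build n') (F n' (nth x0 (build n'))) else [::].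
have sz n : size (build n) = n by elim: n => //= n IH; rewrite size_rcons IH.
have stable i n m : (i < n <= m)%N -> nth x0 (build m) i = nth x0 (build n) i.
  elim: m => [|m IH]; first by rewrite leqn0 => /andP[h /eqP E]; rewrite E in h.
  move=> /andP[h]; rewrite leq_eqVlt => /predU1P[-> //|nm] /=.
  rewrite nth_rcons sz (leq_trans h) //; apply: IH.
  by rewrite h.
exists (fun n => nth x0 (build n.+1) n) => n /=.
rewrite nth_rcons sz ltnn eqxx; apply: hF => i ni.
by rewrite (@stable i i.+1 n) // ltnSn.
Qed.

(** The recursion for the coefficients of the inverse is dominated by a geometric
    sequence; the ratio [K + 1] leaves room for the sum over the previous terms. *)
Lemma PS_inverse a s : 0 < s -> geo a s -> a 0%N != 0 ->
  exists b t, [/\ 0 < t <= s, geo b t & forall z, cmod z < t -> PS a z * PS b z = 1].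
Proof.
move=> s0 [A h] a0.
have [|b hb] := @strong_recursion R[i] 0 (fun n b => if n is n'.+1 then
    - (a 0%N)^-1 * \sum_(i < n) a i.+1 * b (n' - i)%N else (a 0%N)^-1).
  move=> [//|n] f g fg; congr (_ * _); apply: eq_bigr => i _.
  by rewrite fg // ltnS leq_subr.
(* [K - 1] bounds the coefficients of [a] relative to the first one. *)
pose K := A / cmod (a 0%N) + 1.
have c0 : 0 < cmod (a 0%N) by rewrite cmod_gt0.
have K1 : 1 <= K by rewrite /K lerDr divr_ge0 ?(gbound_ge0 h) // ltW.
have K0 : 0 < K + 1 by lra.
pose t := s / (K + 1).
have t0 : 0 < t by rewrite divr_gt0.
have ts : t <= s by rewrite ler_pdivrMr // ler_peMr ?ltW //; lra.
have gb : gbound b t (cmod (a 0%N))^-1.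
  move=> n; have [m] := ubnP n; elim: m n => // m IH [|n] nm.
    by rewrite hb expr0 mulr1 cmodV.
  rewrite hb cmodM cmodN cmodV -mulrA; apply: ler_piMr; first by rewrite invr_ge0 ltW.
  apply: (le_trans (y := \sum_(i < n.+1) (K - 1) * (K + 1)^-1 ^+ i.+1)).
    apply: (le_trans (y := \sum_(i < n.+1) cmod (a i.+1 * b (n - i)%N) * t ^+ n.+1)).
      by rewrite -big_distrl /=; apply: ler_wpM2r; rewrite ?cmod_sum // exprn_ge0 // ltW.
    apply: ler_sum => i _.
    have -> : t ^+ n.+1 = t ^+ i.+1 * t ^+ (n - i).
      by rewrite -exprD addSn subnKC // -ltnS.
    rewrite cmodM mulrACA.
    have {}IH := IH (n - i)%N (leq_ltn_trans (leq_subr i n) nm).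
    apply: (le_trans (y := (A * (K + 1)^-1 ^+ i.+1) * (cmod (a 0%N))^-1)).
      apply: ler_pM; [| |  |exact: IH].
      - by rewrite mulr_ge0 ?cmod_ge0 // exprn_ge0 // ltW.
      - by rewrite mulr_ge0 ?cmod_ge0 // exprn_ge0 // ltW.
      rewrite /t exprMn mulrA.
      apply: ler_wpM2r => //.
      by rewrite exprn_ge0 // invr_ge0 ltW.
    by rewrite mulrAC /K addrK.
  rewrite -big_distrr /=.
  have -> : \sum_(i < n.+1) (K + 1)^-1 ^+ i.+1 = \sum_(1 <= i < n.+2) (K + 1)^-1 ^+ i.
    by rewrite big_add1 /= big_mkord.
  have x01 : 0 <= (K + 1)^-1 < 1 by rewrite invr_ge0 ltW //= invf_lt1 //; lra.
  apply: le_trans (ler_wpM2l _ (geo_tail 1 n.+2 x01)) _; first by lra.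
  rewrite expr1 (_ : (K + 1)^-1 / (1 - (K + 1)^-1) = K^-1); last by field; lra.
  by rewrite ler_pdivrMr; lra.
have gt : geo b t by eexists; exact: gb.
exists b, t; rewrite t0 ts; split => // z zt.
rewrite -(@PS_cprod _ a b t) //; last by apply: geo_le (ex_intro _ A h); rewrite ltW.
have -> : PS (cprod a b) z = PS (fun j => (1%:P : {poly R[i]})`_j) z.
  apply: PS_ext => -[|n]; rewrite coefC /cprod.
    by rewrite big_ord1 subnn hb divff.
  rewrite big_ord_recl subn0 hb /= mulrA mulrN divff // mulN1r addrC.
  by apply/eqP; rewrite subr_eq0; apply/eqP; apply: eq_bigr => i _; rewrite subSS.
by rewrite PS_poly hornerC.
Qed.

End local_behaviour.

(** * Analytic germs *)

Section analytic_germs.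
Context {R : realType}.
Implicit Types (a b : nat -> R[i]) (z w u c : R[i]) (s t A B e : R).
Implicit Types (f g h : R[i] -> R[i]).

(** The terms of a convergent series are bounded. *)
Lemma cvg_geo a w : cvgn (psum a w) -> geo a (cmod w).
Proof.
move=> /cvg_ex[l /ccvgP /(_ 1 ltr01)[N hN]].
exists (\sum_(j < N) cmod (a j) * cmod w ^+ j + 2) => j.
have P k : 0 <= cmod (a k) * cmod w ^+ k by rewrite mulr_ge0 ?exprn_ge0 ?cmod_ge0.
have S0 : 0 <= \sum_(j < N) cmod (a j) * cmod w ^+ j by rewrite sumr_ge0.
have [Nj|jN] := leqP N j; last first.
  rewrite (bigD1 (Ordinal jN)) //= -addrA lerDl addr_ge0 ?sumr_ge0 //; lra.
have h1 := hN _ Nj; have h2 := hN _ (leqW Nj).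
have E : a j * w ^+ j = (psum a w j.+1 - l) - (psum a w j - l) by rewrite psumS; ring.
have := cmodB (psum a w j.+1 - l) (psum a w j - l); rewrite -E cmodM cmodX; lra.
Qed.

(** Pointwise convergence near [z] gives a geometric bound on the coefficients,
    hence all the uniformity used afterwards. *)
Lemma analyticP f z : analytic_at f z <->
  exists a s, [/\ 0 < s, geo a s & forall w, cmod (w - z) < s -> f w = PS a (w - z)].
Proof.
split=> [[a /nearC[e e0 he]]|[a [s [s0 [A hA] hf]]]].
  exists a, (e / 2); split; first by lra.
    have := he (z + (e / 2)%:C); rewrite addrC addKr cmodR_ge0; last by lra.
    move=> H; have {}H : psum a (e / 2)%:C @ \oo --> f (z + (e / 2)%:C) by apply: H; lra.
    have := @cvg_geo a (e / 2)%:C; rewrite cmodR_ge0; last by lra.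
    by apply; apply/cvg_ex; eexists; exact: H.
  by move=> w wz; rewrite (PS_lim (he w _)) //; lra.
exists a; apply/nearC; exists s => // w wz.
by rewrite hf //; exact: PS_cvg hA wz.
Qed.

Lemma analytic_ext f g z : (\forall w \near z, f w = g w) ->
  analytic_at f z -> analytic_at g z.
Proof.
move=> /nearC[e e0 he] [a /nearC[d d0 hd]]; exists a; apply/nearC.
exists (Num.min e d); first by rewrite lt_min e0.
by move=> w; rewrite lt_min => /andP[we wd]; rewrite -he //; exact: hd.
Qed.

Lemma PS_analytic a s z : geo a s -> cmod z < s -> analytic_at (PS a) z.
Proof.
move=> [A h] zs; have z0 := cmod_ge0 z.
apply/analyticP; exists (recenter a z), ((s - cmod z) / 2); split; first by lra.
  by eexists; apply: gbound_recenter h _ _; lra.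
move=> w wz; rewrite -{1}(subrK z w) [w - z + z]addrC.
by apply: (@PS_recenter _ a s); [exists A|lra].
Qed.

Lemma analytic_near f z : analytic_at f z -> \forall w \near z, analytic_at f w.
Proof.
move=> /analyticP[a [s [s0 h hf]]]; apply/nearC; exists s => // w wz.
apply: (@analytic_ext (fun v => PS a (v - z))).
  apply/nearC; exists (s - cmod (w - z)); first by rewrite subr_gt0.
  move=> v vw; rewrite hf //; have := cmod_tri w v z; lra.
have /analyticP[b [t [t0 hb ht]]] := PS_analytic h wz.
apply/analyticP; exists b, t; split; [exact: t0|exact: hb|move=> v vw].
have E : v - w = v - z - (w - z) by ring.
by rewrite ht -?E // E.
Qed.

Lemma analytic_cst c z : analytic_at (fun=> c) z.
Proof.
apply/analyticP; exists (fun j => (c%:P)`_j), 1; split=> //; first exact: geo_poly.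
by move=> w _; rewrite PS_poly hornerC.
Qed.

Lemma analytic_poly (p : {poly R[i]}) z : analytic_at (fun w => p.[w]) z.
Proof.
apply: (@analytic_ext (PS (fun j => p`_j))).
  by apply/nearC; exists 1 => // w _; rewrite PS_poly.
apply: (@PS_analytic _ (cmod z + 1)); last by lra.
by apply: geo_poly; have := cmod_ge0 z; lra.
Qed.

Lemma analytic_id z : analytic_at (fun w => w) z.
Proof.
apply: analytic_ext (analytic_poly 'X z).
by apply/nearC; exists 1 => // w _; rewrite hornerX.
Qed.

Lemma analyticM f g z : analytic_at f z -> analytic_at g z ->
  analytic_at (fun w => f w * g w) z.
Proof.
move=> /analyticP[a [s [s0 ha hf]]] /analyticP[b [t [t0 hb hg]]].
pose m := Num.min s t; have m0 : 0 < m by rewrite lt_min s0.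
have ha' : geo a m by apply: geo_le ha; rewrite ltW // ge_min lexx.
have hb' : geo b m by apply: geo_le hb; rewrite ltW // ge_min lexx orbT.
apply/analyticP; exists (cprod a b), (m / 2); split; first by lra.
  by apply: geo_cprod ha' hb' _; lra.
move=> w wz; have wm : cmod (w - z) < m by lra.
move: (wm); rewrite lt_min => /andP[ws wt].
by rewrite (PS_cprod ha' hb' wm) hf ?hg.
Qed.

Lemma analyticD f g z : analytic_at f z -> analytic_at g z ->
  analytic_at (fun w => f w + g w) z.
Proof.
move=> /analyticP[a [s [s0 ha hf]]] /analyticP[b [t [t0 hb hg]]].
pose m := Num.min s t; have m0 : 0 < m by rewrite lt_min s0.
have ha' : geo a m by apply: geo_le ha; rewrite ltW // ge_min lexx.
have hb' : geo b m by apply: geo_le hb; rewrite ltW // ge_min lexx orbT.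
apply/analyticP; exists (fun j => a j + b j), m; split=> //.
  by apply: geoD => //; exact: ltW.
move=> w wm; move: (wm); rewrite lt_min => /andP[ws wt].
by rewrite (PSD ha' hb' wm) hf ?hg.
Qed.

Lemma analyticB f g z : analytic_at f z -> analytic_at g z ->
  analytic_at (fun w => f w - g w) z.
Proof.
move=> hf hg; apply: (@analytic_ext (fun w => f w + -1 * g w)).
  by apply/nearC; exists 1 => // w _; rewrite mulN1r.
exact: analyticD hf (analyticM (analytic_cst _ _) hg).
Qed.

Lemma analyticX f n z : analytic_at f z -> analytic_at (fun w => f w ^+ n) z.
Proof.
move=> hf; elim: n => [|n IH]; first exact: analytic_cst.
apply: analytic_ext (analyticM hf IH).
by apply/nearC; exists 1 => // w _; rewrite exprS.
Qed.

Lemma analyticV f z : analytic_at f z -> f z != 0 ->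
  analytic_at (fun w => (f w)^-1) z.
Proof.
move=> /analyticP[a [s [s0 ha hf]]].
rewrite hf ?subrr ?cmod0 // PS0 => a0.
have [b [t [/andP[t0 ts] hb hab]]] := PS_inverse s0 ha a0.
apply/analyticP; exists b, t; split=> // w wt.
rewrite hf; last by rewrite (lt_le_trans wt).
have E := hab _ wt; have n0 : PS a (w - z) != 0.
  by apply: contra_eq_neq E => ->; rewrite mul0r eq_sym oner_eq0.
by apply: (mulfI n0); rewrite divff ?E.
Qed.

Lemma analytic_rot f c z : cmod c = 1 -> analytic_at f (c * z) ->
  analytic_at (fun w => f (c * w)) z.
Proof.
move=> c1 /analyticP[a [s [s0 ha hf]]].
apply/analyticP; exists (fun j => a j * c ^+ j), s; split=> //; first exact: geo_rot.
by move=> w wz; rewrite hf ?PS_rot ?mulrBr // -mulrBr cmodM c1 mul1r.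
Qed.

Lemma analytic_continuous f z : analytic_at f z -> forall e, 0 < e ->
  \forall w \near z, cmod (f w - f z) < e.
Proof.
move=> /analyticP[a [s [s0 ha hf]]] e e0; apply/nearC.
have [d /andP[d0 ds] hd] := PS_near0 s0 ha e0; exists d; first exact: d0.
have fz : f z = a 0%N by rewrite hf ?subrr ?cmod0 ?PS0.
by move=> w wd; rewrite fz (hf w (lt_le_trans wd ds)); exact: hd.
Qed.

(** By continuity. The punctured neighbourhoods that come with meromorphy are
    filled in this way. *)
Lemma analytic_eq_punctured f g z : analytic_at f z -> analytic_at g z ->
  (\forall w \near z^', f w = g w) -> f z = g z.
Proof.
move=> hf hg hfg; apply/eqP; rewrite -subr_eq0 -cmod_eq0.
rewrite eq_le cmod_ge0 andbT; apply/ler_addgt0Pr => e e0.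
have e20 : 0 < e / 2 by lra.
near z^' => w.
have k1 : cmod (f w - f z) < e / 2.
  by near: w; apply: nbhs_dnbhs; exact: analytic_continuous hf _ e20.
have k2 : cmod (g w - g z) < e / 2.
  by near: w; apply: nbhs_dnbhs; exact: analytic_continuous hg _ e20.
have E : f w = g w by near: w.
rewrite E in k1.
have := cmod_tri (g w) (f z) (g z); rewrite (cmodC (f z) (g w)); lra.
Unshelve. all: by end_near.
Qed.

(** The centre lies in the disc of the re-expansion at a sufficiently close point. *)
Lemma analytic_zero f w : analytic_at f w ->
  (forall d, 0 < d -> exists2 v, cmod (v - w) < d & \forall z \near v, f z = 0) ->
  \forall z \near w, f z = 0.
Proof.
move=> /analyticP[a [s [s0 ha hf]]] hz.
have [|v vw /nearC[e e0 he]] := hz (s / 4); first by lra.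
set u := v - w in vw; have u0 := cmod_ge0 u.
have [A hA] := ha.
have hr : geo (recenter a u) (s / 2).
  by eexists; apply: gbound_recenter hA _ _; lra.
have s20 : 0 < s / 2 by lra.
pose m := Num.min e (s / 2); have m0 : 0 < m by rewrite lt_min e0.
have r0 : recenter a u =1 (fun=> 0).
  apply: (PS_eq0 s20 m0 hr) => x; rewrite lt_min => /andP[xe xs].
  rewrite -(PS_recenter ha); last by lra.
  have E : x + v - w = u + x by rewrite /u; ring.
  rewrite -E -hf; first by rewrite he // addrK.
  by rewrite E; apply: le_lt_trans (cmodD _ _) _; lra.
apply/nearC; exists (s / 4); first by lra.
move=> z zw; rewrite hf; last by lra.
have E : z - w = u + (z - w - u) by ring.
have zu : cmod (z - w - u) < s / 2 by apply: le_lt_trans (cmodB _ _) _; lra.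
rewrite E (PS_recenter ha); last by lra.
rewrite (PS_ext _ r0); apply: PS_lim.
rewrite (_ : psum _ _ = fun=> 0); first exact: cvg_cst.
by apply/funext => n; rewrite psumE big1 // => i _; rewrite mul0r.
Qed.

Lemma analytic_factor f z : analytic_at f z -> ~ (\forall w \near z, f w = 0) ->
  exists n g, [/\ analytic_at g z, g z != 0 &
    \forall w \near z, f w = (w - z) ^+ n * g w].
Proof.
move=> /analyticP[a [s [s0 ha hf]]] hn.
have [|m [b [hb b0 E]]] := PS_factor s0 ha.
  apply: contrapT => /forallNP h0; apply: hn; apply/nearC; exists s => // w wz.
  rewrite hf // (@PS_ext _ _ (fun j => (0 : {poly R[i]})`_j)) ?PS_poly ?horner0 //.
  by move=> j; rewrite coef0; have /negP := h0 j; rewrite negbK => /eqP.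
exists m, (fun w => PS b (w - z)); split.
- by apply/analyticP; exists b, s.
- by rewrite subrr PS0.
- by apply/nearC; exists s => // w wz; rewrite hf // E.
Qed.

Lemma analytic_isolated f z : analytic_at f z -> ~ (\forall w \near z, f w = 0) ->
  \forall w \near z^', f w != 0.
Proof.
move=> hf hn; have [n [g [hg g0 /nearC[d d0 hd]]]] := analytic_factor hf hn.
have c0 : 0 < cmod (g z) by rewrite cmod_gt0.
have /nearC[e e0 he] := analytic_continuous hg c0.
apply/dnearC; exists (Num.min d e); first by rewrite lt_min d0.
move=> w; rewrite lt_min => /andP[wd we] wz; rewrite hd //.
rewrite mulf_neq0 ?expf_neq0 ?subr_eq0 //.
by apply: contraTneq (he _ we) => ->; rewrite sub0r cmodN ltxx.
Qed.

End analytic_germs.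

(** * Compactness of closed discs *)

Section compactness.
Context {R : realType}.
Implicit Types (z w v : R[i]) (e d t : R).

Lemma open_cball w e : open [set z : R[i] | cmod (z - w) < e].
Proof.
rewrite openE => z /= zw; apply/nearC; exists (e - cmod (z - w)).
  by rewrite subr_gt0.
by move=> v vz /=; have := cmod_tri z v w; lra.
Qed.

Lemma compact_closed_disc t : compact [set z : R[i] | cmod z <= t].
Proof.
pose f (p : R * R) : R[i] := p.1 +i* p.2.
have fc : continuous f.
  move=> p; apply/cvgrPdist_lt => -[e e']; rewrite ltcE /= => /andP[/eqP -> e0].
  exists (ball p.1 (e / 2), ball p.2 (e / 2)) => /=.
    by split; apply: nbhsx_ballx; lra.
  move=> q [/= h1 h2]; rewrite normE ltcR; apply: le_lt_trans (cmod_le _) _.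
  move: h1 h2; rewrite /ball /=; lra.
have cK : compact (f @` (`[-t, t] `*` `[-t, t])).
  apply: continuous_compact; first exact: continuous_subspaceT.
  by apply: compact_setX; exact: segment_compact.
apply: subclosed_compact cK _.
  rewrite -openC openE => z /= /negP; rewrite -ltNge => tz.
  apply/nearC; exists (cmod z - t); first by rewrite subr_gt0.
  move=> v vz /=; apply/negP; rewrite -ltNge.
  have := cmod_tri v z 0; rewrite !subr0 (cmodC z v); lra.
move=> z /= zt; exists (complex.Re z, complex.Im z); last by case: z zt.
have := cmod_Re z; have := cmod_Im z; rewrite /= !in_itv /= -!ler_norml => h1 h2.
by split; [exact: le_trans h2 zt|exact: le_trans h1 zt].
Qed.

Lemma interior_point w r d : cmod w = r -> 0 < r -> 0 < d ->
  exists2 z, cmod (z - w) < d & cmod z < r.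
Proof.
move=> wr r0 d0; pose k := Num.min d r / 2.
have m0 : 0 < Num.min d r by rewrite lt_min d0.
have [kd kr] : k < d /\ k < r.
  have : Num.min d r / 2 < Num.min d r by lra.
  by rewrite -/k lt_min => /andP[].
have k0 : 0 < k by rewrite /k; lra.
exists (w * (1 - k / r)%:C).
  have -> : w * (1 - k / r)%:C - w = w * (- (k / r))%:C.
    by rewrite rmorphB rmorph1 rmorphN; ring.
  rewrite cmodM wr cmodR normrN ger0_norm; last by rewrite divr_ge0 ?ltW.
  by rewrite mulrCA divff ?mulr1 // gt_eqF.
rewrite cmodM wr cmodR_ge0; last by rewrite subr_ge0 ler_pdivrMr //; lra.
by rewrite mulrBr mulr1 mulrCA divff ?mulr1 ?gt_eqF //; lra.
Qed.

(** Lebesgue numbers, in the form that makes local radii uniform. *)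
Lemma disc_uniform t (P : R -> R[i] -> Prop) :
  (forall w, cmod w <= t -> exists2 e, 0 < e &
     forall v d, cmod (v - w) < e -> 0 < d < e -> P d v) ->
  exists2 e, 0 < e & forall d v, 0 < d < e -> cmod v <= t -> P d v.
Proof.
move=> h; have := @compact_closed_disc t.
move=> /compact_near_coveringP /(_ R (0 : R)^'+ P _) [].
  move=> w /= /h[e e0 he].
  exists ([set v | cmod (v - w) < e], [set d | 0 < d < e]) => /=; last first.
    by move=> [v d] /= [h1 h2]; exact: he.
  split; first by apply/nearC; exists e.
  by exists e => // d; rewrite /ball_ /= sub0r normrN => de d0; rewrite d0 (le_lt_trans _ de) // ler_norm.
move=> e /= e0 he; exists e => // d v /andP[d0 de] vt; apply: (he d) => //=.
by rewrite sub0r normrN ger0_norm // ltW.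
Qed.

Lemma disc_cover t (e : R[i] -> R) : (forall w, cmod w <= t -> 0 < e w) ->
  exists2 l : seq R[i], (forall c, c \in l -> cmod c <= t) &
    forall w, cmod w <= t -> exists2 c, c \in l & cmod (w - c) < e c.
Proof.
move=> e0; have := @compact_closed_disc t; rewrite compact_cover.
set K := [set z : R[i] | cmod z <= t].
move=> /(_ _ K (fun c => [set z : R[i] | cmod (z - c) < e c])) [].
- by move=> c _; exact: open_cball.
- by move=> w wt; exists w => //=; rewrite subrr cmod0; exact: e0.
move=> D hD hK; exists (finmap.enum_fset D) => [c /hD|w /hK[c /= cD cw]].
  by rewrite inE.
by exists c.
Qed.

End compactness.

(** * Points of the unit circle *)

Section circle.
Context {R : realType}.
Implicit Types (x y : R).

Definition cis x : R[i] := cos x +i* sin x.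

Lemma cisD x y : cis (x + y) = cis x * cis y.
Proof. by rewrite /cis cosD sinD; simpc; rewrite addrC [sin _ * _ + _]addrC. Qed.

Lemma cis0 : cis 0 = 1. Proof. by rewrite /cis cos0 sin0. Qed.

Lemma cisX x n : cis x ^+ n = cis (n%:R * x).
Proof.
elim: n => [|n IH]; first by rewrite mul0r cis0.
by rewrite exprS IH -cisD -natr1 mulrDl mul1r addrC.
Qed.

Lemma cmod_cis x : cmod (cis x) = 1.
Proof. by rewrite /cmod /= cos2Dsin2 sqrtr1. Qed.

Lemma cis_pi : cis pi = -1.
Proof. by rewrite /cis cospi sinpi; apply/eqP; rewrite eq_complex /= oppr0 !eqxx. Qed.

Lemma cis_2pi : cis (2 * pi) = 1.
Proof. by rewrite mulrC -[2]/(1 + 1) mulrDr mulr1 cisD cis_pi mulrNN mulr1. Qed.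

(** The order divides [2 ^ k.+1], and a proper divisor of it would divide [2 ^ k]. *)
Lemma prim_root_half (z : R[i]) k : z ^+ (2 ^ k) = -1 -> (2 ^ k.+1)%N.-primitive_root z.
Proof.
move=> zN; have z1 : z ^+ (2 ^ k.+1) = 1 by rewrite expnSr exprM zN sqrrN expr1n.
have [m pm] := prim_order_exists (expn_gt0 2 k.+1 : (0 < 2 ^ k.+1)%N) z1.
move=> /dvdn_pfactor -/(_ isT)[l lk ml].
have [lk'|lk'] := eqVneq l k.+1; first by move: pm; rewrite ml lk'.
have {lk lk'} lk : (l <= k)%N by rewrite -ltnS ltn_neqAle lk'.
have := zN; rewrite -(subnKC lk) expnD exprM -ml (prim_expr_order pm).
by rewrite expr1n => /eqP; rewrite -addr_eq0 -[1 + 1]/(2%:R) pnatr_eq0.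
Qed.

Definition root2 k := cis (2 * pi / 2 ^+ k).

Lemma root2S k : root2 k.+1 ^+ 2 = root2 k.
Proof.
by rewrite /root2 cisX exprS; congr cis; field; rewrite expf_neq0 // pnatr_eq0.
Qed.

Lemma root2_1 k : root2 k ^+ (2 ^ k) = 1.
Proof.
elim: k => [|k IH]; first by rewrite /root2 expr0 divr1 cis_2pi.
by rewrite expnS exprM root2S.
Qed.

Lemma root2_N1 k : root2 k.+1 ^+ (2 ^ k) = -1.
Proof.
elim: k => [|k IH]; last by rewrite expnS exprM root2S.
by rewrite expn0 /root2 !expr1 [2 * pi]mulrC mulfK ?cis_pi // pnatr_eq0.
Qed.

Lemma root2_prim k : (2 ^ k)%N.-primitive_root (root2 k).
Proof.
case: k => [|k]; last exact: prim_root_half (root2_N1 k).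
have r1 : root2 0 = 1 := root2_1 0.
by apply/forallP => i; rewrite r1 ord1 unity_rootE expr1 !eqxx.
Qed.

Lemma cmod_root2 k : cmod (root2 k) = 1. Proof. exact: cmod_cis. Qed.

End circle.

(** * The Cauchy inequality *)

Section cauchy_inequality.
Context {R : realType}.
Implicit Types (a b : nat -> R[i]) (z w v : R[i]) (e d r s t A M : R).

(** Orthogonality of the characters of a cyclic group of order [2 ^ k]. *)
Lemma root2_sum k (i j : nat) : (i < 2 ^ k)%N -> (j < 2 ^ k)%N ->
  \sum_(l < 2 ^ k) (root2 k ^+ l : R[i]) ^+ i * (root2 k ^+ l) ^- j =
  (i == j)%:R * (2 ^ k)%:R.
Proof.
move=> ik jk; set w := root2 k.
have w0 : w != 0 by rewrite -cmod_gt0 cmod_root2.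
pose x := w ^+ i * w ^- j.
have -> : \sum_(l < 2 ^ k) (w ^+ l) ^+ i * (w ^+ l) ^- j = \sum_(l < 2 ^ k) x ^+ l.
  by apply: eq_bigr => l _; rewrite exprMn exprVn -!exprM mulnC [(l * j)%N]mulnC.
have [ij|ij] := eqVneq i j.
  rewrite /x mul1r; rewrite (eq_bigr (fun=> 1)).
    by rewrite sumr_const card_ord.
  by move=> l _; rewrite ij divff ?expr1n // expf_neq0.
rewrite mul0r; apply/eqP.
have x1 : x - 1 != 0.
  rewrite subr_eq0 /x -(inj_eq (mulIf (expf_neq0 j w0))) divfK ?expf_neq0 // mul1r.
  by rewrite (eq_prim_root_expr (root2_prim k)) /= !modn_small.
rewrite -(mulrI_eq0 _ (mulfI x1)) -subrX1 /x exprMn exprVn -!exprM.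
by rewrite ![(_ * 2 ^ k)%N]mulnC !exprM root2_1 !expr1n divr1 subrr.
Qed.

(** Cauchy's inequality, by averaging over the roots of unity of order [2 ^ k]
    instead of integrating. *)
Lemma cauchy_inequality a s r M j : geo a s -> 0 <= r < s ->
  (forall z, cmod z = r -> cmod (PS a z) <= M) -> cmod (a j) * r ^+ j <= M.
Proof.
move=> [A h] /andP[r0 rs] hM; have s0 := le_lt_trans r0 rs.
have rC : cmod (r%:C) = r by rewrite cmodR_ge0.
have x01 : 0 <= r / s < 1 by rewrite -{1 2}rC ratio_lt1 // rC.
set x := r / s in x01; have x1 : 0 < 1 - x by rewrite subr_gt0; case/andP: x01.
apply/ler_addgt0Pr => e e0.
have A0 := gbound_ge0 h.
have C0 : 0 < A / (1 - x) + 1 by rewrite ltr_wpDl // divr_ge0 // ltW.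
have [N hN] := expr_small x01 (divr_gt0 e0 C0).
pose k := maxn N j.
have kN : (2 ^ k > k)%N by rewrite ltn_expl.
have jk : (j < 2 ^ k)%N by rewrite (leq_ltn_trans _ kN) // leq_maxr.
have Nk : (N <= 2 ^ k)%N by rewrite (leq_trans _ (ltnW kN)) // leq_maxl.
have {hN Nk} hN := hN _ Nk.
set n := (2 ^ k)%N in jk hN.
have n0 : 0 < n%:R :> R by rewrite ltr0n expn_gt0.
pose W (l : nat) : R[i] := root2 k ^+ l.
have W1 l : cmod (W l) = 1 by rewrite cmodX cmod_root2 expr1n.
have zr l : cmod (r%:C * W l) = r by rewrite cmodM W1 mulr1.
have E : \sum_(l < n) psum a (r%:C * W l) n * W l ^- j = n%:R * (a j * r%:C ^+ j).
  under eq_bigr do rewrite psumE big_distrl /=.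
  rewrite exchange_big /= (bigD1 (Ordinal jk)) //= [X in _ + X]big1 ?addr0.
    rewrite (eq_bigr (fun l : 'I_n => (a j * r%:C ^+ j) * (W l ^+ j * W l ^- j))).
      by rewrite -big_distrr /= root2_sum // eqxx mul1r mulrC.
    by move=> l _; rewrite exprMn !mulrA.
  move=> i ij.
  rewrite (eq_bigr (fun l : 'I_n => (a i * r%:C ^+ i) * (W l ^+ i * W l ^- j))).
    by rewrite -big_distrr /= root2_sum // -[_ == j :> nat]/(i == Ordinal jk) (negPf ij) mul0r mulr0.
  by move=> l _; rewrite exprMn !mulrA.
have : cmod (n%:R * (a j * r%:C ^+ j)) <= n%:R * (M + e).
  rewrite -E; apply: le_trans (cmod_sum _ _ _) _.
  rewrite mulr_natl -[n in leRHS]card_ord -sumr_const; apply: ler_sum => l _.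
  rewrite cmodM cmodV cmodX W1 expr1n invr1 mulr1.
  have zs : cmod (r%:C * W l) < s by rewrite zr.
  have := PS_tail n h zs; rewrite zr -/x => h1.
  have h2 := hM _ (zr l).
  have h3 : A * (x ^+ n / (1 - x)) <= e.
    move: hN; rewrite ltr_pdivlMr // => /ltW; apply: le_trans.
    rewrite mulrCA; apply: ler_wpM2l; last by rewrite lerDl.
    by rewrite exprn_ge0 //; case/andP: x01.
  have := cmod_tri (PS a (r%:C * W l)) (psum a (r%:C * W l) n) 0.
  rewrite !subr0 (cmodC (psum _ _ _)); lra.
by rewrite cmodM cmod_nat ler_pM2l // cmodM cmodX rC.
Qed.

End cauchy_inequality.

(** * Singularities on the circle of convergence *)

Section disc_of_convergence.
Context {R : realType}.
Implicit Types (a b : nat -> R[i]) (z w v : R[i]) (e d r s t A M : R).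

(** Both re-expansions sum to the same germ at [v]. *)
Lemma recenter_unique a b s t v w e : geo a s -> cmod v < s -> geo b t ->
  cmod (v - w) < t -> 0 < e ->
  (forall z, cmod (z - v) < e -> PS a z = PS b (z - w)) ->
  recenter a v =1 recenter b (v - w).
Proof.
move=> ha vs hb vt e0 hab; have [A hA] := ha; have [B hB] := hb.
pose m := Num.min ((s - cmod v) / 2) ((t - cmod (v - w)) / 2).
have m0 : 0 < m by rewrite lt_min; apply/andP; split; lra.
have [m1 m2] : m <= (s - cmod v) / 2 /\ m <= (t - cmod (v - w)) / 2.
  by rewrite /m !ge_min !lexx orbT.
have h1 : geo (recenter a v) m.
  by eexists; apply: gbound_recenter hA _ _; lra.
have h2 : geo (recenter b (v - w)) m.
  by eexists; apply: gbound_recenter hB _ _; lra.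
pose n := Num.min e m.
have n0 : 0 < n by rewrite lt_min e0.
apply: (PS_unique m0 n0 h1 h2) => z; rewrite lt_min => /andP[ze zm].
rewrite -(PS_recenter ha); last by lra.
rewrite -(PS_recenter hb); last by lra.
by rewrite hab addrAC ?subrr ?add0r // addrK.
Qed.

(** Summing the bounds on all the derivatives of [a m * z ^+ m] recovers, by the
    binomial formula, a bound at a radius beyond [r]. *)
Lemma binomial_sum_bound a m r x C : 0 <= r -> 0 < x -> 0 <= C ->
  (forall n, (n <= m)%N -> cmod (a m) * ('C(m, n)%:R * r ^+ (m - n)) * x ^+ n <= C) ->
  cmod (a m) * (r + 3 / 4 * x) ^+ m <= C * 4.
Proof.
move=> r0 x0 C0 h; rewrite exprDn big_distrr /=.
apply: (le_trans (y := \sum_(n < m.+1) C * (3 / 4) ^+ n)); last first.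
  rewrite -big_distrr /=; apply: ler_wpM2l => //.
  have := @geo_tail R (3 / 4) 0 m.+1; rewrite big_mkord expr0.
  have xb : 0 <= (3 / 4 : R) < 1 by lra.
  by move=> /(_ xb) H; apply: le_trans H _; rewrite ler_pdivrMr; lra.
apply: ler_sum => n _; have {h} := h n; rewrite -ltnS ltn_ord => /(_ isT) h.
rewrite exprMn -mulr_natl.
have := ler_wpM2r _ h; move=> /(_ ((3 / 4) ^+ n)) H; apply: le_trans (H _).
  by apply: eq_ler; ring.
by rewrite exprn_ge0 //; lra.
Qed.

(** A power series has a singular point on its circle of convergence: if its
    sum continues analytically across every point of the circle of radius [t],
    the re-expansions at points close to the circle have coefficients bounded
    by a uniform geometric sequence, and by Cauchy's inequality this bounds the
    coefficients of the original series beyond [t]. *)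
Lemma PS_extends a t : 0 < t -> (forall s, 0 < s < t -> geo a s) ->
  (forall w, cmod w = t -> exists g, analytic_at g w /\
     exists2 e, 0 < e & forall z, cmod (z - w) < e -> cmod z < t -> PS a z = g z) ->
  exists2 s, t < s & geo a s.
Proof.
move=> t0 ha hg.
have geoa v : cmod v < t -> exists2 s, cmod v < s < t & geo a s.
  move=> vt; have v0 := cmod_ge0 v.
  by exists ((cmod v + t) / 2); [lra|apply: ha; lra].
pose P d w := cmod w = t -> forall v n, cmod (v - w) < d -> cmod v < t ->
  cmod (recenter a v n) * d ^+ n.+1 <= 1.
have [|d0 d00 hd0] := @disc_uniform R t P.
  move=> w; rewrite le_eqVlt => /predU1P[wt|wt]; last first.
    exists (t - cmod w); first by rewrite subr_gt0.
    move=> v d vw _ vt; have := cmod_tri w v 0; rewrite !subr0; lra.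
  have [g [/analyticP[b [s [s0 hb hgb]]] [e e0 he]]] := hg _ wt.
  pose m := Num.min s e; have m0 : 0 < m by rewrite lt_min s0.
  have [ms me] : m <= s /\ m <= e by rewrite /m !ge_min !lexx orbT.
  have [A hA] : geo b m by apply: geo_le hb; rewrite ltW.
  have A0 := gbound_ge0 hA.
  have A1 : 0 < (2 * A + 1)^-1 by rewrite invr_gt0; lra.
  exists (Num.min (m / 6) (2 * A + 1)^-1); first by rewrite lt_min A1 andbT; lra.
  move=> x d xw; rewrite lt_min in xw *; case/andP: xw => xw _.
  rewrite lt_min => /and3P[d0 dm dA] xt v n vx vt.
  have vw : cmod (v - w) < m / 3 by have := cmod_tri x v w; lra.
  have [s1 /andP[vs1 s1t] hs1] := geoa _ vt.
  pose e1 := Num.min (t - cmod v) (m / 3).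
  have e10 : 0 < e1 by rewrite lt_min subr_gt0 vt; lra.
  have hbm : geo b m by exists A.
  rewrite (@recenter_unique a b s1 m v w e1 hs1 vs1 hbm _ e10); last first.
  - move=> z; rewrite lt_min => /andP[z1 z2].
    have zw : cmod (z - w) < m by have := cmod_tri v z w; lra.
    rewrite he; [|lra|by have := cmod_tri v z 0; rewrite !subr0; lra].
    by rewrite hgb //; lra.
  - lra.
  have h := @gbound_recenter R b m (m / 3) A (v - w) hA.
  have {}h := h _ _ n; move: h => /(_ _)/(_ _) h.
  have y12 : cmod (v - w) / (m - m / 3) <= 2^-1.
    by rewrite ler_pdivrMr; lra.
  have B2 : A / (1 - cmod (v - w) / (m - m / 3)) <= 2 * A.
    rewrite ler_pdivrMr; last by lra.
    have -> : 2 * A * (1 - cmod (v - w) / (m - m / 3)) =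
      A + A * (1 - 2 * (cmod (v - w) / (m - m / 3))) by ring.
    by rewrite lerDl mulr_ge0 //; lra.
  apply: (le_trans (y := 2 * A * (2 * A + 1)^-1)); last first.
    by rewrite ler_pdivrMr; lra.
  rewrite exprSr mulrA; apply: ler_pM; last exact: ltW.
  - by rewrite mulr_ge0 ?cmod_ge0 ?exprn_ge0 // ltW.
  - exact: ltW.
  apply: le_trans B2; apply: le_trans (h _ _); [|lra|lra].
  apply: ler_wpM2l; rewrite ?cmod_ge0 // lerXn2r ?nnegrE //; lra.
pose d := Num.min d0 t / 2.
have mm : 0 < Num.min d0 t by rewrite lt_min d00.
have dp : 0 < d by rewrite /d; lra.
have dd0 : d < d0 by apply: (lt_le_trans (y := Num.min d0 t)); rewrite ?ge_min ?lexx // /d; lra.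
have dt : d < t by apply: (lt_le_trans (y := Num.min d0 t)); rewrite ?ge_min ?lexx ?orbT // /d; lra.
pose r := t - d / 2; have r0 : 0 < r by rewrite /r; lra.
have rt : r < t by rewrite /r; lra.
have hrec v n : cmod v = r -> cmod (PS (dcoef a n) v) <= (d ^+ n.+1)^-1.
  move=> vr; rewrite -[leRHS]mul1r ler_pdivlMr ?exprn_gt0 //.
  pose w := v * (t / r)%:C.
  have wt : cmod w = t.
    by rewrite cmodM vr cmodR_ge0 ?divr_ge0 ?ltW // mulrCA divff ?mulr1 // gt_eqF.
  apply: (hd0 d w) => //; rewrite ?dp ?dd0 ?wt ?vr //.
  have -> : v - w = v * (1 - t / r)%:C by rewrite rmorphB rmorph1 /w; ring.
  rewrite cmodM vr cmodR -{1}[r]ger0_norm ?ltW // -normrM mulrBr mulr1.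
  rewrite mulrCA divff ?gt_eqF // mulr1 ler0_norm /r; lra.
(* [r + 3 d / 4 > t]: the radius [d] of the re-expansions exceeds the distance
   [d / 2] from the circle of radius [r] to the circle of radius [t]. *)
exists (r + 3 / 4 * d); first by rewrite /r; lra.
exists (d^-1 * 4) => m; apply: binomial_sum_bound; rewrite ?(ltW r0) ?invr_ge0 ?(ltW dp) //.
move=> n nm.
have [A hA] : geo a ((r + t) / 2) by apply: ha; lra.
have hdc : geo (dcoef a n) ((r + (r + t) / 2) / 2).
  by eexists; apply: gbound_dcoef hA _; lra.
have := @cauchy_inequality R (dcoef a n) ((r + (r + t) / 2) / 2) r (d ^+ n.+1)^-1 (m - n)%N hdc.
have rr : 0 <= r < (r + (r + t) / 2) / 2 by lra.
move=> /(_ rr (fun v vr => hrec v n vr)).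
rewrite /dcoef subnK // cmodM cmod_nat exprS invfM => H.
rewrite -ler_pdivlMr ?exprn_gt0 //; apply: le_trans H.
by apply: eq_ler; ring.
Qed.

(** If the supremum of the radii where the series represents [F] were less than
    [r], the series would converge on a larger disc by [PS_extends], and by the
    identity theorem it would still represent [F] there. *)
Lemma taylor_disc (F : R[i] -> R[i]) a r s0 : 0 < r -> 0 < s0 -> geo a s0 ->
  (forall z, cmod z < s0 -> F z = PS a z) ->
  (forall w, cmod w <= r -> exists g, analytic_at g w /\
     exists2 e, 0 < e & forall z, cmod (z - w) < e -> cmod z < r -> F z = g z) ->
  (exists2 s, r < s & geo a s) /\ forall z, cmod z < r -> F z = PS a z.
Proof.
move=> r0 s00 ha hF0 hF.
pose T := [set t | [/\ 0 < t <= r, geo a t & forall z, cmod z < t -> F z = PS a z]].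
pose m0 := Num.min s0 r.
have m00 : 0 < m0 by rewrite lt_min s00.
have Tm0 : T m0.
  split; first by rewrite m00 ge_min lexx orbT.
    by apply: geo_le ha; rewrite ltW //= ge_min lexx.
  by move=> z; rewrite lt_min => /andP[zs _]; exact: hF0.
have Tub : has_ubound T by exists r => t [/andP[]].
have Ts : has_sup T by split; [exists m0|].
pose t := sup T.
have t0 : 0 < t by apply: lt_le_trans m00 _; exact: ub_le_sup.
have tr : t <= r by apply: ge_sup; [exists m0|move=> x [/andP[]]].
have Tlt x : x < t -> exists2 y, x < y & T y.
  by move=> /(sup_gt (proj1 Ts))[y Ty xy]; exists y.
have hgeo s : 0 < s < t -> geo a s.
  move=> /andP[s1 /Tlt[y sy [_ hy _]]]; apply: geo_le hy.
  by rewrite !ltW.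
have hFt z : cmod z < t -> F z = PS a z.
  by move=> /Tlt[y zy [_ _]]; apply.
have [|s ts has] := PS_extends t0 hgeo.
  move=> w wt; have [|g [hg [e e0 he]]] := hF w; first by rewrite wt.
  exists g; split => //; exists e => // z ze zt.
  by rewrite -hFt // he // (lt_le_trans zt).
move: tr; rewrite le_eqVlt => /predU1P[trE|tr].
  by rewrite -trE; split => //; exists s.
exfalso.
have [|e e0 he] := @disc_uniform R t (fun d w => cmod w = t ->
    forall z, cmod (z - w) < d -> F z = PS a z).
  move=> w; rewrite le_eqVlt => /predU1P[wt|wt]; last first.
    exists (t - cmod w); first by rewrite subr_gt0.
    move=> v d vw _ vt; have := cmod_tri w v 0; rewrite !subr0; lra.
  have [|g [hg [e1 e10 he1]]] := hF w; first by rewrite wt ltW.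
  pose e := Num.min e1 (r - t).
  have e0 : 0 < e by rewrite lt_min e10 subr_gt0.
  have he z : cmod (z - w) < e -> F z = g z.
    rewrite lt_min => /andP[z1 z2]; apply: he1 => //.
    by have := cmod_tri w z 0; rewrite !subr0; lra.
  have hPa : analytic_at (PS a) w by apply: PS_analytic has _; rewrite wt.
  have /nearC[e2 e20 he2] : \forall z \near w, PS a z - g z = 0.
    apply: analytic_zero; first exact: analyticB.
    move=> d d0; have de0 : 0 < Num.min d e by rewrite lt_min d0.
    have [v] := interior_point wt t0 de0; rewrite lt_min => /andP[vd ve] vt.
    exists v; first exact: vd.
    apply/nearC; exists (Num.min (e - cmod (v - w)) (t - cmod v)).
      by rewrite lt_min !subr_gt0 ve.
    move=> z; rewrite lt_min => /andP[z1 z2].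
    rewrite -he; last by have := cmod_tri v z w; lra.
    by rewrite hFt ?subrr //; have := cmod_tri v z 0; rewrite !subr0; lra.
  pose e3 := Num.min e e2; have e30 : 0 < e3 by rewrite lt_min e0.
  exists (e3 / 2); first by lra.
  move=> v d vw /andP[d0 de] _ z zv.
  have : cmod (z - w) < e3 by have := cmod_tri v z w; lra.
  rewrite lt_min => /andP[z1 z2].
  by rewrite he //; apply/esym/eqP; rewrite -subr_eq0 he2.
pose d := e / 2; have d0 : 0 < d < e by rewrite /d; lra.
pose t' := Num.min (Num.min (t + d) s) r.
have tt' : t < t' by rewrite !lt_min ts tr ltrDl; case/andP: d0 => ->.
have : T t'.
  split; first by rewrite (lt_trans t0 tt') ge_min lexx orbT.
    by apply: geo_le has; rewrite ltW ?(lt_trans t0) //= !ge_min lexx orbT.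
  move=> z; rewrite !lt_min => /andP[/andP[z1 z2] z3].
  have [zt|tz] := ltP (cmod z) t; first exact: hFt.
  have z0 : 0 < cmod z by exact: lt_le_trans tz.
  pose w := z * (t / cmod z)%:C.
  have wt : cmod w = t.
    by rewrite cmodM cmodR_ge0 ?divr_ge0 ?ltW // mulrCA divff ?mulr1 // gt_eqF.
  apply: (he d w) => //; first by rewrite wt.
  have -> : z - w = z * (1 - t / cmod z)%:C by rewrite rmorphB rmorph1 /w; ring.
  rewrite cmodM cmodR_ge0; last by rewrite subr_ge0 ler_pdivrMr // mul1r.
  by rewrite mulrBr mulr1 mulrCA divff ?mulr1; [lra|rewrite gt_eqF].
by move=> /(ub_le_sup Tub); rewrite leNgt tt'.
Qed.

End disc_of_convergence.

(** * Functions meromorphic on a disc *)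

Section meromorphic.
Context {R : realType}.
Implicit Types (a b c : nat -> R[i]) (z w v : R[i]) (e d r s t : R).
Implicit Types (f g h : R[i] -> R[i]) (P Q : {poly R[i]}).

Definition pcprod P c := cprod (fun j => P`_j) c.

Lemma geo_pcprod P c s t : geo c s -> 0 <= t < s -> geo (pcprod P c) t.
Proof.
by move=> hc ts; apply: (geo_cprod _ hc ts); apply: geo_poly; case/andP: ts; lra.
Qed.

Lemma PS_pcprod P c s z : geo c s -> cmod z < s ->
  PS (pcprod P c) z = P.[z] * PS c z.
Proof.
move=> hc zs; rewrite (PS_cprod _ hc zs) ?PS_poly //.
by apply: geo_poly; have := cmod_ge0 z; lra.
Qed.

(** The product of three series is associative and commutative because their
    sums are. *)
Lemma pcprodC P Q c s : 0 < s -> geo c s ->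
  pcprod P (pcprod Q c) =1 pcprod Q (pcprod P c).
Proof.
move=> s0 hc.
have h1 : geo c (s / 2) by apply: geo_le hc; lra.
have h2 P' : geo (pcprod P' c) (s / 2) by apply: geo_pcprod hc _; lra.
have s4 : 0 < s / 4 by lra.
apply: (PS_unique s4 s4); try by apply: geo_pcprod (h2 _) _; lra.
move=> z zs; rewrite !(PS_pcprod _ (h2 _)) ?(PS_pcprod _ hc) //; [exact: mulrCA|lra..].
Qed.

(** The Maclaurin series [c] is that of a function meromorphic on the disc of
    radius [t] with finitely many poles: some polynomial clears them. *)
Definition mero_coef c t := exists2 P, P.[0] != 0 & geo (pcprod P c) t.

Lemma mero_coef_le c s t : 0 <= t <= s -> mero_coef c s -> mero_coef c t.
Proof. by move=> ts [P P0 h]; exists P => //; exact: geo_le h. Qed.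

(** Meromorphy at a point [w] of the closed disc of radius [r] of a function
    given in the open disc only, up to its values at isolated points. *)
Definition mero_from_disc h r w := exists n g, analytic_at g w /\
  exists2 e, 0 < e & forall z, cmod (z - w) < e -> cmod z < r ->
    \forall v \near z^', (v - w) ^+ n * h v = g v.

Lemma meromorphic_from_disc h r w : meromorphic_at h w -> mero_from_disc h r w.
Proof.
move=> [n [g [hg /dnearC[e e0 he]]]]; exists n, g; split => //.
exists e => // z zw _; apply/dnearC.
have [->|zw0] := eqVneq z w; first by exists e.
have d0 : 0 < cmod (z - w) by rewrite cmod_gt0 subr_eq0.
exists (Num.min (e - cmod (z - w)) (cmod (z - w))).
  by rewrite lt_min subr_gt0 zw.
move=> v; rewrite lt_min => /andP[v1 v2] _; apply: he.
  by have := cmod_tri z v w; lra.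
by apply: contraTneq v2 => ->; rewrite cmodC ltxx.
Qed.

Lemma near_analytic_radius g w : analytic_at g w -> exists2 e, 0 < e &
  forall v, cmod (v - w) < e -> analytic_at g v.
Proof. by move=> /analytic_near/nearC. Qed.

(** [P] clears the pole at [w], with [g] as the resulting germ. *)
Definition clears P h r w g e := [/\ 0 < e,
  forall v, cmod (v - w) < e -> analytic_at g v &
  forall z, cmod (z - w) < e -> cmod z < r -> \forall v \near z^', P.[v] * h v = g v].

(** By compactness, finitely many polynomial factors suffice. *)
Lemma clear_poles h c r s : 0 < r -> 0 < s -> geo c s ->
  (forall z, cmod z < s -> h z = PS c z) ->
  (forall w, cmod w <= r -> mero_from_disc h r w) ->
  exists2 P, P.[0] != 0 & forall w, cmod w <= r -> exists g e, clears P h r w g e.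
Proof.
move=> r0 s0 hc h0 hm.
have : forall w, exists p : nat * (R[i] -> R[i]) * R, cmod w <= r ->
    (w = 0 -> p.1.1 = 0%N) /\ clears (('X - w%:P) ^+ p.1.1) h r w p.1.2 p.2.
  move=> w; have [wr|wr] := leP (cmod w) r; last first.
    by exists (0%N, h, 0).
  have [->|w0] := eqVneq w 0.
    exists (0%N, PS c, s) => _; split=> //; split => //= [v|z].
      by rewrite subr0; exact: PS_analytic.
    rewrite subr0 => zs _; apply/dnearC; exists (s - cmod z); first by rewrite subr_gt0.
    move=> v vz _; rewrite expr0 hornerC mul1r h0 //.
    by have := cmod_tri z v 0; rewrite !subr0; lra.
  have [n [g [hg [e e0 he]]]] := hm _ wr.
  have [d d0 hd] := near_analytic_radius hg.
  exists (n, g, Num.min d e) => _; split=> [/eqP|]; first by rewrite (negPf w0).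
  split=> /=; first by rewrite lt_min d0.
    by move=> v; rewrite lt_min => /andP[v1 _]; exact: hd.
  move=> z; rewrite lt_min => /andP[_ v2] zr; have /dnearC[x x0 hx] := he _ v2 zr; apply/dnearC; exists x => // v vz vz0.
  by rewrite horner_exp hornerXsubC hx.
move=> /boolp.choice[p hp].
have [|l lr lc] := @disc_cover R r (fun w => (p w).2).
  by move=> w /hp[_ []].
pose F w := ('X - w%:P) ^+ (p w).1.1.
exists (\prod_(w <- l) F w).
  rewrite horner_prod prodf_seq_neq0; apply/allP => w wl /=.
  rewrite horner_exp hornerXsubC sub0r; have [hw _] := hp _ (lr _ wl).
  by have [/hw ->|w0] := eqVneq w 0; rewrite ?expr0 ?oner_eq0 // expf_neq0 // oppr_eq0.
move=> w /lc[x xl wx]; have [_ [e0 hg he]] := hp _ (lr _ xl).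
rewrite (big_rem x xl) /=; set Q := \prod_(y <- rem x l) F y.
exists (fun v => Q.[v] * (p x).1.2 v), ((p x).2 - cmod (w - x)); split.
- by rewrite subr_gt0.
- move=> v vw; apply: analyticM; first exact: analytic_poly.
  by apply: hg; have := cmod_tri w v x; lra.
- move=> z zw zr; have [|d d0 hd] := (dnearC _ _).1 (he z _ zr).
    by have := cmod_tri w z x; lra.
  apply/dnearC; exists d => // v vz vz0.
  by rewrite hornerM mulrAC -mulrA -hd // mulrA [RHS]mulrA [Q.[v] * _]mulrC mulrAC.
Qed.

Lemma mero_disc h c r s : 0 < r -> 0 < s -> geo c s ->
  (forall z, cmod z < s -> h z = PS c z) ->
  (forall w, cmod w <= r -> mero_from_disc h r w) ->
  exists P, [/\ P.[0] != 0, exists2 t, r < t & geo (pcprod P c) t &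
    forall z, cmod z < r -> \forall v \near z^', P.[v] * h v = PS (pcprod P c) v].
Proof.
move=> r0 s0 hc h0 hm; have [P P0 hP] := clear_poles r0 s0 hc h0 hm.
have : forall w, exists p : (R[i] -> R[i]) * R, cmod w <= r -> clears P h r w p.1 p.2.
  move=> w; have [/hP[g [e he]]|wr] := leP (cmod w) r; first by exists (g, e).
  by exists (h, 0).
move=> /boolp.choice[p hp]; pose F z := (p z).1 z.
have FE w z : cmod w <= r -> cmod (z - w) < (p w).2 -> cmod z < r -> F z = (p w).1 z.
  move=> wr zw zr; have [e0 hg he] := hp _ wr.
  have [e0' hg' he'] := hp _ (ltW zr).
  apply: (@analytic_eq_punctured _ (p z).1 (p w).1 z).
    by apply: hg'; rewrite subrr cmod0.
    exact: hg.
  have /dnearC[d d0 hd] := he _ zw zr.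
  have /dnearC[d' d0' hd'] : \forall v \near z^', P.[v] * h v = (p z).1 v.
    by apply: he' => //; rewrite subrr cmod0.
  apply/dnearC; exists (Num.min d d'); first by rewrite lt_min d0.
  by move=> v; rewrite lt_min => /andP[v1 v2] vz; rewrite -hd // hd'.
pose m := Num.min (s / 2) r; have m0 : 0 < m by rewrite lt_min r0 andbT; lra.
have [ms mr] : m <= s / 2 /\ m <= r by rewrite /m !ge_min !lexx orbT.
have ha : geo (pcprod P c) m by apply: geo_pcprod hc _; lra.
have F0 z : cmod z < m -> F z = PS (pcprod P c) z.
  move=> zm; have zr : cmod z < r by lra.
  have [e0 hg he] := hp _ (ltW zr).
  apply: (@analytic_eq_punctured _ (p z).1 (PS (pcprod P c)) z).
  - by apply: hg; rewrite subrr cmod0.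
  - exact: PS_analytic ha zm.
  have /dnearC[d d0 hd] : \forall v \near z^', P.[v] * h v = (p z).1 v.
    by apply: he => //; rewrite subrr cmod0.
  apply/dnearC; exists (Num.min d (m - cmod z)); first by rewrite lt_min d0 subr_gt0.
  move=> v; rewrite lt_min => /andP[v1 v2] vz; rewrite -hd //.
  have vm : cmod v < m by have := cmod_tri z v 0; rewrite !subr0; lra.
  by rewrite (PS_pcprod _ hc) ?h0 //; lra.
have [|ht FP] := taylor_disc r0 m0 ha F0.
  move=> w wr; have [e0 hg he] := hp _ wr.
  exists (p w).1; split; first by apply: hg; rewrite subrr cmod0.
  by exists (p w).2 => // z zw zr; exact: FE.
exists P; split => // z zr.
have [e0 hg he] := hp _ (ltW zr).
have zz : cmod (z - z) < (p z).2 by rewrite subrr cmod0.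
near=> v.
have -> : P.[v] * h v = (p z).1 v by near: v; exact: he.
have vr : cmod v < r by near: v; exact: dnear_lt0.
have vz : cmod (v - z) < (p z).2 by near: v; exact: dnear_lt.
by rewrite -FP // (FE z) // ltW.
Unshelve. all: by end_near.
Qed.

Lemma ereal_between (x : R) (y : \bar R) : (x%:E < y)%E ->
  exists2 t, x < t & (t%:E < y)%E.
Proof.
case: y => [y| |] //; rewrite ?lte_fin => xy.
  by exists ((x + y) / 2); rewrite ?lte_fin; lra.
by exists (x + 1); rewrite ?ltry //; lra.
Qed.

(** Quotients of the numerators [pcprod P c] by the denominators [P] agree
    wherever both make sense, and therefore glue to a meromorphic function. *)
Lemma mero_glue c (rad : \bar R) s : 0 < s -> geo c s ->
  (forall t, 0 < t -> (t%:E < rad)%E -> mero_coef c t) ->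
  exists h, (forall z, disc rad z -> meromorphic_at h z) /\
    forall z, cmod z < s -> h z = PS c z.
Proof.
move=> s0 hc hm.
(* [Q z x]: [x] is the value at [z] of one of the quotients. *)
pose Q z x := exists t P, [/\ P.[z] != 0, cmod z < t, geo (pcprod P c) t &
  x = PS (pcprod P c) z / P.[z]].
have Qu z x y : Q z x -> Q z y -> x = y.
  move=> [t [P [Pz zt hP ->]]] [t' [P' [Pz' zt' hP' ->]]].
  apply/eqP; rewrite eqr_div //; apply/eqP.
  rewrite mulrC -(PS_pcprod _ hP zt) [RHS]mulrC -(PS_pcprod _ hP' zt').
  exact/PS_ext/(pcprodC _ _ s0 hc).
have [h hh] : exists h, forall z, Q z (h z) \/ (~ (exists x, Q z x) /\ h z = PS c z).
  suff /boolp.choice[f hf] : forall z, exists x, Q z x \/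
      (~ (exists x, Q z x) /\ x = PS c z) by exists f.
  move=> z; have [[x Qx]|nQ] := pselect (exists x, Q z x).
    by exists x; left.
  by exists (PS c z); right.
have hQ z x : Q z x -> h z = x.
  by move=> Qx; case: (hh z) => [/Qu/(_ Qx) //|[[]]]; exists x.
exists h; split => [z zr|z zs]; last first.
  case: (hh z) => [[t [P [Pz zt hP E]]]|[_ ->//]].
  by rewrite E (PS_pcprod _ hc zs) mulrAC divff ?mul1r.
have [t zt tr] := ereal_between zr.
have t0 : 0 < t by exact: le_lt_trans (cmod_ge0 z) zt.
have [P P0 hP] := hm _ t0 tr.
have Pn0 : P != 0 by apply: contraNneq P0 => ->; rewrite horner0.
have [n [P1 + PE]] := multiplicity_XsubC P z; rewrite Pn0 /= => P1z.
have /nearC[d d0 hd] : \forall v \near z, cmod (P1.[v] - P1.[z]) < cmod P1.[z].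
  by apply: analytic_continuous (analytic_poly P1 z) _ _; rewrite cmod_gt0.
exists n, (fun v => PS (pcprod P c) v * P1.[v]^-1); split.
  by apply: analyticM (PS_analytic hP zt) (analyticV (analytic_poly _ _) P1z).
apply/dnearC; exists (Num.min d (t - cmod z)); first by rewrite lt_min d0 subr_gt0.
move=> v; rewrite lt_min => /andP[v1 v2] vz.
have vt : cmod v < t by have := cmod_tri z v 0; rewrite !subr0; lra.
have P1v : P1.[v] != 0.
  by apply: contraTneq (hd _ v1) => ->; rewrite sub0r cmodN ltxx.
have Pv : P.[v] = P1.[v] * (v - z) ^+ n by rewrite PE hornerM horner_exp hornerXsubC.
have vz0 : (v - z) ^+ n != 0 by rewrite expf_neq0 // subr_eq0.
have Pv0 : P.[v] != 0 by rewrite Pv mulf_neq0.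
rewrite (@hQ v (PS (pcprod P c) v / P.[v])); last by exists t, P.
rewrite Pv; move: vz0 P1v; move: ((v - z) ^+ n) P1.[v] (PS _ _) => x y u x0 y0.
by field; rewrite x0 y0.
Qed.

Lemma continuation_coef f c s (rad : \bar R) h r : 0 < s -> geo c s ->
  (forall z, cmod z < s -> f z = PS c z) ->
  meromorphic_continuation f rad h -> 0 < r -> (r%:E < rad)%E ->
  exists P, [/\ P.[0] != 0, exists2 t, r < t & geo (pcprod P c) t &
    forall z, cmod z < r -> \forall v \near z^', P.[v] * h v = PS (pcprod P c) v].
Proof.
move=> s0 hc hf [hm /nearC[d d0 hd]] r0 rr.
pose m := Num.min d s; have m0 : 0 < m by rewrite lt_min d0.
have hcm : geo c m by apply: geo_le hc; rewrite ltW // ge_min lexx orbT.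
apply: (mero_disc r0 m0 hcm) => [z|w wr].
  by rewrite lt_min => /andP[z1 z2]; rewrite hd ?subr0 // hf.
apply: meromorphic_from_disc; apply: hm; apply: le_lt_trans rr.
by rewrite lee_fin.
Qed.

Lemma meromorphy_radius_ge f c s t : 0 < s -> geo c s ->
  (forall z, cmod z < s -> f z = PS c z) -> mero_coef c t ->
  (t%:E <= meromorphy_radius f)%E.
Proof.
move=> s0 hc hf ht.
have [|h [hm h0]] := @mero_glue c t%:E s s0 hc.
  by move=> u u0; rewrite lte_fin => ut; apply: mero_coef_le ht; rewrite !ltW.
apply: ereal_sup_ubound; exists h; split => //.
by apply/nearC; exists s => // z; rewrite subr0 => zs; rewrite h0 ?hf.
Qed.

Lemma meromorphy_radius_coef f c s t : 0 < s -> geo c s ->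
  (forall z, cmod z < s -> f z = PS c z) ->
  0 < t -> (t%:E < meromorphy_radius f)%E -> exists2 u, t < u & mero_coef c u.
Proof.
move=> s0 hc hf t0 /ereal_sup_gt[r [h hh] tr].
have [P [P0 [u tu hu] _]] := continuation_coef s0 hc hf hh t0 tr.
by exists u => //; exists P.
Qed.

(** The continuations to the smaller discs are all determined by the Maclaurin
    series, so they glue. *)
Lemma meromorphy_radius_attained f c s : 0 < s -> geo c s ->
  (forall z, cmod z < s -> f z = PS c z) ->
  exists h, meromorphic_continuation f (meromorphy_radius f) h.
Proof.
move=> s0 hc hf.
have [|h [hm h0]] := @mero_glue c (meromorphy_radius f) s s0 hc.
  move=> t t0 /(meromorphy_radius_coef s0 hc hf t0)[u tu].
  by apply: mero_coef_le; rewrite !ltW.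
exists h; split => //.
by apply/nearC; exists s => // z; rewrite subr0 => zs; rewrite h0 ?hf.
Qed.

End meromorphic.

(** * The radius of convergence *)

Section radius_of_convergence.
Context {R : realType}.
Implicit Types (a : nat -> R[i]) (t : R).

Lemma geo_unshift a (s : R) m : 0 < s -> geo (fun j => a (j + m)%N) s -> geo a s.
Proof.
move=> s0 [A h]; exists (\sum_(j < m) cmod (a j) * s ^+ j + A * s ^+ m) => j.
have P k : 0 <= cmod (a k) * s ^+ k by rewrite mulr_ge0 ?cmod_ge0 ?exprn_ge0 // ltW.
have A0 := gbound_ge0 h.
have [mj|jm] := leqP m j.
  rewrite -(subnK mj) exprD mulrA; apply: (le_trans (y := A * s ^+ m)).
    by apply: ler_wpM2r; [rewrite exprn_ge0 // ltW|exact: h].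
  by rewrite lerDr sumr_ge0.
rewrite (bigD1 (Ordinal jm)) //= -addrA lerDl addr_ge0 ?sumr_ge0 //.
by rewrite mulr_ge0 // exprn_ge0 // ltW.
Qed.

Lemma PS_near1 a (s : R) : 0 < s -> geo a s -> a 0%N = 1 -> forall e, 0 < e ->
  exists2 d, 0 < d <= s & forall z, cmod z < d -> cmod (PS a z - 1) < e.
Proof. by move=> s0 ha a0 e /(PS_near0 s0 ha); rewrite a0. Qed.

Lemma geo_lt_radius a t : 0 <= t -> (t%:E < convergence_radius a)%E -> geo a t.
Proof.
move=> t0 /ereal_sup_gt[_ [z /= hz <-]]; rewrite lte_fin => tz.
by apply: geo_le (cvg_geo hz); rewrite t0 ltW.
Qed.

Lemma radius_ge_geo a t : 0 < t -> geo a t -> (t%:E <= convergence_radius a)%E.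
Proof.
move=> t0 [A h]; rewrite leNgt; apply/negP => rt.
have [u [u0 ut ru]] : exists u : R, [/\ 0 <= u, u < t & (convergence_radius a < u%:E)%E].
  move: rt; case: (convergence_radius a) => [r| |] // rt.
    exists (Num.max 0 ((r + t) / 2)); rewrite lte_fin in rt.
    split; first by rewrite le_max lexx.
      by rewrite gt_max t0 /=; lra.
    by rewrite lte_fin lt_max; apply/orP; right; lra.
  by exists 0; rewrite lexx t0 ltNye.
have uC : cmod u%:C = u by rewrite cmodR_ge0.
have : (u%:E <= convergence_radius a)%E.
  apply: ereal_sup_ubound; exists u%:C; last by rewrite uC.
  by apply/cvg_ex; eexists; apply: PS_cvg h _; rewrite uC.
by rewrite leNgt ru.
Qed.

Lemma radius_ge0 a : (0 <= convergence_radius a)%E.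
Proof.
apply: ereal_sup_ubound; exists 0; last by rewrite cmod0.
apply/cvg_ex; exists (a 0%N); apply/ccvgP => e e0; exists 1%N => -[//|n] _.
rewrite psumE big_ord_recl /= expr0 mulr1 big1 ?addr0 ?subrr ?cmod0 // => i _.
by rewrite expr0n mulr0.
Qed.

End radius_of_convergence.

(** * The continued fraction *)

Section rogers_ramanujan.
Context {R : realType}.
Variable q : R[i].
Hypothesis q1 : cmod q = 1.
Implicit Types (z w : R[i]) (e : R) (v : nat -> R[i]).

Lemma cmod_qX k : cmod (q ^+ k) = 1. Proof. by rewrite cmodX q1 expr1n. Qed.

Lemma cmod_qXM k z : cmod (q ^+ k * z) = cmod z.
Proof. by rewrite cmodM cmod_qX mul1r. Qed.

Lemma cmod_qM z : cmod (q * z) = cmod z. Proof. by rewrite cmodM q1 mul1r. Qed.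

(** The sequence [v] and the denominators [jden v] are the Maclaurin series of
    [V = 1 / W] and [W], where [W z = H z + z] satisfies the even contraction
    [W z = 1 + (1 + q) z - q^3 z^2 / W (q^2 z)] of the continued fraction. *)
Definition jden v k : R[i] :=
  match k with 0 => 1 | 1 => 1 + q | k.+2 => - (q ^+ 3 * (v k * (q ^+ 2) ^+ k)) end.

Definition jfraction v := forall n, cprod (jden v) v n = (n == 0%N)%:R.

Lemma cprod_jden v n : cprod (jden v) v n.+2 =
  v n.+2 + (1 + q) * v n.+1 - q ^+ 3 * cprod (fun k => v k * (q ^+ 2) ^+ k) v n.
Proof.
rewrite /cprod big_ord_recl [X in _ + X = _]big_ord_recl /= mul1r !subSS !subn0 addrA.
congr (_ + _); rewrite big_distrr /= -sumrN; apply: eq_bigr => i _; rewrite !subSS; ring.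
Qed.

(** The equation determines each coefficient of [v] from the previous ones. *)
Lemma jfraction_exists : exists v, jfraction v.
Proof.
have [|v hv] := @strong_recursion R[i] 0 (fun n v =>
  match n with 0 => 1 | 1 => - (1 + q)
  | n.+2 => q ^+ 3 * cprod (fun k => v k * (q ^+ 2) ^+ k) v n - (1 + q) * v n.+1 end).
  move=> [|[|n]] f g fg //; rewrite fg //; congr (_ * _ - _).
  apply: eq_bigr => i _; have hi : (i < n.+2)%N := leqW (ltn_ord i).
  by rewrite !fg // ltnS (leq_trans (leq_subr _ _)).
exists v => -[|[|n]].
- by rewrite /cprod big_ord1 /= hv mulr1.
- transitivity (v 1%N + (1 + q) * v 0%N); last by rewrite !hv /= mulr1 addNr.
  by rewrite /cprod 2!big_ord_recl big_ord0 /= mul1r addr0.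
- by rewrite cprod_jden [v n.+2]hv -[RHS]/(0 : R[i]); ring.
Qed.

(** Both sides count products [x i * x k]; on the left only those with
    [i + k < n]. *)
Lemma conv_sum_le (x : nat -> R) n : (forall i, 0 <= x i) ->
  \sum_(m < n) \sum_(i < m.+1) x i * x (m - i)%N <= (\sum_(i < n) x i) ^+ 2.
Proof.
move=> x0.
have -> : \sum_(m < n) \sum_(i < m.+1) x i * x (m - i)%N =
    \sum_(i < n) x i * \sum_(k < n - i) x k.
  elim: n => [|n IH]; first by rewrite !big_ord0.
  rewrite big_ord_recr /= IH [RHS]big_ord_recr /= subSnn big_ord1.
  rewrite [X in _ + X]big_ord_recr /= subnn addrA; congr (_ + _).
  rewrite -big_split /=; apply: eq_bigr => i _; rewrite subSn; last exact: ltnW.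
  by rewrite big_ord_recr /= mulrDr.
rewrite expr2 big_distrl /=; apply: ler_sum => i _; apply: ler_wpM2l => //.
rewrite -!(big_mkord xpredT x) [leRHS](big_cat_nat (n := (n - i)%N)) ?leq_subr //=.
by rewrite lerDl sumr_ge0.
Qed.

(** The constant is the radius of convergence of the majorant series of [v], see
    [jfraction_sum]. *)
Definition jradius : R := (2 + cmod (1 + q))^-1.

Lemma jradius_gt0 : 0 < jradius.
Proof. by rewrite invr_gt0; have := cmod_ge0 (1 + q); lra. Qed.

(** The partial sums of the majorant series stay below [1 / jradius], the double
    root of the majorant equation at the critical radius. *)
Lemma jfraction_sum v n : jfraction v ->
  \sum_(j < n) cmod (v j) * jradius ^+ j <= 2 + cmod (1 + q).
Proof.
move=> hv; have a0 := cmod_ge0 (1 + q); have r0 := jradius_gt0.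
set a := cmod (1 + q) in a0 *; set r := jradius in r0 *.
have a20 : 0 < 2 + a by lra.
have ra : r * (2 + a) = 1 by exact: mulVf (lt0r_neq0 a20).
pose x j := cmod (v j) * r ^+ j.
have x0 j : 0 <= x j by rewrite mulr_ge0 ?cmod_ge0 // exprn_ge0 // ltW.
have v0 : v 0%N = 1 by have := hv 0%N; rewrite /cprod big_ord1 /= mul1r.
have v1 : v 1%N = - (1 + q).
  have := hv 1%N; rewrite /cprod !big_ord_recl big_ord0 /= v0 mul1r mulr1 addr0.
  by move=> /eqP; rewrite addr_eq0 => /eqP.
have v2 m : v m.+2 = q ^+ 3 * cprod (fun k => v k * (q ^+ 2) ^+ k) v m - (1 + q) * v m.+1.
  have := hv m.+2; rewrite cprod_jden /= => /eqP; rewrite subr_eq add0r => /eqP <-; ring.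
have xS m : x m.+2 <= a * r * x m.+1 + r ^+ 2 * \sum_(i < m.+1) x i * x (m - i)%N.
  rewrite /x v2; apply: (le_trans (y := (cmod (cprod (fun k => v k * (q ^+ 2) ^+ k) v m)
      + a * cmod (v m.+1)) * r ^+ m.+2)).
    apply: ler_wpM2r; first by rewrite exprn_ge0 // ltW.
    by apply: le_trans (cmodB _ _) _; rewrite cmod_qXM cmodM.
  rewrite mulrDl addrC; apply: lerD.
    by apply: eq_ler; rewrite [r ^+ m.+2]exprS; ring.
  rewrite big_distrr /=; apply: (le_trans (y :=
     \sum_(i < m.+1) cmod (v i * (q ^+ 2) ^+ i * v (m - i)%N) * r ^+ m.+2)).
    rewrite -big_distrl /=; apply: ler_wpM2r; last exact: cmod_sum.
    by rewrite exprn_ge0 // ltW.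
  apply: ler_sum => i _; rewrite !cmodM cmodX cmod_qX expr1n mulr1.
  have -> : r ^+ m.+2 = r ^+ 2 * (r ^+ i * r ^+ (m - i)).
    by rewrite -!exprD subnKC // -ltnS.
  by apply: eq_ler; ring.
(* [y] is the majorant convolution, shifted so that the two terms of the recursion
   are summed over the same range. *)
pose y j := if j is m.+1 then \sum_(i < m.+1) x i * x (m - i)%N else 0.
have xy j : x j.+1 <= a * r * x j + r ^+ 2 * y j.
  case: j => [|m]; last exact: xS.
  by rewrite /x v0 v1 /y cmodN cmod1 expr0 expr1 !mulr1 mulr0 addr0.
have S0 m : 0 <= \sum_(j < m) x j by rewrite sumr_ge0.
have yS m : \sum_(j < m) y j <= (\sum_(j < m) x j) ^+ 2.
  case: m => [|m]; first by rewrite !big_ord0 expr0n.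
  rewrite big_ord_recl /= add0r; apply: le_trans (conv_sum_le m x0) _.
  by rewrite lerXn2r ?nnegrE ?S0 // [leRHS]big_ord_recr /= lerDl.
rewrite -/(\sum_(j < n) x j); elim: n => [|n IH]; first by rewrite big_ord0 ltW.
rewrite big_ord_recl [x _]/x v0 cmod1 expr0 mul1r.
have h : \sum_(j < n) x (lift ord0 j) <= \sum_(j < n) (a * r * x j + r ^+ 2 * y j).
  by apply: ler_sum => j _; exact: xy.
rewrite big_split -!big_distrr /= in h.
have h2 := ler_wpM2l (sqr_ge0 r) (yS n).
have h3 : a * r * \sum_(j < n) x j <= a * r * (2 + a).
  by apply: ler_wpM2l => //; rewrite mulr_ge0 // ltW.
have h4 : r ^+ 2 * (\sum_(j < n) x j) ^+ 2 <= r ^+ 2 * (2 + a) ^+ 2.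
  apply: ler_wpM2l; first exact: sqr_ge0.
  by rewrite lerXn2r ?nnegrE // ltW.
have ra' : a * r * (2 + a) = a by rewrite -mulrA ra mulr1.
have ra2 : r ^+ 2 * (2 + a) ^+ 2 = 1 by rewrite -exprMn ra expr1n.
rewrite ra' in h3; rewrite ra2 in h4; lra.
Qed.

Lemma geo_jfraction v : jfraction v -> geo v jradius.
Proof.
move=> hv; exists (2 + cmod (1 + q)) => j.
apply: le_trans (jfraction_sum j.+1 hv); rewrite big_ord_recr /= lerDr sumr_ge0 // => i _.
by rewrite mulr_ge0 ?cmod_ge0 // exprn_ge0 // ltW // jradius_gt0.
Qed.

Lemma geo_jden v : geo v jradius -> geo (jden v) jradius.
Proof.
move=> hv; apply: (geo_unshift (m := 2)); first exact: jradius_gt0.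
have [A h] : geo (fun j => - q ^+ 3 * (v j * (q ^+ 2) ^+ j)) jradius.
  by apply: geoZ; apply: geo_rot => //; exact: cmod_qX.
by exists A => j; have := h j; rewrite addn2 /= mulNr.
Qed.

(** Maclaurin coefficients of [H = W - z]. *)
Definition hcoef v k : R[i] := jden v k - (k == 1%N)%:R.

Lemma hcoefE v k : hcoef v k = jden v k + -1 * ('X : {poly R[i]})`_k.
Proof. by rewrite /hcoef coefX mulN1r. Qed.

Lemma geo_hcoef v : geo v jradius -> geo (hcoef v) jradius.
Proof.
move=> hv; have r0 := ltW jradius_gt0.
have [A h] := geoD (geo_jden hv) (geoZ (-1) (geo_poly 'X r0)) r0.
by exists A => j; rewrite hcoefE; exact: h.
Qed.

Lemma PS_jden v z : geo v jradius -> cmod z < jradius ->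
  PS (jden v) z = 1 + (1 + q) * z - q ^+ 3 * z ^+ 2 * PS v (q ^+ 2 * z).
Proof.
move=> hv zr; rewrite (PS_shift 2 (geo_jden hv) zr) psumE !big_ord_recl big_ord0 /=.
rewrite (@PS_ext _ _ (fun j => - q ^+ 3 * (v j * (q ^+ 2) ^+ j))); last first.
  by move=> j; rewrite addn2 /= mulNr.
rewrite (PSZ _ (geo_rot (cmod_qX 2) hv) zr) PS_rot /bump /= expr0 expr1; ring.
Qed.

Lemma PS_hcoef v z : geo v jradius -> cmod z < jradius ->
  PS (hcoef v) z = PS (jden v) z - z.
Proof.
move=> hv zr; have gX := geo_poly 'X (ltW jradius_gt0).
rewrite (PS_ext _ (hcoefE v)) (PSD (geo_jden hv) (geoZ (-1) gX) zr) (PSZ _ gX zr).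
by rewrite PS_poly hornerX mulN1r.
Qed.

(** Two steps of the continued fraction at once: this is the contraction that
    defines [jden], read back on [H]. *)
Lemma PS_hcoef_two_step v z : jfraction v -> cmod z < jradius ->
  PS (hcoef v) (q ^+ 2 * z) + q ^+ 2 * z != 0 /\
  PS (hcoef v) z = 1 + q * z * (PS (hcoef v) (q ^+ 2 * z) /
    (PS (hcoef v) (q ^+ 2 * z) + q ^+ 2 * z)).
Proof.
move=> hv zr; have gv := geo_jfraction hv.
have zr2 : cmod (q ^+ 2 * z) < jradius by rewrite cmod_qXM.
have E : PS (jden v) (q ^+ 2 * z) * PS v (q ^+ 2 * z) = 1.
  rewrite -(PS_cprod (geo_jden gv) gv zr2) (@PS_ext _ _ (fun j => (1%:P : {poly R[i]})`_j)).
    by rewrite PS_poly hornerC.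
  by move=> j; rewrite hv coefC; case: (j == 0)%N.
rewrite !PS_hcoef // subrK.
set W := PS (jden v) _ in E *; have W0 : W != 0.
  by apply: contra_eq_neq E => ->; rewrite mul0r eq_sym oner_eq0.
split => //; rewrite PS_jden // (_ : PS v (q ^+ 2 * z) = W^-1); first by field.
by apply: (mulfI W0); rewrite E divff.
Qed.

(** The fixed-point equation halves the distance of two solutions at each
    application, and the rotation leaves the disc invariant. *)
Lemma two_step_contraction (X Y : R[i] -> R[i]) e : e <= 1 / 8 ->
  (forall z, cmod z < e -> cmod (X z - 1) <= 1 / 4 /\ cmod (Y z - 1) <= 1 / 4) ->
  (forall z, cmod z < e ->
     X z = 1 + q * z * (X (q ^+ 2 * z) / (X (q ^+ 2 * z) + q ^+ 2 * z))) ->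
  (forall z, cmod z < e ->
     Y z = 1 + q * z * (Y (q ^+ 2 * z) / (Y (q ^+ 2 * z) + q ^+ 2 * z))) ->
  forall z, cmod z < e -> X z = Y z.
Proof.
move=> e8 hb hX hY.
have low (U : R[i]) w : cmod (U - 1) <= 1 / 4 -> cmod w < e -> 5 / 8 <= cmod (U + w).
  move=> hU hw; have := cmodB (U + w) (U - 1 + w).
  have -> : U + w - (U - 1 + w) = 1 by ring.
  rewrite cmod1; have := cmodD (U - 1) w; lra.
have step z : cmod z < e -> cmod (X z - Y z) <= 1 / 2 * cmod (X (q ^+ 2 * z) - Y (q ^+ 2 * z)).
  move=> ze; have we : cmod (q ^+ 2 * z) < e by rewrite cmod_qXM.
  have [bX bY] := hb _ we; rewrite hX // hY //.
  set w := q ^+ 2 * z in we *; set x := X w in bX *; set y := Y w in bY *.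
  have hx := low _ _ bX we; have hy := low _ _ bY we.
  have x0 : x + w != 0 by rewrite -cmod_gt0; lra.
  have y0 : y + w != 0 by rewrite -cmod_gt0; lra.
  have -> : 1 + q * z * (x / (x + w)) - (1 + q * z * (y / (y + w))) =
    q * z * w * (x - y) / ((x + w) * (y + w)) by field; rewrite x0 y0.
  rewrite cmod_div [cmod (_ * (x - y))]cmodM [cmod (q * z * w)]cmodM cmod_qM.
  rewrite [cmod ((x + w) * _)]cmodM ler_pdivrMr; last by rewrite mulr_gt0 ?cmod_gt0.
  have h1 : 1 / 4 <= cmod (x + w) * cmod (y + w).
    by apply: (le_trans (y := (5 / 8) * (5 / 8))); [lra|apply: ler_pM => //; lra].
  have h2 : cmod z * cmod w <= 1 / 8.
    by rewrite -[leRHS]mulr1; apply: ler_pM; rewrite ?cmod_ge0 //; lra.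
  apply: (le_trans (y := 1 / 8 * cmod (x - y))).
    by apply: ler_wpM2r; rewrite ?cmod_ge0.
  rewrite [leRHS]mulrAC; apply: ler_wpM2r; first exact: cmod_ge0.
  by lra.
have iter_step n z : cmod z < e -> cmod (X z - Y z) <= (1 / 2) ^+ n.
  elim: n z => [|n IH] z ze.
    rewrite expr0; have [bX bY] := hb _ ze.
    have := cmod_tri 1 (X z) (Y z); rewrite (cmodC 1); lra.
  apply: le_trans (step z ze) _; rewrite [leRHS]exprS; apply: ler_wpM2l; first by lra.
  by apply: IH; rewrite cmod_qXM.
move=> z ze; apply/eqP; rewrite -subr_eq0 -cmod_eq0 eq_le cmod_ge0 andbT.
apply/ler_addgt0Pr => x x0; have [||N hN] := @expr_small R (1 / 2) x; [lra|by []|].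
by rewrite add0r (le_trans (iter_step N z ze)) // ltW // hN.
Qed.

(** If [X] solves the two-step equation, so does [1 + q z / X (q z)]; by
    uniqueness of the solution near the constant [1] they coincide. *)
Lemma PS_hcoef_one_step v : jfraction v -> exists2 e, 0 < e <= jradius & e <= 1 / 8 /\
  forall z, cmod z < e -> cmod (PS (hcoef v) z - 1) <= 1 / 4 /\
    PS (hcoef v) z = 1 + q * z / PS (hcoef v) (q * z).
Proof.
move=> hv; have gv := geo_jfraction hv; set c := hcoef v.
have c0 : c 0%N = 1 by rewrite /c /hcoef subr0.
have [|d /andP[d0 dr] hd] := PS_near1 jradius_gt0 (geo_hcoef gv) c0 (e := 1 / 6); first by lra.
pose e := Num.min d (1 / 8); have e0 : 0 < e by rewrite lt_min d0; lra.
have [ed e8] : e <= d /\ e <= 1 / 8 by rewrite /e !ge_min !lexx orbT.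
have near z : cmod z < e -> cmod (PS c z - 1) <= 1 / 6.
  by move=> ze; rewrite ltW // hd //; lra.
have low z : cmod z < e -> 5 / 6 <= cmod (PS c z).
  move=> /near; have := cmod_tri (PS c z) 1 0; rewrite !subr0 cmod1 (cmodC 1); lra.
have nz z : cmod z < e -> PS c z != 0 by move=> /low h; rewrite -cmod_gt0; lra.
exists e; first by rewrite e0 (le_trans ed).
split => // z ze; split; first by have := near _ ze; lra.
pose K z := 1 + q * z / PS c (q * z).
have rz u : cmod u < e -> cmod u < jradius by lra.
apply: (two_step_contraction (Y := K) e8) => // u ue.
- split; first by have := near _ ue; lra.
  rewrite /K addrAC subrr add0r cmod_div cmod_qM.
  have h := low _ (_ : cmod (q * u) < e); rewrite cmod_qM in h.
  have {}h := h ue; rewrite ler_pdivrMr; lra.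
- by have [] := PS_hcoef_two_step hv (rz _ ue).
- have ue1 : cmod (q * u) < e by rewrite cmod_qM.
  have [n0 E] := PS_hcoef_two_step hv (rz _ ue1).
  rewrite {1}/K E /K.
  have -> : q * (q ^+ 2 * u) = q ^+ 2 * (q * u) by ring.
  have ue3 : cmod (q ^+ 2 * (q * u)) < e by rewrite cmod_qXM.
  have := nz _ ue3; have := nz _ ue1; rewrite E; move: n0.
  rewrite -/c; set x := PS c (q ^+ 2 * (q * u)) => n0 n1 x0.
  have n2 : x + q ^+ 2 * (q * u) + q * (q * u) * x != 0.
    apply: contra_neq n1 => h; apply: (mulIf n0); rewrite mul0r -h; field.
    by rewrite n0.
  have E2 : q * (q * u) = q ^+ 2 * u by ring.
  by rewrite E2 in n2; field; rewrite x0 n0 n2.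
Qed.

Lemma cfrac0 z k : cfrac q z k 0 = 1. Proof. by []. Qed.

Lemma cfracS z k n : cfrac q z k n.+1 = 1 + q ^+ k * z / cfrac q z k.+1 n.
Proof. by []. Qed.

(** Replacing the innermost denominator by the exact value [F] makes the finite
    fraction exact, and each level contracts the error. *)
Lemma cfrac_cvg (F : R[i] -> R[i]) e : e <= 1 / 8 ->
  (forall z, cmod z < e -> cmod (F z - 1) <= 1 / 4 /\ F z = 1 + q * z / F (q * z)) ->
  forall z, cmod z < e -> (fun n => cfrac q z 1 n) @ \oo --> F z.
Proof.
move=> e8 hF z ze.
have low w : cmod w < e -> 3 / 4 <= cmod (F w).
  move=> /hF[h _]; have := cmod_tri (F w) 1 0; rewrite !subr0 cmod1 (cmodC 1); lra.
have clow n k : 1 / 2 <= cmod (cfrac q z k n).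
  elim: n k => [|n IH] k; first by rewrite cfrac0 cmod1; lra.
  rewrite cfracS.
  have h : cmod (q ^+ k * z / cfrac q z k.+1 n) <= 1 / 4.
    by rewrite cmod_div cmod_qXM ler_pdivrMr; have := IH k.+1; lra.
  have := cmodD_ge 1 (q ^+ k * z / cfrac q z k.+1 n); rewrite cmod1; lra.
have key n k : cmod (cfrac q z k.+1 n - F (q ^+ k * z)) <= (1 / 2) ^+ n.
  elim: n k => [|n IH] k.
    rewrite expr0 cfrac0 cmodC; have [|h _] := hF (q ^+ k * z); first by rewrite cmod_qXM.
    lra.
  have [|_ ->] := hF (q ^+ k * z); first by rewrite cmod_qXM.
  rewrite cfracS mulrA -exprS.
  have := low (q ^+ k.+1 * z); rewrite cmod_qXM => /(_ ze) h1.
  have h2 := clow n k.+2; have {IH} := IH k.+1.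
  set x := cfrac _ _ _ _ in h2 *; set y := F _ in h1 * => h3.
  have x0 : x != 0 by rewrite -cmod_gt0; lra.
  have y0 : y != 0 by rewrite -cmod_gt0; lra.
  have -> : 1 + q ^+ k.+1 * z / x - (1 + q ^+ k.+1 * z / y) =
      q ^+ k.+1 * z * (y - x) / (x * y) by field; rewrite x0 y0.
  rewrite cmod_div cmodM cmod_qXM cmodM ler_pdivrMr ?mulr_gt0 ?cmod_gt0 // exprS cmodC.
  have h4 : 1 / 4 <= cmod x * cmod y.
    by apply: (le_trans (y := (1 / 2) * (3 / 4))); [lra|apply: ler_pM => //; lra].
  apply: (le_trans (y := 1 / 8 * (1 / 2) ^+ n)).
    by apply: ler_pM; rewrite ?cmod_ge0 //; lra.
  have p0 : 0 <= (1 / 2 : R) ^+ n by apply: exprn_ge0; lra.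
  apply: (le_trans (y := 1 / 2 * (1 / 2) ^+ n * (1 / 4))); first by lra.
  by apply: ler_wpM2l => //; apply: mulr_ge0 => //; lra.
apply/ccvgP => x x0; have [||N hN] := @expr_small R (1 / 2) x; [lra|by []|].
exists N => n /hN; apply: le_lt_trans; have := key n 0%N; by rewrite expr0 mul1r.
Qed.

End rogers_ramanujan.

(** * The functional equation of G *)

Section gseries.
Context {R : realType}.
Variable q : R[i].
Hypothesis q1 : cmod q = 1.
Hypothesis qnr : not_root_of_unity q.
Implicit Types (z w : R[i]) (e s : R).

Lemma qX_neq1 n : 1 - q ^+ n.+1 != 0.
Proof. by rewrite subr_eq0 eq_sym; exact: qnr. Qed.

Lemma Gcoef0 : Gcoef q 0 = 1.
Proof. by rewrite /Gcoef big_geq // divr1. Qed.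

Lemma Gcoef_rec n : Gcoef q n.+1 * (1 - q ^+ n.+1) = q * (q ^+ 2) ^+ n * Gcoef q n.
Proof.
have E : q ^+ (n.+1 ^ 2) = q * (q ^+ 2) ^+ n * q ^+ (n ^ 2).
  by rewrite -exprM -exprS -exprD; congr (q ^+ _); nia.
by rewrite /Gcoef big_nat_recr //= E invfM -!mulrA mulVf ?qX_neq1 // mulr1.
Qed.

Lemma PS_Gcoef s z : geo (Gcoef q) s -> cmod z < s ->
  PS (Gcoef q) z = PS (Gcoef q) (q * z) + q * z * PS (Gcoef q) (q ^+ 2 * z).
Proof.
move=> hG zs; have hr := geo_rot q1 hG; have hN := geoZ (-1) hr.
have s0 := le_lt_trans (cmod_ge0 z) zs.
have hd := geoD hG hN (ltW s0).
apply/eqP; rewrite addrC -subr_eq; apply/eqP.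
transitivity (PS (fun j => Gcoef q j + -1 * (Gcoef q j * q ^+ j)) z).
  by rewrite (PSD hG hN zs) (PSZ _ hr zs) PS_rot mulN1r.
rewrite (PS_shift 1 hd zs) psumE big_ord1 /= !expr0 expr1 !mulr1 mulN1r subrr add0r.
rewrite (@PS_ext _ _ (fun j => q * (Gcoef q j * (q ^+ 2) ^+ j))).
  by rewrite (PSZ _ (geo_rot (cmod_qX q1 2) hG) zs) PS_rot; ring.
move=> j; rewrite addn1; transitivity (Gcoef q j.+1 * (1 - q ^+ j.+1)); first by ring.
by rewrite Gcoef_rec; ring.
Qed.

Lemma Gq_PS z : Gq q z = PS (Gcoef q) z. Proof. by []. Qed.

(** Near the origin [H] is the sum of its Maclaurin series in both cases of the
    definition, since [G z / G (q z)] is also a limit of the continued fraction. *)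
Lemma Hq_near0 v : jfraction q v -> exists2 s, 0 < s <= jradius q &
  forall z, cmod z < s -> Hq q z = PS (hcoef q v) z.
Proof.
move=> hv.
have gen (a b c d : R) : a < 1 / 16 -> b < 1 / 16 -> 7 / 8 <= d -> c <= a + b ->
  c <= 1 / 4 * d by lra.
have [e /andP[e0 er] [e8 he]] := PS_hcoef_one_step q1 hv.
have [Rpos|Rneg] := boolP (0 < Rq q)%E; last first.
  exists e; first by rewrite e0.
  move=> z ze; rewrite /Hq (negPf Rneg).
  by apply: cvg_lim => //; exact: (cfrac_cvg q1 e8 he).
have [s s0 sR] := ereal_between Rpos.
have hG := geo_lt_radius (ltW s0) sR.
have x0 : 0 < 1 / 16 :> R by lra.
have [d /andP[d0 ds] hd] := PS_near1 s0 hG Gcoef0 x0.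
pose m := Num.min d e; have m0 : 0 < m by rewrite lt_min d0.
have [md me] : m <= d /\ m <= e by rewrite /m !ge_min !lexx orbT.
exists m; first by rewrite m0 (le_trans me).
move=> z zm; rewrite /Hq Rpos !Gq_PS.
pose F w := PS (Gcoef q) w / PS (Gcoef q) (q * w).
have low w : cmod w < m -> 7 / 8 <= cmod (PS (Gcoef q) w).
  move=> wm; have := cmod_tri (PS (Gcoef q) w) 1 0; rewrite !subr0 cmod1 (cmodC 1).
  by have := hd w (lt_le_trans wm md); lra.
have nz w : cmod w < m -> PS (Gcoef q) w != 0 by move=> /low h; rewrite -cmod_gt0; lra.
have hF w : cmod w < m -> cmod (F w - 1) <= 1 / 4 /\ F w = 1 + q * w / F (q * w).
  move=> wm; have qwm : cmod (q * w) < m by rewrite cmod_qM.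
  have qqwm : cmod (q * (q * w)) < m by rewrite !cmod_qM.
  have n1 := nz _ qwm; have n2 := nz _ qqwm; split.
    have -> : F w - 1 = (PS (Gcoef q) w - PS (Gcoef q) (q * w)) / PS (Gcoef q) (q * w).
      rewrite /F; move: n1; move: (PS (Gcoef q) (q * w)) (PS (Gcoef q) w) => a b a0.
      by rewrite mulrBl divff.
    rewrite cmod_div ler_pdivrMr ?cmod_gt0 //.
    have h1 := hd w (lt_le_trans wm md); have h2 := hd _ (lt_le_trans qwm md).
    have h3 := low _ qwm.
    have := cmod_tri 1 (PS (Gcoef q) w) (PS (Gcoef q) (q * w)).
    by rewrite (cmodC 1 (PS (Gcoef q) (q * w))); exact: gen h1 h2 h3.
  have ws : cmod w < s by lra.
  rewrite {1}/F (PS_Gcoef hG ws) /F.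
  have -> : q * (q * w) = q ^+ 2 * w by ring.
  rewrite mulrA -expr2 in n2; move: n1 n2.
  move: (PS _ (q * w)) (PS _ (q ^+ 2 * w)) => a b a0 b0; field.
  by rewrite a0 b0.
have m8 : m <= 1 / 8 by lra.
have c1 := cfrac_cvg q1 m8 hF zm.
have c2 := cfrac_cvg q1 e8 he (lt_le_trans zm me).
exact: ccvg_unique c1 c2.
Qed.

Lemma Hq_maclaurin : exists v s, [/\ jfraction q v, 0 < s <= jradius q,
  geo (hcoef q v) (jradius q), geo (hcoef q v) s &
  forall z, cmod z < s -> Hq q z = PS (hcoef q v) z].
Proof.
have [v hv] := jfraction_exists q; have [s /andP[s0 sj] hs] := Hq_near0 hv.
have hc := geo_hcoef q1 (geo_jfraction q1 hv).
exists v, s; split; [exact: hv|by rewrite s0| | |exact: hs]; first exact: hc.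
by apply: geo_le hc; rewrite ltW.
Qed.

End gseries.

(** * Hankel determinants *)

Section hankel.
Context {R : realType}.
Implicit Types (a c : nat -> R[i]) (s t : R).

Definition hankel a k n : 'M[R[i]]_n := \matrix_(i, j) a (i + j + k)%N.

(** Each term of the Leibniz formula takes one entry from every column. *)
Lemma cmod_det_le n (M : 'M[R[i]]_n) (b : 'I_n -> R) :
  (forall i j, cmod (M i j) <= b j) -> cmod (\det M) <= n`!%:R * \prod_j b j.
Proof.
move=> h; apply: le_trans (cmod_sum _ _ _) _.
apply: (le_trans (y := \sum_(s : 'S_n) \prod_j b j)); last first.
  by rewrite sumr_const card_Sn mulr_natl.
apply: ler_sum => s _; rewrite cmodM cmodX cmodN cmod1 expr1n mul1r cmod_prod.
rewrite [leRHS](reindex_inj (@perm_inj _ s)) /=; apply: ler_prod => i _.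
by rewrite cmod_ge0 h.
Qed.

(** Hankel determinants of the Maclaurin series of a function meromorphic in a
    disc of radius larger than one tend to zero: column operations with the
    coefficients of a polynomial clearing the poles replace all but boundedly
    many columns by geometrically small ones. *)
Lemma hankel_small c k s t : 0 < s <= 1 -> geo c s -> 1 < t -> mero_coef c t ->
  exists n, cmod (\det (hankel c k n)) < 1.
Proof.
move=> /andP[s0 s1] [A hA] t1 [P P0 [B hB]].
have t0 : 0 < t by lra.
pose m := (size P).-1.
have hP p : (m < p)%N -> P`_p = 0.
  by move=> mp; rewrite nth_default //; move: mp; rewrite /m; case: (size P).
have p0 : 0 < cmod P.[0] by rewrite cmod_gt0.
pose A1 := A + 1; pose B1 := B + 1.
have A10 : 0 < A1 by rewrite ltr_wpDl ?(gbound_ge0 hA).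
have B10 : 0 < B1 by rewrite ltr_wpDl ?(gbound_ge0 hB).
(* Bound for the entries of column [j] after the column operations; the first [m]
   columns are left as they are. *)
pose b n j := if (j < m)%N then A1 * s^-1 ^+ (n + n + k) else B1 * t^-1 ^+ j.
have sV : 1 <= s^-1 by rewrite invf_ge1.
have hdet n : (m <= n)%N ->
    cmod (\det (hankel c k n)) * cmod P.[0] ^+ (n - m) <= n`!%:R * \prod_(j < n) b n j.
  (* Right multiplication by the triangular matrix [U] convolves the columns from
     the [m]-th on with the coefficients of [P]. *)
  move=> mn; pose U : 'M[R[i]]_n := \matrix_(l, j)
    if (j < m)%N then (l == j)%:R else if (l <= j)%N then P`_(j - l) else 0.
  have dU : \det U = P.[0] ^+ (n - m).
    rewrite -det_tr det_trig; last first.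
      apply/is_trig_mxP => i j ij; rewrite !mxE; case: ifP => _.
        by rewrite -val_eqE /= gtn_eqF.
      by rewrite leqNgt ij.
    under eq_bigr do rewrite !mxE eqxx leqnn subnn -horner_coef0.
    rewrite -(big_mkord xpredT (fun j => if (j < m)%N then 1 else P.[0])).
    rewrite (big_cat_nat (n := m)) //= big_nat big1 ?mul1r; last by move=> i /andP[_ ->].
    rewrite big_nat (eq_bigr (fun=> P.[0])); last by move=> i /andP[mi _]; rewrite ltnNge mi.
    by rewrite -big_nat prodr_const_nat.
  rewrite -cmodX -dU -cmodM -det_mulmx; apply: cmod_det_le => i j.
  rewrite mxE /b; case: (ltnP j m) => jm.
    rewrite (bigD1 j) //= !mxE jm eqxx mulr1 big1 ?addr0; last first.
      by move=> l lj; rewrite !mxE jm (negPf lj) mulr0.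
    apply: (le_trans (y := A1 * s^-1 ^+ (i + j + k))).
      rewrite exprVn ler_pdivlMr ?exprn_gt0 //; apply: le_trans (hA _) _; rewrite /A1; lra.
    apply: ler_wpM2l; first exact: ltW.
    apply: ler_weXn2l => //; rewrite leq_add2r leq_add // ltnW //; exact: ltn_ord.
  have -> : \sum_(l < n) hankel c k n i l * U l j = pcprod P c (i + j + k).
    rewrite /pcprod /cprod.
    rewrite (eq_bigr (fun l : 'I_n => if (l <= j)%N then c (i + l + k)%N * P`_(j - l) else 0)); last first.
      move=> l _; rewrite !mxE ltnNge jm /=; case: ifP => _ //; exact: mulr0.
    rewrite -(big_mkord xpredT (fun l => if (l <= j)%N then c (i + l + k)%N * P`_(j - l) else 0)).
    rewrite (big_cat_nat (n := j.+1)) //= [X in _ + X]big_nat [X in _ + X]big1 ?addr0; last first.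
      by move=> l /andP[jl _]; rewrite leqNgt jl.
    rewrite -(big_mkord xpredT (fun p => P`_p * c (i + j + k - p)%N)).
    rewrite [RHS](big_cat_nat (n := j.+1)) //=; last by rewrite ltnS -addnA addnCA leq_addr.
    rewrite [X in _ + X]big_nat [X in _ + X]big1 ?addr0; last first.
      by move=> p /andP[jp _]; rewrite hP ?mul0r // (leq_ltn_trans jm).
    rewrite big_nat_rev /= add0n; apply: eq_big_nat => p /andP[_ pj].
    rewrite subSS leq_subr mulrC; congr (P`_ _ * c _).
      by rewrite subKn.
    by move: pj; lia.
  have h := hB (i + j + k)%N; rewrite -ler_pdivlMr ?exprn_gt0 // in h.
  apply: le_trans h _; rewrite -exprVn; apply: (le_trans (y := B1 * t^-1 ^+ (i + j + k))).
    by apply: ler_wpM2r; [rewrite exprn_ge0 // invr_ge0 ltW|rewrite /B1; lra].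
  apply: ler_wpM2l; first exact: ltW.
  apply: ler_wiXn2l; [by rewrite invr_ge0 ltW|by rewrite invf_le1 // ltW|].
  by rewrite -addnA addnCA leq_addr.
pose K := s^-1 ^+ (m + m) * B1 / cmod P.[0].
have K0 : 0 < K by rewrite divr_gt0 // mulr_gt0 // exprn_gt0 // invr_gt0.
(* The factor [t^-1 ^+ n] of the last column beats the factorial, since passing
   from [n] to [n.+1] multiplies the bound by [n.+1 * t^-1 ^+ n] and a constant. *)
pose E n : R := (n`!%:R * \prod_(j < n) b n j) / cmod P.[0] ^+ (n - m).
have b0 n j : 0 < b n j.
  by rewrite /b; case: ifP => _; rewrite mulr_gt0 // exprn_gt0 // invr_gt0.
have E0 n : 0 < E n.
  by rewrite divr_gt0 ?exprn_gt0 // mulr_gt0 ?ltr0n ?fact_gt0 // prodr_gt0.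
have ES n : (m <= n)%N -> E n.+1 = E n * (n.+1%:R * t^-1 ^+ n * K).
  move=> mn; rewrite /E factS natrM big_ord_recr /= subSn // exprS.
  have -> : \prod_(j < n) b n.+1 j = \prod_(j < n) b n j * s^-1 ^+ (m + m).
    rewrite -(big_mkord xpredT (b n.+1)) -(big_mkord xpredT (b n)).
    rewrite (big_cat_nat (n := m)) // [in RHS](big_cat_nat (n := m)) //=.
    have -> : \prod_(m <= j < n) b n.+1 j = \prod_(m <= j < n) b n j.
      by apply: eq_big_nat => j /andP[mj _]; rewrite /b ltnNge mj.
    rewrite mulrAC; congr (_ * _).
    transitivity (\prod_(0 <= j < m) (b n j * s^-1 ^+ 2)).
      apply: eq_big_nat => j /andP[_ jm]; rewrite /b jm -mulrA -exprD.
      by congr (_ * _ ^+ _); rewrite addSn addnS addn2 !addSn.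
    by rewrite big_split /= prodr_const_nat subn0 -exprM mul2n addnn.
  rewrite [b n.+1 n]/b ltnNge mn /= /K.
  have f1 : cmod P.[0] ^+ (n - m) != 0 by rewrite expf_neq0 // gt_eqF.
  have f2 : cmod P.[0] != 0 by rewrite gt_eqF.
  move: (n`!%:R) (\prod_(j < n) _) (s^-1 ^+ _) (t^-1 ^+ n) f1 => x1 x2 x3 x4.
  by move: (cmod P.[0]) f2 (_ ^+ (n - m)) => x5 f2 x6 f1; field; rewrite f1 f2.
have tV : 0 <= t^-1 < 1 by rewrite invr_ge0 ltW // invf_lt1.
have e0 : 0 < (2 * t * K)^-1 by rewrite invr_gt0 mulr_gt0 // mulr_gt0.
have [N hN] := linear_expr_small tV e0.
pose M := maxn N m.
have hE i : E (M + i)%N <= E M * (1 / 2) ^+ i.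
  elim: i => [|i IH]; first by rewrite addn0 mulr1.
  rewrite addnS ES; last by rewrite (leq_trans (leq_maxr N m)) // leq_addr.
  have {}hN := hN (M + i).+1 (leq_trans (leq_maxl N m) (leqW (leq_addr _ _))).
  have tK : 0 < t * K by rewrite mulr_gt0.
  have h : (M + i).+1%:R * t^-1 ^+ (M + i) * K <= 1 / 2.
    move: hN; rewrite exprSr -(ltr_pM2r tK); move: (_ ^+ (M + i)) (_.+1%:R) => x y.
    have -> : y * (x / t) * (t * K) = y * x * K by field; rewrite gt_eqF.
    have -> : (2 * t * K)^-1 * (t * K) = 1 / 2 by field; rewrite !gt_eqF.
    exact: ltW.
  apply: (le_trans (y := E M * (1 / 2) ^+ i * (1 / 2))); last by rewrite [_ ^+ i.+1]exprSr -[leLHS]mulrA.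
  apply: ler_pM => //; first exact: ltW.
  apply: mulr_ge0; last exact: ltW.
  by apply: mulr_ge0 => //; rewrite exprn_ge0 // invr_ge0 ltW.
have [||x hx] := @expr_small R (1 / 2) (E M)^-1; [lra|by rewrite invr_gt0|].
have mM : (m <= M + x)%N by rewrite (leq_trans (leq_maxr N m)) // leq_addr.
exists (M + x)%N; have := hdet _ mM; rewrite -ler_pdivlMr ?exprn_gt0 // -/(E _) => h.
apply: le_lt_trans h (le_lt_trans (hE x) _).
have := hx x (leqnn x); rewrite -(ltr_pM2l (E0 M)) divff // gt_eqF //.
Qed.

(** Left multiplication by the triangular Toeplitz matrix of [f] turns the first
    column of the Hankel matrix of [1 / f] into a unit vector; the remaining minor is
    minus the shifted Hankel matrix of [f] times a unitriangular matrix. *)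
Lemma det_hankel_inverse f v n : f 0%N = 1 -> (forall n, cprod f v n = (n == 0%N)%:R) ->
  \det (hankel v 0 n.+1) = (-1) ^+ n * \det (hankel f 2 n).
Proof.
move=> f0 hfv.
pose T : 'M[R[i]]_n.+1 := \matrix_(i, j) if (j <= i)%N then f (i - j)%N else 0.
pose U : 'M[R[i]]_n := \matrix_(l, j) if (l <= j)%N then v (j - l)%N else 0.
have v0 : v 0%N = 1 by have := hfv 0%N; rewrite /cprod big_ord1 f0 mul1r.
have dT : \det T = 1.
  rewrite det_trig; last by apply/is_trig_mxP => i j ij; rewrite mxE leqNgt ij.
  by rewrite big1 // => i _; rewrite mxE leqnn subnn.
have dU : \det U = 1.
  rewrite -det_tr det_trig; last by apply/is_trig_mxP => i j ij; rewrite !mxE leqNgt ij.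
  by rewrite big1 // => i _; rewrite !mxE leqnn subnn.
have TH i j : (T *m hankel v 0 n.+1) i j = \sum_(k < i.+1) f (i - k)%N * v (k + j)%N.
  rewrite mxE.
  transitivity (\sum_(k < n.+1) if (k <= i)%N then f (i - k)%N * v (k + j)%N else 0).
    by apply: eq_bigr => k _; rewrite !mxE addn0; case: ifP => _ //; rewrite mul0r.
  rewrite -(big_mkord xpredT (fun k => if (k <= i)%N then f (i - k)%N * v (k + j)%N else 0)).
  rewrite (big_cat_nat (n := i.+1)) //= [X in _ + X]big_nat [X in _ + X]big1 ?addr0; last first.
    by move=> k /andP[ik _]; rewrite leqNgt ik.
  rewrite big_mkord; apply: eq_bigr => k _; by rewrite -ltnS ltn_ord.
have conv0 i : \sum_(k < i.+1) f (i - k)%N * v k = (i == 0%N)%:R.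
  rewrite -hfv /cprod (reindex_inj rev_ord_inj) /=; apply: eq_bigr => k _.
  by rewrite subSS subKn // -ltnS.
have convS i j : \sum_(k < i.+1) f (i - k)%N * v (k + j.+1)%N =
    - \sum_(l < j.+1) f (i + l + 1)%N * v (j - l)%N.
  apply/eqP; rewrite -addr_eq0; apply/eqP.
  transitivity (cprod f v (i + j.+1)); last by rewrite hfv addnS.
  symmetry.
  rewrite /cprod -addnS -(big_mkord xpredT (fun k => f k * v (i + j.+1 - k)%N)).
  rewrite (big_cat_nat (n := i.+1)) //=; last by rewrite addnS ltnS leq_addr.
  congr (_ + _).
    rewrite big_nat_rev /= add0n big_mkord; apply: eq_bigr => k _.
    have ki : (k <= i)%N by rewrite -ltnS.
    by rewrite subSS; congr (_ * v _); lia.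
  rewrite -{1}[i.+1]add0n big_addn big_mkord (_ : (i + j.+2 - i.+1 = j.+1)%N); last by lia.
  by apply: eq_bigr => l _; congr (f _ * v _); have := ltn_ord l; lia.
have -> : \det (hankel v 0 n.+1) = \det (T *m hankel v 0 n.+1) by rewrite det_mulmx dT mul1r.
rewrite (expand_det_col _ ord0) (bigD1 ord0) //= big1 ?addr0; last first.
  move=> i i0; rewrite TH -[X in X * _](_ : (i == 0%N :> nat)%:R = _).
    by rewrite -[_ == _]/(i == ord0) (negPf i0) mul0r.
  by rewrite -conv0; apply: eq_bigr => k _; rewrite addn0.
rewrite TH big_ord1 /= f0 v0 mul1r /cofactor /= expr0 !mul1r.
have -> : row' ord0 (col' ord0 (T *m hankel v 0 n.+1)) = - (hankel f 2 n *m U).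
  apply/matrixP => i j; rewrite !mxE; have := TH (lift ord0 i) (lift ord0 j).
  rewrite mxE => ->; rewrite /= /bump /= !add1n convS; congr (- _).
  transitivity (\sum_(l < n) if (l <= j)%N then f (i + l + 2)%N * v (j - l)%N else 0); last first.
    by apply: eq_bigr => l _; rewrite !mxE; case: ifP => _ //; rewrite mulr0.
  rewrite -(big_mkord xpredT (fun l => if (l <= j)%N then f (i + l + 2)%N * v (j - l)%N else 0)).
  rewrite (big_cat_nat (n := j.+1)) //= [X in _ + X]big_nat [X in _ + X]big1 ?addr0; last first.
    by move=> k /andP[ik _]; rewrite leqNgt ik.
  rewrite big_mkord; apply: eq_bigr => k _; rewrite -ltnS ltn_ord.
  by congr (f _ * _); lia.
by rewrite -scaleN1r detZ det_mulmx dU mulr1.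
Qed.

(** For [W = jden] and [V = 1 / W], the functional equation expresses the twice
    shifted coefficients of [W] by those of [V] up to unimodular factors, and
    inversion expresses the Hankel determinants of [V] by those of [W] of size
    one less. So all of them have modulus one. *)
Lemma cmod_det_hankel_jden (q : R[i]) v n : cmod q = 1 -> jfraction q v ->
  cmod (\det (hankel (jden q v) 2 n)) = 1.
Proof.
move=> q1 hv; have hqX k : cmod (q ^+ k) = 1 by rewrite cmodX q1 expr1n.
have E k : cmod (\det (hankel (jden q v) 2 k)) = cmod (\det (hankel v 0 k)).
  pose d : 'rV[R[i]]_k := \row_i (q ^+ 2) ^+ i.
  have -> : hankel (jden q v) 2 k = (- q ^+ 3) *: (diag_mx d *m hankel v 0 k *m diag_mx d).
    apply/matrixP => i j; rewrite mul_mx_diag mul_diag_mx !mxE addn2 addn0 /=.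
    by rewrite exprD; ring.
  have dd : cmod (\det (diag_mx d)) = 1.
    rewrite det_diag cmod_prod big1 // => i _.
    by rewrite mxE cmodX hqX expr1n.
  by rewrite detZ !det_mulmx !cmodM dd cmodX cmodN hqX expr1n mul1r mul1r mulr1.
elim: n => [|n IH]; first by rewrite det_mx00 cmod1.
by rewrite E (det_hankel_inverse n _ hv) // cmodM cmodX cmodN cmod1 expr1n mul1r.
Qed.

End hankel.

(** * Identity theorem and quotients on discs *)

Section quotients.
Context {R : realType}.
Implicit Types (w z v : R[i]) (t : R).

(** A closed disc is chained by small steps along a radius; the compactness
    argument makes the step uniform. *)
Lemma disc_locally_constant t (Z : R[i] -> Prop) :
  (forall w, cmod w <= t -> exists2 e, 0 < e & forall v, cmod (v - w) < e -> (Z v <-> Z w)) ->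
  forall z, cmod z <= t -> Z z -> Z 0.
Proof.
move=> hZ z zt Zz.
have [|e e0 he] := @disc_uniform R t (fun d w => forall v, cmod (v - w) < d -> (Z v <-> Z w)).
  move=> w /hZ[e e0 he]; exists (e / 2); first by lra.
  move=> x d xw /andP[d0 de] v vx.
  have h1 : Z v <-> Z w by apply: he; have := cmod_tri x v w; lra.
  have h2 : Z x <-> Z w by apply: he; lra.
  by split; [move/h1/h2|move/h2/h1].
pose N := (Num.bound (cmod z / (e / 2))).+1.
have N0 : 0 < N%:R :> R by rewrite ltr0n.
have zN : cmod z < (e / 2) * N%:R.
  rewrite mulrC -ltr_pdivrMr; last by lra.
  apply: lt_trans (archi_boundP _) _; last by rewrite ltr_nat.
  by rewrite divr_ge0 ?cmod_ge0 //; lra.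
have step k : (k <= N)%N -> Z (z * ((N - k)%:R / N%:R : R)%:C).
  elim: k => [|k IH] kN; first by rewrite subn0 divff ?gt_eqF // rmorph1 mulr1.
  have le1 : ((N - k.+1)%:R / N%:R : R) <= 1 by rewrite ler_pdivrMr // mul1r ler_nat leq_subr.
  have ge0 : 0 <= ((N - k.+1)%:R / N%:R : R) by rewrite divr_ge0.
  have wt : cmod (z * ((N - k.+1)%:R / N%:R : R)%:C) <= t.
    rewrite cmodM cmodR_ge0 //; by apply: le_trans zt; rewrite ler_piMr // cmod_ge0.
  apply: (he (e / 2) _ _ wt (z * ((N - k)%:R / N%:R : R)%:C) _).1; first by lra.
    rewrite -mulrBr -rmorphB cmodM -mulrBl -natrB; last by rewrite leq_sub2l.
    rewrite (_ : (N - k - (N - k.+1) = 1)%N); last by move: kN; lia.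
    by rewrite cmodR_ge0 ?divr_ge0 // div1r ltr_pdivrMr.
  exact/IH/ltnW.
by have := step N (leqnn N); rewrite subnn mul0r rmorph0 mulr0.
Qed.

Lemma PS_zero_disc a s z : geo a s -> cmod z < s -> (\forall w \near z, PS a w = 0) ->
  a =1 (fun=> 0).
Proof.
move=> ha zs hz; have s0 := le_lt_trans (cmod_ge0 z) zs.
have /nearC[e e0 he] : \forall w \near (0 : R[i]), PS a w = 0.
  apply: (@disc_locally_constant (cmod z) (fun v => \forall w \near v, PS a w = 0)) hz => //.
  move=> w wz; have [hw|hw] := pselect (\forall v \near w, PS a v = 0).
    have /nearC[e e0 he] := hw; exists e; first exact: e0.
    move=> v vw; split=> [_|_]; first exact: hw.
    apply/nearC; exists (e - cmod (v - w)); first by rewrite subr_gt0.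
    by move=> x xv; apply: he; have := cmod_tri v x w; lra.
  have hA : analytic_at (PS a) w by apply: PS_analytic ha _; exact: le_lt_trans zs.
  have /existsNP[d /not_implyP[d0 hd]] := contra_not (analytic_zero hA) hw.
  exists d; first exact: d0.
  by move=> v vw; split=> [hv|hv']; [exfalso; apply: hd; exists v|exfalso; apply: hw].
apply: (PS_eq0 s0 e0 ha) => w we; apply: he; by rewrite subr0.
Qed.

Lemma meromorphic_quotient (f g : R[i] -> R[i]) z : analytic_at f z -> analytic_at g z ->
  ~ (\forall w \near z, g w = 0) -> meromorphic_at (fun w => f w / g w) z.
Proof.
move=> hf hg hn; have [n [g1 [hg1 g10 /nearC[e e0 he]]]] := analytic_factor hg hn.
exists n, (fun w => f w * (g1 w)^-1); split.
  exact: analyticM hf (analyticV hg1 g10).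
have c0 : 0 < cmod (g1 z) by rewrite cmod_gt0.
have /nearC[d d0 hd] := analytic_continuous hg1 c0.
apply/dnearC; exists (Num.min e d); first by rewrite lt_min e0.
move=> w; rewrite lt_min => /andP[we wd] wz; rewrite he //.
have gw : g1 w != 0.
  by apply: contraTneq (hd _ wd) => ->; rewrite sub0r cmodN ltxx.
have wz0 : (w - z) ^+ n != 0 by rewrite expf_neq0 // subr_eq0.
by move: wz0 gw; move: (_ ^+ n) (g1 w) (f w) => x y u x0 y0; field; rewrite x0 y0.
Qed.

End quotients.

(** * Bounds for the radius of meromorphy *)

Section radius_of_meromorphy.
Context {R : realType}.
Variable q : R[i].
Hypothesis q1 : cmod q = 1.
Hypothesis qnr : not_root_of_unity q.

(** A radius larger than one would make the Hankel determinants of the Maclaurin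
    series tend to zero, but they all have modulus one. *)
Lemma rho_le1 : (rho q <= 1)%E.
Proof.
rewrite leNgt; apply/negP => r1.
have [v [s [hv /andP[s0 sj] hc hcs hs]]] := Hq_maclaurin q1 qnr.
have [u u1 hu] := meromorphy_radius_coef s0 hcs hs ltr01 r1.
have j01 : 0 < jradius q <= 1.
  rewrite jradius_gt0 /= /jradius invf_le1; have := cmod_ge0 (1 + q); lra.
have [n] := hankel_small 2 j01 hc u1 hu.
have -> : hankel (hcoef q v) 2 n = hankel (jden q v) 2 n.
  by apply/matrixP => i j; rewrite !mxE addn2 /hcoef subr0.
by rewrite cmod_det_hankel_jden // ltxx.
Qed.

(** The Maclaurin series of [H] itself converges in the disc of radius [jradius]. *)
Lemma rho_ge_jradius : ((jradius q)%:E <= rho q)%E.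
Proof.
have [v [s [hv /andP[s0 sj] hc hcs hs]]] := Hq_maclaurin q1 qnr.
apply: (meromorphy_radius_ge s0 hcs hs).
exists 1; first by rewrite hornerC oner_eq0.
have [A hA] := hc; exists A => j; rewrite (_ : pcprod 1 _ j = hcoef q v j) //.
rewrite /pcprod /cprod big_ord_recl /= coef1 mul1r subn0 big1 ?addr0 // => i _.
by rewrite coef1 mul0r.
Qed.

Lemma continuation_exists : exists h, meromorphic_continuation (Hq q) (rho q) h.
Proof.
have [v [s [hv /andP[s0 sj] hc hcs hs]]] := Hq_maclaurin q1 qnr.
exact: meromorphy_radius_attained s0 hcs hs.
Qed.

Lemma jradius_ge4 : (4^-1 <= jradius q)%R.
Proof.
rewrite lef_pV2 ?posrE; have := cmodD 1 q; rewrite cmod1 q1; have := cmod_ge0 (1 + q); lra.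
Qed.

(** There [H] is the quotient of two convergent series. *)
Lemma rho_ge_Rq : (Rq q <= rho q)%E.
Proof.
have [Rpos|Rneg] := ltP 0%E (Rq q); last first.
  by apply: le_trans Rneg _; apply: le_trans rho_ge_jradius; rewrite lee_fin ltW // jradius_gt0.
apply: ereal_sup_ubound.
exists (Hq q); split; last by apply/nearC; exists 1.
have E : Hq q = (fun z => PS (Gcoef q) z / PS (Gcoef q) (q * z)).
  by apply/funext => z; rewrite /Hq Rpos.
have hG t : 0 < t -> (t%:E < Rq q)%E -> geo (Gcoef q) t.
  by move=> t0 tR; apply: geo_lt_radius tR; exact: ltW.
rewrite E => z zR; have [t zt tR] := ereal_between zR.
have t0 : 0 < t by exact: le_lt_trans (cmod_ge0 z) zt.
apply: meromorphic_quotient; first exact: PS_analytic (hG _ t0 tR) zt.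
  by apply: analytic_rot => //; apply: PS_analytic (hG _ t0 tR) _; rewrite cmod_qM.
move=> hz; have hr := geo_rot q1 (hG _ t0 tR).
have /(PS_zero_disc hr zt)/(_ 0%N) : \forall w \near z, PS (fun j => Gcoef q j * q ^+ j) w = 0.
  by move: hz; apply: filterS => w; rewrite PS_rot.
by rewrite Gcoef0 mulr1 => /eqP; rewrite oner_eq0.
Qed.

End radius_of_meromorphy.

(** * Density of the orbits of an irrational rotation *)

Section orbits.
Context {R : realType}.
Implicit Types (x y : R) (z w u : R[i]).

(** Mean value theorem. *)
Lemma lipschitz1 (f df : R -> R) : (forall x, is_derive x 1 f (df x)) ->
  (forall x, `|df x| <= 1) -> forall x y, `|f x - f y| <= `|x - y|.
Proof.
move=> hf hdf.
have lt x y : x < y -> `|f x - f y| <= `|x - y|.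
  move=> xy; have [|c _ E] := @MVT R f df x y xy (fun v _ => hf v).
    apply: continuous_subspaceT => v.
    by apply/differentiable_continuous/derivable1_diffP; have := hf v; case.
  by rewrite distrC E [leRHS]distrC normrM ler_piMl.
move=> x y; have [|/lt|->] := ltgtP x y; first exact: lt.
  by rewrite distrC [leRHS]distrC.
by rewrite !subrr.
Qed.

Lemma cis_lipschitz x y : cmod (cis x - cis y) <= 2 * `|x - y|.
Proof.
apply: le_trans (cmod_le _) _; rewrite /=.
have h1 := lipschitz1 (fun x => is_derive_cos x) (fun x => _) x y.
have h2 := lipschitz1 (fun x => is_derive_sin x) (@cos_max R) x y.
have {}h1 : `|cos x - cos y| <= `|x - y|.
  by apply: h1 => z; rewrite normrN sin_max.
by rewrite mulr_natl mulr2n; exact: lerD.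
Qed.

Lemma cis_sub2pi x n : cis (x - n%:R * (2 * pi)) = cis x.
Proof.
rewrite -[in RHS](subrK (n%:R * (2 * pi)) x).
by rewrite [RHS]cisD -(cisX (2 * pi) n) cis_2pi expr1n mulr1.
Qed.

Lemma cisN x : cis (- x) = (cis x)^-1.
Proof.
have x0 : cis x != 0 :> R[i] by rewrite -cmod_gt0 cmod_cis.
by apply: (mulfI x0); rewrite divff // -cisD subrr cis0.
Qed.

Lemma cis_surj z : cmod z = 1 -> exists2 x, 0 <= x & z = cis x.
Proof.
case: z => a b; rewrite /cmod /= => h.
have h1 : a ^+ 2 + b ^+ 2 = 1.
  by rewrite -[LHS]sqr_sqrtr ?addr_ge0 ?sqr_ge0 // h expr1n.
have a1 : -1 <= a <= 1.
  by rewrite -ler_norml -(@ler_pXn2r _ 2) ?nnegrE // expr1n real_normK ?num_real // -h1 lerDl sqr_ge0.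
have a1' : a \in `[(-1), 1] by rewrite in_itv.
have s : sin (acos a) = `|b|.
  by rewrite sin_acos // -h1 addrAC subrr add0r sqrtr_sqr.
have [b0|b0] := leP 0 b.
  by exists (acos a); [exact: acos_ge0|rewrite /cis acosK // s ger0_norm].
exists (2 * pi - acos a).
  rewrite subr_ge0 (le_trans (acos_lepi a1)) // ler_peMl ?pi_ge0 //; lra.
by rewrite cisD cis_2pi mul1r /cis cosN sinN acosK // s ltr0_norm // opprK.
Qed.

End orbits.

Section density.
Context {R : realType}.
Variable q : R[i].
Hypothesis q1 : cmod q = 1.
Hypothesis qnr : not_root_of_unity q.
Implicit Types (u w z : R[i]) (d e : R).

(** Pigeonhole: among [N + 1] points of the orbit two fall in the same arc of
    length [2 pi / N]. *)
Lemma small_return d : 0 < d -> exists m x, [/\ (0 < m)%N, q ^+ m = cis x, x != 0 & `|x| < d].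
Proof.
move=> d0; have [a a0 qa] := cis_surj q1.
have p0 : 0 < 2 * pi :> R by rewrite mulr_gt0 ?pi_gt0.
pose N := (Num.bound (2 * pi / d)).+1.
have N0 : 0 < N%:R :> R by rewrite ltr0n.
have Nd : 2 * pi / N%:R < d.
  rewrite ltr_pdivrMr // [d * _]mulrC -ltr_pdivrMr //.
  apply: lt_trans (archi_boundP _) _; last by rewrite ltr_nat.
  by rewrite divr_ge0 // ltW.
pose x (k : nat) : R := k%:R * a - (Num.trunc (k%:R * a / (2 * pi)))%:R * (2 * pi).
have xb k : 0 <= x k < 2 * pi.
  have h : 0 <= k%:R * a / (2 * pi) by apply: divr_ge0; [exact: mulr_ge0|exact: ltW].
  have /andP[] := truncn_itv h; rewrite ler_pdivlMr // ltr_pdivrMr // -natr1 /x => h1 h2.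
  by apply/andP; split; lra.
have xq k : cis (x k) = q ^+ k by rewrite /x cis_sub2pi -cisX -qa.
have yb k : 0 <= x k / (2 * pi) * N%:R < N%:R.
  have /andP[h1 h2] := xb k; apply/andP; split.
    by apply: mulr_ge0 => //; apply: divr_ge0 => //; exact: ltW.
  by rewrite -[ltRHS]mul1r ltr_pM2r // ltr_pdivrMr // mul1r.
have Fb (k : 'I_N.+1) : (Num.trunc (x k / (2 * pi) * N%:R) < N)%N.
  have /andP[h1 h2] := yb k; have /andP[h3 _] := truncn_itv h1.
  by rewrite -(ltr_nat R) (le_lt_trans h3).
pose F (k : 'I_N.+1) : 'I_N := Ordinal (Fb k).
have : ~~ injectiveb F.
  by apply/negP => /injectiveP/leq_card; rewrite !card_ord ltnn.
move=> /injectivePn[i [j ij]].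
wlog lt_ij : i j ij / (i < j)%N.
  move=> H; have [lt|lt|/val_inj eq] := ltngtP i j; first exact: H.
    by move=> E; apply: (H j i) => //; rewrite eq_sym.
  by rewrite eq eqxx in ij.
move=> /(congr1 val) /= E.
have /andP[i0 i1] := yb i; have /andP[j0 j1] := yb j.
have /andP[] := truncn_itv i0; have /andP[] := truncn_itv j0; rewrite E -(natr1 (Num.trunc (x j / _ * _))) => h1 h2 h3 h4.
have q0 : q != 0 by rewrite -cmod_gt0 q1.
exists (j - i)%N, (x j - x i); rewrite subn_gt0 lt_ij.
have qE : q ^+ (j - i) = cis (x j - x i).
  by rewrite cisD cisN !xq expfB.
split => //.
  apply: contraTneq (qnr (_ : (0 < j - i)%N)); last by rewrite subn_gt0.
  by rewrite qE => ->; rewrite cis0 eqxx.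
apply: lt_trans Nd; rewrite ltr_pdivlMr //.
have h5 : `|x j / (2 * pi) * N%:R - x i / (2 * pi) * N%:R| < 1.
  by rewrite ltr_norml; apply/andP; split; lra.
move: h5; rewrite -mulrBl -mulrBl mulrAC normrM [`|_^-1|]ger0_norm; last by rewrite invr_ge0 ltW.
by rewrite ltr_pdivrMr // mul1r normrM [`|N%:R|]ger0_norm // ltW.
Qed.

(** The powers of a small nontrivial rotation pass near every point. The rotation
    may be backwards, in which case the target angle is taken negative. *)
Lemma orbit_dense u w e : cmod u = cmod w -> 0 < e -> exists k, cmod (q ^+ k * u - w) < e.
Proof.
move=> uw e0; have [u0|u0] := eqVneq u 0.
  exists 0%N; rewrite u0 mulr0 sub0r cmodN -uw u0 cmod0 //.
have cu : 0 < cmod u by rewrite cmod_gt0.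
pose d := e / (cmod u * 2); have d0 : 0 < d by rewrite divr_gt0 // mulr_gt0.
have [y y0 yE] : exists2 y : R, 0 <= y & w / u = cis y.
  by apply: cis_surj; rewrite cmod_div -uw divff // gt_eqF.
have [m [x [m0 qx x0 xd]]] := small_return d0.
suff [k [z [zE zx]]] : exists k (z : R), w / u = cis z /\ `|k%:R * x - z| <= `|x|.
  exists (m * k)%N; rewrite exprM qx cisX.
  have -> : cis (k%:R * x) * u - w = (cis (k%:R * x) - cis z) * u.
    by rewrite mulrBl -zE divfK.
  rewrite cmodM -ltr_pdivlMr //; apply: le_lt_trans (cis_lipschitz _ _) _.
  rewrite -ltr_pdivlMl //; apply: le_lt_trans zx _.
  by have -> : 2^-1 * (e / cmod u) = d by rewrite /d; field; rewrite gt_eqF.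
have key (z : R) : 0 <= z / x -> `|(Num.trunc (z / x))%:R * x - z| <= `|x|.
  move=> zx0; have /andP[h1 h2] := truncn_itv zx0.
  rewrite -natr1 in h2; move: h1 h2; set n : R := _%:R => h1 h2.
  have -> : n * x - z = (n - z / x) * x by rewrite mulrBl divfK.
  rewrite normrM ler_piMl // ler_norml; apply/andP; split; lra.
have [xp|xn] := ltP 0 x.
  by exists (Num.trunc (y / x)), y; split => //; apply: key; rewrite divr_ge0 // ltW.
pose n := (Num.bound (y / (2 * pi))).+1.
have p0 : 0 < 2 * pi :> R by rewrite mulr_gt0 ?pi_gt0.
have yn : y <= n%:R * (2 * pi).
  rewrite -ler_pdivrMr // ltW //; apply: lt_trans (archi_boundP _) _; last by rewrite ltr_nat.
  by rewrite divr_ge0 // ltW.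
pose z := y - n%:R * (2 * pi).
exists (Num.trunc (z / x)), z; split; first by rewrite cis_sub2pi.
apply: key; rewrite -mulrNN; apply: mulr_ge0; first by rewrite oppr_ge0 subr_le0.
by rewrite oppr_ge0 invr_le0.
Qed.

Lemma orbit_return u e : 0 < e -> exists k, cmod (q ^+ k.+1 * u - u) < e.
Proof.
move=> e0; have [|k hk] := @orbit_dense (q * u) u e _ e0; first exact: cmod_qM.
by exists k; rewrite exprSr -mulrA.
Qed.

End density.

(** * The natural boundary of G *)

Section natural_boundary_of_G.
Context {R : realType}.
Variable q : R[i].
Hypothesis q1 : cmod q = 1.
Hypothesis qnr : not_root_of_unity q.
Implicit Types (u w z v : R[i]) (d e r s : R) (P Q : {poly R[i]}).

Lemma q_neq0 : q != 0. Proof. by rewrite -cmod_gt0 q1. Qed.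

Lemma cmod_qVX k z : cmod (q ^- k * z) = cmod z.
Proof. by rewrite cmodM cmodV cmodX q1 expr1n invr1 mul1r. Qed.

Lemma qXK k z : q ^+ k * (q ^- k * z) = z.
Proof. by rewrite mulrA divff ?mul1r // expf_neq0 // q_neq0. Qed.

Lemma qVK k z : q ^- k * (q ^+ k * z) = z.
Proof. by rewrite mulrA mulVf ?mul1r // expf_neq0 // q_neq0. Qed.

Lemma qVXB k z w : cmod (q ^- k * z - w) = cmod (z - q ^+ k * w).
Proof. by rewrite -[in LHS](qVK k w) -mulrBr cmod_qVX. Qed.

Lemma poly_near_neq0 P z : P != 0 -> \forall v \near z^', P.[v] != 0.
Proof.
move=> Pn0; apply: analytic_isolated; first exact: analytic_poly.
move=> hP; have z1 : cmod z < cmod z + 1 by lra.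
have z2 : 0 <= cmod z + 1 by have := cmod_ge0 z; lra.
have hP' : \forall w \near z, PS (fun j => P`_j) w = 0.
  by move: hP; apply: filterS => w; rewrite PS_poly.
have E := PS_zero_disc (geo_poly P z2) z1 hP'.
by move/eqP: Pn0; apply; apply/polyP => j; rewrite coef0 E.
Qed.

(** Analytic continuation across [w] of a function given on the disc of radius
    [r], with a uniform radius so that the property is open in [w]. *)
Definition extends (f : R[i] -> R[i]) r w := exists2 e, 0 < e &
  exists2 g, (forall v, cmod (v - w) < e -> analytic_at g v) &
    forall z, cmod (z - w) < e -> cmod z < r -> f z = g z.

Lemma extends_open f r w : extends f r w ->
  exists2 e, 0 < e & forall v, cmod (v - w) < e -> extends f r v.
Proof.
move=> [e e0 [g hg he]]; exists e => // v vw.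
exists (e - cmod (v - w)); first by rewrite subr_gt0.
by exists g => [z zv|z zv]; [apply: hg|apply: he]; have := cmod_tri v z w; lra.
Qed.

Lemma analytic_mulVX f k z : analytic_at f (q ^- k * z) ->
  analytic_at (fun w => f (q ^- k * w)) z.
Proof. by apply: analytic_rot; rewrite cmodV cmodX q1 expr1n invr1. Qed.

Section with_radius.
Variable r : R.
Hypothesis r0 : 0 < r.
Hypothesis hG : forall s, 0 < s < r -> geo (Gcoef q) s.
Let G := PS (Gcoef q).

Lemma geo_at z : cmod z < r -> exists2 s, cmod z < s & geo (Gcoef q) s.
Proof.
move=> zr; have z0 := cmod_ge0 z.
by exists ((cmod z + r) / 2); [lra|apply: hG; lra].
Qed.

(** The functional equation gives [G] at the third of three consecutive points of
    an orbit from the first two. *)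
Lemma extends_step w : w != 0 -> extends G r w -> extends G r (q * w) ->
  extends G r (q ^+ 2 * w).
Proof.
move=> w0 [e e0 [g hg he]] [d d0 [f hf hd]].
have cw : 0 < cmod w by rewrite cmod_gt0.
exists (Num.min (cmod w) (Num.min e d)); first by rewrite !lt_min cw e0.
have sh k v x : cmod (q ^- k * v - x) = cmod (v - q ^+ k * x) by exact: qVXB.
exists (fun v => (g (q ^- 2 * v) - f (q ^- 1 * v)) * (q ^- 1 * v)^-1).
  move=> v; rewrite !lt_min => /and3P[v1 v2 v3].
  have v0 : v != 0.
    by apply: contraTneq v1 => ->; rewrite sub0r cmodN (cmod_qXM q1) ltxx.
  apply: analyticM.
    apply: analyticB; apply: analytic_mulVX; first by apply: hg; rewrite sh.
    by apply: hf; rewrite sh mulrA -expr2.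
  apply: analyticV; last by rewrite mulf_neq0 // invr_neq0 // expf_neq0 // q_neq0.
  by apply: (@analytic_mulVX (fun x => x)); exact: analytic_id.
move=> v; rewrite !lt_min => /and3P[v1 v2 v3] vr.
have v0 : v != 0.
  by apply: contraTneq v1 => ->; rewrite sub0r cmodN (cmod_qXM q1) ltxx.
pose y := q ^- 2 * v.
have yr : cmod y < r by rewrite cmod_qVX.
have vE : v = q ^+ 2 * y by rewrite qXK.
have qyE : q * y = q ^- 1 * v.
  by rewrite vE expr2 -mulrA -[X in X ^- 1 * (X * _)]expr1 qVK.
rewrite -qyE -/y -he; [|by rewrite sh|by []].
rewrite -hd; [|by rewrite qyE sh mulrA -expr2|by rewrite cmod_qM].
have [s ys hs] := geo_at yr.
rewrite {1}/G /G (PS_Gcoef q1 qnr hs ys) addrAC subrr add0r -vE mulrAC divff ?mul1r //.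
by rewrite qyE mulf_neq0 // invr_neq0 // expf_neq0 // q_neq0.
Qed.

Lemma extends_orbit w k : w != 0 -> extends G r w -> extends G r (q * w) ->
  extends G r (q ^+ k * w).
Proof.
move=> w0 h1 h2; suff [] : extends G r (q ^+ k * w) /\ extends G r (q ^+ k.+1 * w) by [].
elim: k => [|k [IH1 IH2]]; first by rewrite expr0 mul1r expr1.
split => //; rewrite (_ : q ^+ k.+2 * w = q ^+ 2 * (q ^+ k * w)).
  apply: extends_step => //; first by rewrite mulf_neq0 // expf_neq0 // q_neq0.
  by rewrite mulrA -exprS.
by rewrite mulrA -exprD.
Qed.

(** Iterating the functional equation expresses [G z] by two consecutive values
    further along the orbit. *)
Lemma PS_Gcoef_iter n : exists P Q, [/\ P.[0] = 1, Q.[0] = 1 &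
  forall z, cmod z < r -> G z = P.[z] * G (q ^+ n.+1 * z) +
    q ^+ n.+1 * z * Q.[z] * G (q ^+ n.+2 * z)].
Proof.
have GE z : cmod z < r -> G z = G (q * z) + q * z * G (q ^+ 2 * z).
  by move=> /geo_at[s zs hs]; exact: (@PS_Gcoef _ q q1 qnr s z hs zs).
(* From here on [G] is any solution of the equation. *)
move: (G) GE => {}g GE.
elim: n => [|n [P [Q [P0 Q0 IH]]]].
  exists 1, 1; rewrite hornerC; split => // z zr.
  by rewrite hornerC mul1r mulr1 expr1 -GE.
exists (P + q ^+ n.+1 *: ('X * Q)), P; split => //.
  by rewrite hornerD hornerZ hornerM hornerX mul0r mulr0 addr0.
move=> z zr; rewrite IH // hornerD hornerZ hornerM hornerX.
have zr' : cmod (q ^+ n.+1 * z) < r by rewrite cmod_qXM.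
rewrite (GE _ zr').
have -> : q * (q ^+ n.+1 * z) = q ^+ n.+2 * z by rewrite mulrA -exprS.
have -> : q ^+ 2 * (q ^+ n.+1 * z) = q ^+ n.+3 * z by rewrite mulrA -exprD.
ring.
Qed.

Lemma extends_rot f k w : extends (fun z => f (q ^+ k * z)) r w -> extends f r (q ^+ k * w).
Proof.
move=> [e e0 [g hg he]]; exists e => //; exists (fun z => g (q ^- k * z)).
  by move=> v vw; apply: analytic_mulVX; apply: hg; rewrite qVXB.
by move=> z zw zr; rewrite -he ?qXK // ?qVXB // cmod_qVX.
Qed.

(** Two consecutive points of an orbit suffice, and by recurrence of the rotation
    one point of analyticity provides them: eliminate the terms between [z] and
    its return [q^n z] from the functional equation. *)
Lemma extends_pair z0 : cmod z0 = r -> extends G r z0 ->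
  exists w, [/\ cmod w = r, extends G r w & extends G r (q * w)].
Proof.
move=> z0r /extends_open[e e0 he].
have z00 : z0 != 0 by rewrite -cmod_gt0 z0r.
have e20 : 0 < e / 2 by lra.
(* [q ^+ n.+1] brings [z0] back; the second return [z1], close to [z0], avoids the
   zeros of [Q]. *)
have [n hn] := orbit_return q1 qnr z0 e20.
have [P [Q [_ Q0 HPQ]]] := PS_Gcoef_iter n.
have /dnearC[d d0 hd] : \forall z \near z0^', Q.[z] != 0.
  by apply: poly_near_neq0; apply: contra_eq_neq Q0 => ->; rewrite horner0 eq_sym oner_eq0.
have m0 : 0 < Num.min d (e / 2) by rewrite lt_min d0.
have [m] := orbit_return q1 qnr z0 m0; set z1 := q ^+ m.+1 * z0.
rewrite lt_min => /andP[z1d z1e].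
have z10 : z1 != z0.
  by rewrite /z1 -[X in _ != X]mul1r (inj_eq (mulIf z00)) qnr.
have z1r : cmod z1 = r by rewrite cmod_qXM.
have [e1 e10 [g1 hg1 he1]] : extends G r z1 by apply: he; lra.
have [e2 e20' [g2 hg2 he2]] : extends G r (q ^+ n.+1 * z1).
  apply: he; apply: le_lt_trans (cmod_tri (q ^+ n.+1 * z0) _ _) _.
  by rewrite -mulrBr cmod_qXM //; lra.
exists (q ^+ n.+1 * z1); split; first by rewrite cmod_qXM.
  by exists e2 => //; exists g2.
rewrite mulrA -exprS; apply: extends_rot.
have c0 : 0 < cmod (z1 - z0) by rewrite cmod_gt0 subr_eq0.
have cr : 0 < cmod z1 by rewrite z1r.
pose x := Num.min (Num.min (cmod z1) e1) (Num.min e2 (Num.min (d - cmod (z1 - z0)) (cmod (z1 - z0)))).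
have x0 : 0 < x by rewrite !lt_min cr e10 e20' c0 subr_gt0 z1d.
have nz v : cmod (v - z1) < x -> q ^+ n.+1 * v * Q.[v] != 0.
  rewrite /x !lt_min => /andP[/andP[v1 v2] /and3P[v3 v4 v5]].
  rewrite !mulf_neq0 ?expf_neq0 ?q_neq0 //.
    by apply: contraTneq v1 => ->; rewrite sub0r cmodN ltxx.
  apply: hd; first by have := cmod_tri z1 v z0; lra.
  by apply: contraTneq v5 => ->; rewrite cmodC ltxx.
exists x => //; exists (fun v => (g1 v - P.[v] * g2 (q ^+ n.+1 * v)) * (q ^+ n.+1 * v * Q.[v])^-1).
  move=> v vx; have := vx; rewrite /x !lt_min => /andP[/andP[v1 v2] /and3P[v3 v4 v5]].
  apply: analyticM; last first.
    apply: analyticV; last exact: nz.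
    apply: analyticM; last exact: analytic_poly.
    by apply: analyticM; [exact: analytic_cst|exact: analytic_id].
  apply: analyticB; first exact: hg1.
  apply: analyticM; first exact: analytic_poly.
  apply: analytic_rot; first by rewrite cmodX q1 expr1n.
  by apply: hg2; rewrite -mulrBr cmod_qXM.
move=> v vx vr; have := vx; rewrite /x !lt_min => /andP[/andP[v1 v2] /and3P[v3 v4 v5]].
rewrite -he1 // -he2; [|by rewrite -mulrBr cmod_qXM|by rewrite cmod_qXM].
by rewrite (HPQ _ vr) addrAC subrr add0r [_ * G _]mulrC mulfK // nz.
Qed.

Lemma extends_circle z0 : cmod z0 = r -> extends G r z0 ->
  forall w, cmod w = r -> extends G r w.
Proof.
move=> z0r /(extends_pair z0r)[w [wr /extends_open[e e0 he] /extends_open[d d0 hd]]].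
move=> x xr; have m0 : 0 < Num.min e d by rewrite lt_min e0.
have [|k] := orbit_dense q1 qnr (u := w) (w := x) _ m0; first by rewrite wr.
rewrite cmodC -qVXB lt_min => /andP[h1 h2].
rewrite -(qXK k x); apply: extends_orbit; last first.
- by apply: hd; rewrite -mulrBr cmod_qM.
- exact: he.
- by rewrite -cmod_gt0 cmod_qVX xr.
Qed.

End with_radius.

(** A single point of analyticity propagates to the whole circle, and then the
    series would converge on a larger disc. *)
Lemma Gq_natural_boundary : (0 < Rq q)%E -> natural_boundary (Gq q) (Rq q).
Proof.
move=> Rpos z0 z0R [g [hg /nearC[e e0 he]]].
have r0 : 0 < cmod z0 by rewrite -z0R lte_fin in Rpos.
have hG s : 0 < s < cmod z0 -> geo (Gcoef q) s.
  move=> /andP[s0 sr]; apply: geo_lt_radius; first exact: ltW.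
  by rewrite -/(Rq q) -z0R lte_fin.
have [d d0 hd] := near_analytic_radius hg.
have h0 : extends (PS (Gcoef q)) (cmod z0) z0.
  exists (Num.min e d); first by rewrite lt_min e0.
  exists g => [v|z]; rewrite lt_min => /andP[z1 z2]; first exact: hd.
  move=> zr; have zd : disc (Rq q) z by rewrite /disc /= -z0R lte_fin.
  have [s zs hs] := geo_at hG zr.
  have ga : analytic_at (Gq q) z by exact: (PS_analytic hs zs).
  by rewrite (he z z1 zd ga) Gq_PS.
have [|s rs hs] := PS_extends r0 hG.
  move=> w wr; have [x x0 [f hf hx]] := extends_circle r0 hG (erefl _) h0 wr.
  exists f; split; first by apply: hf; rewrite subrr cmod0.
  by exists x.
have := radius_ge_geo (lt_trans r0 rs) hs.
by rewrite -/(Rq q) -z0R lee_fin leNgt rs.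
Qed.

End natural_boundary_of_G.

(** * The natural boundary of H *)

Section natural_boundary_of_H.
Context {R : realType}.
Variable q : R[i].
Hypothesis q1 : cmod q = 1.
Hypothesis qnr : not_root_of_unity q.
Implicit Types (u w z v : R[i]) (d e r s : R) (P Q : {poly R[i]}) (f g h : R[i] -> R[i]).

(** Dividing by a power of [w - z] is harmless away from [z]. *)
Lemma meromorphic_near_analytic h z : meromorphic_at h z ->
  \forall v \near z^', analytic_at h v.
Proof.
move=> [n [g [hg /dnearC[e e0 he]]]]; have [d d0 hd] := near_analytic_radius hg.
apply/dnearC; exists (Num.min e d); first by rewrite lt_min e0.
move=> v; rewrite lt_min => /andP[v1 v2] vz.
have vz0 : v - z != 0 by rewrite subr_eq0.
apply: (@analytic_ext _ (fun w => g w * ((w - z) ^+ n)^-1)); last first.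
  apply: analyticM; first exact: hd.
  apply: analyticV; last by rewrite expf_neq0.
  apply: analyticX; apply: analyticB; [exact: analytic_id|exact: analytic_cst].
have c0 : 0 < cmod (v - z) by rewrite cmod_gt0.
apply/nearC; exists (Num.min (e - cmod (v - z)) (cmod (v - z))).
  by rewrite lt_min subr_gt0 v1.
move=> w; rewrite lt_min => /andP[w1 w2].
have wz : w != z by apply: contraTneq w2 => ->; rewrite cmodC ltxx.
rewrite -he //; last by have := cmod_tri v w z; lra.
by rewrite mulrAC divff ?mul1r // expf_neq0 // subr_eq0.
Qed.

Lemma near_punctured_rot c (A : R[i] -> Prop) z : cmod c = 1 ->
  (\forall v \near (c * z)^', A v) -> \forall v \near z^', A (c * v).
Proof.
move=> c1 /dnearC[e e0 he]; apply/dnearC; exists e => // v vz vz0; apply: he.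
  by rewrite -mulrBr cmodM c1 mul1r.
by rewrite (inj_eq (mulfI _)) // -cmod_gt0 c1.
Qed.

(** The relation [H (q z) (H z - 1) = q z] holds near the origin; after clearing
    the poles with a polynomial it is an identity between power series, hence
    persists in the disc where they converge. *)
Lemma continuation_relation h r : meromorphic_continuation (Hq q) (rho q) h ->
  rho q = r%:E -> forall z, cmod z < r ->
  \forall v \near z^', h (q * v) * (h v - 1) = q * v.
Proof.
move=> hh rE z zr.
have [v [s [hv /andP[s0 sj] hc hcs hs]]] := Hq_maclaurin q1 qnr.
pose t := (cmod z + r) / 2; have z0 := cmod_ge0 z.
have t0 : 0 < t by rewrite /t; lra.
have zt : cmod z < t by rewrite /t; lra.
have tr : (t%:E < rho q)%E by rewrite rE lte_fin /t; lra.
have [P [P0 [u tu hN] hP]] := continuation_coef s0 hcs hs hh t0 tr.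
set N := pcprod P (hcoef q v) in hN hP.
have Pn0 : P != 0 by apply: contraNneq P0 => ->; rewrite horner0.
have key w : cmod w < t -> PS N (q * w) * (PS N w - P.[w]) = q * w * P.[w] * P.[q * w].
  have hNq : geo (fun j => N j * q ^+ j) u by exact: geo_rot.
  have hM : geo (fun j => N j + -1 * P`_j) u.
    by apply: geoD => //; [apply: geoZ; apply: geo_poly|]; lra.
  pose T := (q *: 'X * P * (P \Po (q *: 'X))).
  have TE x : T.[x] = q * x * P.[x] * P.[q * x].
    by rewrite /T !hornerM horner_comp hornerZ hornerX.
  have LE x : cmod x < u -> PS (cprod (fun j => N j * q ^+ j) (fun j => N j + -1 * P`_j)) x =
      PS N (q * x) * (PS N x - P.[x]).
    move=> xu; rewrite (PS_cprod hNq hM xu) PS_rot (PSD hN _ xu); last first.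
      by apply: geoZ; apply: geo_poly; lra.
    by rewrite (PSZ _ (geo_poly P _) xu) ?PS_poly ?mulN1r //; lra.
  have [e /andP[e0 ej] [e8 he]] := PS_hcoef_one_step q1 hv.
  have u0 : 0 < u by lra.
  have hL : geo (cprod (fun j => N j * q ^+ j) (fun j => N j + -1 * P`_j)) (u / 2).
    by apply: geo_cprod hNq hM _; lra.
  have hT : geo (fun j => T`_j) (u / 2) by apply: geo_poly; lra.
  have u20 : 0 < u / 2 by lra.
  have m0 : 0 < Num.min e u by rewrite lt_min e0.
  have E := PS_unique u20 m0 hL hT.
  move=> wt; rewrite -LE; last by lra.
  rewrite -TE -PS_poly; apply: PS_ext; apply: E => x; rewrite lt_min => /andP[xe xu].
  rewrite LE // PS_poly TE.
  have xj : cmod x < jradius q by lra.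
  have qxj : cmod (q * x) < jradius q by rewrite cmod_qM.
  have qxe : cmod (q * x) < e by rewrite cmod_qM.
  rewrite !(PS_pcprod _ hc) //.
  have [_ ->] := he _ xe; have [b _] := he _ qxe.
  have n0 : PS (hcoef q v) (q * x) != 0.
    rewrite -cmod_gt0; have := cmod_tri (PS (hcoef q v) (q * x)) 1 0.
    rewrite !subr0 cmod1 (cmodC 1 (PS _ _)); move: b; move: (cmod _) (cmod _) => b1 b2; lra.
  by field.
have qzt : cmod (q * z) < t by rewrite cmod_qM.
have h1 := hP _ zt; have h2 := near_punctured_rot q1 (hP _ qzt).
have h3 := poly_near_neq0 z Pn0; have h4 := near_punctured_rot q1 (poly_near_neq0 (q * z) Pn0).
near=> x.
have xt : cmod x < t by near: x; exact: dnear_lt0.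
have E1 : P.[x] * h x = PS N x by near: x; exact: h1.
have E2 : P.[q * x] * h (q * x) = PS N (q * x) by near: x; exact: h2.
have a0 : P.[x] != 0 by near: x; exact: h3.
have b0 : P.[q * x] != 0 by near: x; exact: h4.
have := key _ xt; rewrite -E1 -E2; move: a0 b0.
move: (P.[x]) (P.[q * x]) (h x) (h (q * x)) => a b c d a0 b0 E.
apply: (mulfI a0); apply: (mulfI b0).
transitivity (b * d * (a * c - a)); first by ring.
by rewrite E; ring.
Unshelve. all: by end_near.
Qed.

(** Meromorphy across the circle is expressed with quotients of germs, a form
    that the relation [h (q z) (h z - 1) = q z] carries from [w] to [q w]. *)
Definition quotient_extends h r w := exists g1 g2 e, [/\ 0 < e,
  forall v, cmod (v - w) < e -> analytic_at g1 v /\ analytic_at g2 v,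
  forall v, cmod (v - w) < e -> ~ (\forall z \near v, g2 z = 0) &
  forall z, cmod (z - w) < e -> cmod z < r ->
    \forall v \near z^', g2 v * h v = g1 v].

Lemma quotient_extends_open h r w : quotient_extends h r w ->
  exists2 e, 0 < e & forall v, cmod (v - w) < e -> quotient_extends h r v.
Proof.
move=> [g1 [g2 [e [e0 ha hn he]]]]; exists e => // v vw.
have sub z : cmod (z - v) < e - cmod (v - w) -> cmod (z - w) < e.
  by have := cmod_tri v z w; lra.
exists g1, g2, (e - cmod (v - w)); split; first by rewrite subr_gt0.
- by move=> z /sub; exact: ha.
- by move=> z /sub; exact: hn.
- by move=> z /sub; exact: he.
Qed.

Lemma not_locally_zero_near g w : analytic_at g w -> ~ (\forall z \near w, g z = 0) ->
  exists2 e, 0 < e & forall v, cmod (v - w) < e -> ~ (\forall z \near v, g z = 0).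
Proof.
move=> hg hn; apply: contrapT => H; apply: hn; apply: analytic_zero => // d d0.
apply: contrapT => H'; apply: H; exists d => // v vd hv; apply: H'.
by exists v.
Qed.

(** On the rotated neighbourhood [h (q v) = q v / (h v - 1)] becomes the quotient of
    [q v * g2] by [g1 - g2]. The new denominator cannot vanish identically,
    since [h v = 1] at some [v != 0] of the disc would contradict the relation. *)
Lemma quotient_extends_step h r w : 0 < r -> cmod w = r ->
  (forall z, cmod z < r -> \forall v \near z^', h (q * v) * (h v - 1) = q * v) ->
  quotient_extends h r w -> quotient_extends h r (q * w).
Proof.
move=> r0 wr hrel [g1 [g2 [e [e0 ha hn he]]]].
have pB x : cmod (q ^- 1 * x - w) = cmod (x - q * w) by rewrite (qVXB q1) expr1.
have mV x : q * (q ^- 1 * x) = x by have := qXK q1 1 x; rewrite expr1.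
pose f v := g1 (q ^- 1 * v) - g2 (q ^- 1 * v).
have fa v : cmod (v - q * w) < e -> analytic_at f v.
  rewrite -pB => /ha[h1 h2].
  by apply: analyticB; exact: analytic_mulVX.
have [d d0 hd] : exists2 d, 0 < d & forall v, cmod (v - q * w) < d -> ~ (\forall z \near v, f z = 0).
  apply: not_locally_zero_near; first by apply: fa; rewrite subrr cmod0.
  move=> /nearC[d d0 hd].
  have m0 : 0 < Num.min d e by rewrite lt_min d0.
  have [z] := interior_point wr r0 m0; rewrite lt_min => /andP[zd ze] zr.
  have [_ hg2] := ha _ ze.
  near z^' => v.
  have g20 : g2 v != 0 by near: v; exact: analytic_isolated hg2 (hn _ ze).
  have E2 : g2 v * h v = g1 v by near: v; exact: he _ ze zr.
  have E3 : h (q * v) * (h v - 1) = q * v by near: v; exact: hrel _ zr.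
  have v0 : ('X : {poly R[i]}).[v] != 0.
    by near: v; apply: poly_near_neq0; rewrite polyX_eq0.
  rewrite hornerX in v0; have vd : cmod (v - w) < d by near: v; exact: dnear_lt.
  have fv : f (q * v) = 0.
    by apply: hd; rewrite -mulrBr cmod_qM.
  have h1 : h v = 1.
    apply: (mulfI g20); rewrite mulr1 E2; apply/eqP; rewrite -subr_eq0.
    by move: fv; rewrite /f -[X in q ^- 1 * (X * _)]expr1 (qVK q1) => ->.
  move: E3; rewrite h1 subrr mulr0 => /esym/eqP.
  by rewrite mulf_eq0 (negPf v0) (negPf (q_neq0 q1)).
exists (fun y => y * g2 (q ^- 1 * y)), f, (Num.min d e); split.
- by rewrite lt_min d0.
- move=> v; rewrite lt_min => /andP[vd ve]; split; last exact: fa.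
  apply: analyticM; first exact: analytic_id.
  by apply: analytic_mulVX => //; apply: (ha _ _).2; rewrite pB.
- by move=> v; rewrite lt_min => /andP[vd _]; exact: hd.
- move=> y; rewrite lt_min => /andP[_ ye] yr.
  have xe : cmod (q ^- 1 * y - w) < e by rewrite pB.
  have xr : cmod (q ^- 1 * y) < r by rewrite (cmod_qVX q1).
  have cV : cmod (q ^- 1) = 1 by rewrite cmodV cmodX q1 expr1n invr1.
  have h1 := near_punctured_rot cV (he _ xe xr).
  have h2 := near_punctured_rot cV (hrel _ xr).
  apply: filterS2 h1 h2 => v; rewrite mV /f.
  move: (g1 _) (g2 _) (h (q ^- 1 * v)) (h v) => a b c t E1 E2.
  by rewrite -E1 -E2; ring.
Unshelve. all: by end_near.
Qed.

Lemma quotient_extends_mero h r w : quotient_extends h r w -> mero_from_disc h r w.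
Proof.
move=> [g1 [g2 [e [e0 ha hn he]]]].
have ww : cmod (w - w) < e by rewrite subrr cmod0.
have [a1 a2] := ha _ ww.
have [n [u [hu u0 /nearC[d d0 hd]]]] := analytic_factor a2 (hn _ ww).
have c0 : 0 < cmod (u w) by rewrite cmod_gt0.
have /nearC[t t0 ht] := analytic_continuous hu c0.
exists n, (fun v => g1 v * (u v)^-1); split; first exact: analyticM a1 (analyticV hu u0).
exists (Num.min e (Num.min d t)); first by rewrite !lt_min e0 d0.
move=> z; rewrite !lt_min => /and3P[z1 z2 z3] zr.
near=> v.
have <- : g2 v * h v = g1 v by near: v; exact: he.
have vt : cmod (v - w) < t by near: v; exact: dnear_lt.
have uv : u v != 0 by apply: contraTneq (ht _ vt) => ->; rewrite sub0r cmodN ltxx.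
have -> : g2 v = (v - w) ^+ n * u v by apply: hd; near: v; exact: dnear_lt.
by move: uv; move: (u v) ((v - w) ^+ n) (h v) => a b c a0'; field.
Unshelve. all: by end_near.
Qed.

(** One point of analyticity gives meromorphy across the whole circle: first on
    an arc, then by rotation everywhere. The disc of meromorphy would then be
    larger. *)
Lemma Hq_natural_boundary h : meromorphic_continuation (Hq q) (rho q) h ->
  natural_boundary h (rho q).
Proof.
move=> hh z0 z0R [g [hg /nearC[e e0 he]]].
set r := cmod z0 in z0R.
have r0 : 0 < r.
  rewrite -lte_fin z0R; apply: lt_le_trans (rho_ge_jradius q1 qnr).
  by rewrite lte_fin jradius_gt0.
have hmer z : cmod z < r -> meromorphic_at h z.
  by move=> zr; apply: hh.1; rewrite /disc /= -z0R lte_fin.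
have hrel := continuation_relation hh (esym z0R).
have [d d0 hd] := near_analytic_radius hg.
have h0 : quotient_extends h r z0.
  exists g, (fun=> 1), (Num.min e d); split; first by rewrite lt_min e0.
  - move=> v; rewrite lt_min => /andP[_ /hd hv].
    by split; [exact: hv|exact: analytic_cst].
  - move=> v _ /nearC[x x0 /(_ v)]; rewrite subrr cmod0 => /(_ x0) /eqP.
    by rewrite oner_eq0.
  - move=> z; rewrite lt_min => /andP[z1 _] zr.
    near=> v; rewrite mul1r; apply/esym/he.
    - by near: v; exact: dnear_lt.
    - by rewrite /disc /= -z0R lte_fin; near: v; exact: dnear_lt0.
    - by near: v; exact: meromorphic_near_analytic (hmer _ zr).
have [x x0 hx] := quotient_extends_open h0.
have hiter k w : cmod w = r -> quotient_extends h r w -> quotient_extends h r (q ^+ k * w).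
  move=> wr hw; elim: k => [|k IH]; first by rewrite expr0 mul1r.
  rewrite exprS -mulrA; apply: quotient_extends_step => //.
  by rewrite cmod_qXM.
have hcirc w : cmod w = r -> quotient_extends h r w.
  move=> wr; have [|k] := orbit_dense q1 qnr (u := z0) (w := w) _ x0; first by rewrite wr.
  rewrite cmodC -(qVXB q1) => hk.
  rewrite -(qXK q1 k w); apply: hiter; first by rewrite (cmod_qVX q1).
  exact: hx.
have [v [s [hv /andP[s0 sj] hc hcs hs]]] := Hq_maclaurin q1 qnr.
have [y y0 hy] := (nearC _ _).1 hh.2.
pose m := Num.min y s; have m0 : 0 < m by rewrite lt_min y0.
have hcm : geo (hcoef q v) m by apply: geo_le hc; rewrite ltW //= (le_trans _ sj) // ge_min lexx orbT.
have hm z : cmod z < m -> h z = PS (hcoef q v) z.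
  by rewrite lt_min => /andP[z1 z2]; rewrite hy ?subr0 // hs.
have [|P [P0 [t rt ht] _]] := mero_disc r0 m0 hcm hm.
  move=> w; rewrite le_eqVlt => /predU1P[wr|wr].
    exact/quotient_extends_mero/hcirc.
  exact/meromorphic_from_disc/hmer.
have : (t%:E <= rho q)%E.
  by apply: (meromorphy_radius_ge s0 hcs hs); exists P.
by rewrite -z0R lee_fin leNgt rt.
Unshelve. all: by end_near.
Qed.

End natural_boundary_of_H.

(** * Small divisors and the radius of convergence *)

Section small_divisors.
Context {R : realType}.
Variable q : R[i].
Hypothesis q1 : cmod q = 1.
Hypothesis qnr : not_root_of_unity q.
Implicit Types (s t : R).

(** The coefficients of [G] up to unimodular factors. *)
Definition qfact_inv j : R[i] := (\prod_(1 <= k < j.+1) (1 - q ^+ k))^-1.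

Lemma cmod_Gcoef j : cmod (Gcoef q j) = cmod (qfact_inv j).
Proof. by rewrite cmodM cmodX q1 expr1n mul1r. Qed.

Lemma qfact_invS j : qfact_inv j.+1 * (1 - q ^+ j.+1) = qfact_inv j.
Proof. by rewrite /qfact_inv big_nat_recr //= invfM -mulrA mulVf ?mulr1 // qX_neq1. Qed.

(** The logarithmic derivative of [F z = \sum_j z^j / ((1-q)...(1-q^j))] is
    [\sum_n z^n / (1-q^n)] (times [z]), because [F (q z) = (1 - z) F z]: this
    replaces the products by single small divisors. *)
Lemma qfact_inv_log_derivative j :
  j%:R * qfact_inv j = \sum_(n < j) (1 - q ^+ n.+1)^-1 * qfact_inv (j - n.+1)%N.
Proof.
elim: j => [|j IH]; first by rewrite mul0r big_ord0.
have nj := qX_neq1 qnr j; apply: (mulIf nj).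
rewrite -mulrA qfact_invS big_distrl /=.
have split_term (n : 'I_j.+1) : (1 - q ^+ n.+1)^-1 * qfact_inv (j.+1 - n.+1)%N * (1 - q ^+ j.+1) =
    (1 - q ^+ n.+1)^-1 * (qfact_inv (j - n)%N * (1 - q ^+ (j - n))) +
    q ^+ (j - n) * qfact_inv (j - n)%N.
  have -> : q ^+ j.+1 = q ^+ (j - n) * q ^+ n.+1.
    by rewrite -exprD; congr (_ ^+ _); have := ltn_ord n; lia.
  have := qX_neq1 qnr n; rewrite subSS.
  by move: (q ^+ n.+1) (q ^+ (j - n)) (qfact_inv _) => x y z x0; field.
rewrite (eq_bigr _ (fun n _ => split_term n)) big_split /= big_ord_recr /= subnn.
rewrite expr0 subrr !mulr0 addr0.
have -> : \sum_(n < j) (1 - q ^+ n.+1)^-1 * (qfact_inv (j - n)%N * (1 - q ^+ (j - n))) =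
    j%:R * qfact_inv j.
  rewrite IH; apply: eq_bigr => n _; congr (_ * _).
  have -> : (j - n = (j - n.+1).+1)%N by have := ltn_ord n; lia.
  exact: qfact_invS.
have -> : \sum_(n < j.+1) q ^+ (j - n) * qfact_inv (j - n)%N = qfact_inv j.
  rewrite (reindex_inj rev_ord_inj) /=.
  rewrite (eq_bigr (fun n : 'I_j.+1 => q ^+ n * qfact_inv n)); last first.
    by move=> n _; rewrite subSS subKn // -ltnS.
  elim: (j) => [|m IHm]; first by rewrite big_ord1 expr0 mul1r.
  by rewrite big_ord_recr /= IHm -[qfact_inv m]qfact_invS; ring.
by rewrite -natr1 mulrDl mul1r.
Qed.

(** Strong induction on the recursion of the logarithmic derivative: its right
    side is a combination of the previous terms with weights of total mass at most
    [K x / (1 - x)], while the left side carries the factor [j], so the bound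
    stops growing once [j] exceeds that mass. *)
Lemma geo_small_divisors s t K : 0 < t < s -> 0 <= K ->
  (forall n, (cmod (1 - q ^+ n.+1))^-1 * s ^+ n.+1 <= K) -> geo (Gcoef q) t.
Proof.
move=> /andP[t0 ts] K0 hK; have s0 : 0 < s by lra.
set x := t / s; have x01 : 0 <= x < 1.
  by rewrite /x divr_ge0 ?ltW //= ltr_pdivrMr // mul1r.
have x1 : 0 < 1 - x by rewrite subr_gt0; case/andP: x01.
have x0 : 0 <= x by case/andP: x01.
(* The weights are powers of [x = t / s]. *)
pose psi j := cmod (qfact_inv j) * t ^+ j.
have psi0 j : 0 <= psi j by rewrite mulr_ge0 ?cmod_ge0 // exprn_ge0 // ltW.
have hpsi j : j%:R * psi j <= K * \sum_(n < j) x ^+ n.+1 * psi (j - n.+1)%N.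
  rewrite /psi mulrA -cmod_nat -cmodM qfact_inv_log_derivative.
  apply: (le_trans (y := \sum_(n < j) cmod ((1 - q ^+ n.+1)^-1 * qfact_inv (j - n.+1)%N) * t ^+ j)).
    rewrite -big_distrl /=; apply: ler_wpM2r; last exact: cmod_sum.
    by rewrite exprn_ge0 // ltW.
  rewrite big_distrr /=; apply: ler_sum => n _; rewrite cmodM cmodV.
  have -> : t ^+ j = s ^+ n.+1 * x ^+ n.+1 * t ^+ (j - n.+1).
    rewrite -exprMn mulrCA divff ?gt_eqF // mulr1 -exprD; congr (_ ^+ _).
    by have := ltn_ord n; lia.
  set c := (cmod _)^-1; set f := cmod _; set u := s ^+ n.+1.
  have := hK n; rewrite -/c -/u => h.
  have -> : c * f * (u * x ^+ n.+1 * t ^+ (j - n.+1)) = c * u * (x ^+ n.+1 * (f * t ^+ (j - n.+1))) by ring.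
  apply: ler_wpM2r => //; apply: mulr_ge0; first exact: exprn_ge0.
  by apply: mulr_ge0; [exact: cmod_ge0|rewrite exprn_ge0 // ltW].
pose J := (Num.bound (K * (x / (1 - x)))).+1.
have hJ : K * (x / (1 - x)) <= J%:R.
  apply: ltW; apply: lt_trans (archi_boundP _) _; last by rewrite ltr_nat.
  by apply: mulr_ge0 => //; apply: divr_ge0 => //; exact: ltW.
pose C := \sum_(j < J) psi j.
exists C => j; rewrite cmod_Gcoef -/(psi j).
have C0 : 0 <= C by rewrite sumr_ge0.
have [m] := ubnP j; elim: m j => // m IH j jm.
have [jJ|Jj] := ltnP j J.
  by rewrite /C (bigD1 (Ordinal jJ)) //= lerDl sumr_ge0.
have j0 : 0 < j%:R :> R by rewrite ltr0n (leq_trans _ Jj).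
rewrite -(ler_pM2l j0); apply: le_trans (hpsi j) _.
apply: (le_trans (y := K * \sum_(n < j) x ^+ n.+1 * C)).
  apply: ler_wpM2l => //; apply: ler_sum => n _; apply: ler_wpM2l; first exact: exprn_ge0.
  by apply: IH; have := ltn_ord n; lia.
rewrite -big_distrl /= mulrA; apply: ler_wpM2r => //.
apply: (le_trans (y := K * (x / (1 - x)))); last by apply: le_trans hJ _; rewrite ler_nat.
apply: ler_wpM2l => //; have := geo_tail 1 j.+1 x01; rewrite big_add1 /= big_mkord.
by rewrite expr1.
Qed.

Lemma natX_expr_bounded m (x : R) : 0 <= x < 1 ->
  exists2 C, 0 < C & forall n, n%:R ^+ m * x ^+ n <= C.
Proof.
elim: m x => [|m IH] x x01.
  exists 1 => // n; rewrite mul1r exprn_ile1 //; case/andP: x01 => // _; exact: ltW.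
case/andP: x01 => x0 x1; pose y := (1 + x) / 2.
have y01 : 0 <= y < 1 by rewrite /y; lra.
have y0 : 0 < y by rewrite /y; lra.
have z01 : 0 <= x / y < 1.
  by apply/andP; split; [rewrite divr_ge0 // ltW|rewrite ltr_pdivrMr // mul1r /y; lra].
have [C C0 hC] := IH _ z01.
have K0 : 0 < (1 - y)^-1 by rewrite invr_gt0 subr_gt0; case/andP: y01.
exists ((1 - y)^-1 * C); first exact: mulr_gt0.
move=> n; have -> : n%:R ^+ m.+1 * x ^+ n = (n%:R * y ^+ n) * (n%:R ^+ m * (x / y) ^+ n).
  by rewrite (expr_ratio x n y0) exprS; ring.
apply: ler_pM => //.
- by rewrite mulr_ge0 // exprn_ge0 // ltW.
- by rewrite mulr_ge0 // exprn_ge0 //; case/andP: z01.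
- apply: le_trans (geo_linear n y01); apply: ler_wpM2r; last by rewrite ler_nat.
  by rewrite exprn_ge0 // ltW.
Qed.

(** Polynomial factors do not change the exponential rate of the small divisors. *)
Lemma Rq_ge t m C k0 : 0 < t -> (forall k, (k0 <= k)%N -> (0 < k)%N ->
    t ^+ k <= C * k%:R ^+ m * cmod (1 - q ^+ k)) -> (t%:E <= Rq q)%E.
Proof.
move=> t0 hk.
have gt u : 0 < u < t -> geo (Gcoef q) u.
  move=> /andP[u0 ut]; pose s := (u + t) / 2.
  have s0 : 0 < s by rewrite /s; lra.
  have st : 0 <= s / t < 1.
    by rewrite divr_ge0 ?ltW //= ltr_pdivrMr // mul1r /s; lra.
  have [D D0 hD] := natX_expr_bounded m st.
  pose B := `|C| * D + \sum_(k < k0) (cmod (1 - q ^+ k.+1))^-1 * s ^+ k.+1.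
  have T0 k : 0 <= (cmod (1 - q ^+ k.+1))^-1 * s ^+ k.+1.
    by rewrite mulr_ge0 ?invr_ge0 ?cmod_ge0 // exprn_ge0 // ltW.
  have CD0 : 0 <= `|C| * D by rewrite mulr_ge0 // ltW.
  apply: (@geo_small_divisors s u B); first by rewrite u0 /s; lra.
    by rewrite addr_ge0 // sumr_ge0.
  move=> n; have [kn|nk] := leqP k0 n; last first.
    by rewrite /B (bigD1 (Ordinal nk)) //= addrCA lerDl addr_ge0 // sumr_ge0.
  have c0 : 0 < cmod (1 - q ^+ n.+1) by rewrite cmod_gt0 qX_neq1.
  have h := hk n.+1 (leqW kn) (ltn0Sn n).
  apply: (le_trans (y := `|C| * D)); last by rewrite lerDl sumr_ge0.
  rewrite mulrC ler_pdivrMr //.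
  rewrite (expr_ratio s n.+1 t0).
  have p0 : 0 <= (s / t) ^+ n.+1 by rewrite exprn_ge0 //; case/andP: st.
  apply: le_trans (ler_wpM2r p0 h) _.
  rewrite mulrAC; apply: ler_wpM2r; first exact: ltW.
  apply: (le_trans (y := `|C| * (n.+1%:R ^+ m * (s / t) ^+ n.+1))).
    by rewrite -mulrA; apply: ler_wpM2r; [rewrite mulr_ge0 // exprn_ge0|exact: ler_norm].
  by apply: ler_wpM2l.
rewrite leNgt; apply/negP => Rt.
have := radius_ge0 (Gcoef q); rewrite -/(Rq q).
move: Rt; case E : (Rq q) => [r| |] //; rewrite lte_fin lee_fin => rt r0.
have := @radius_ge_geo R (Gcoef q) ((r + t) / 2); rewrite -/(Rq q) E lee_fin => H.
have {}H : (r + t) / 2 <= r by apply: H; [lra|apply: gt; lra].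
lra.
Qed.

(** Large coefficients along a subsequence are enough; the factor [b i] absorbs the
    polynomial losses of the estimate. *)
Lemma Rq_le t C (b : nat -> nat) : 0 <= t -> 0 <= C -> (forall i, (i <= b i)%N) ->
  (forall u, t < u -> exists i0, forall i, (i0 <= i)%N ->
     1 <= C * (b i)%:R * cmod (Gcoef q (b i)) * u ^+ b i) -> (Rq q <= t%:E)%E.
Proof.
move=> t0 C0 hb hu; rewrite leNgt; apply/negP => tR.
have [s ts sR] := ereal_between tR.
have s0 : 0 < s by lra.
have [A hA] := geo_lt_radius (ltW s0) sR.
pose u := (t + s) / 2.
have u0 : 0 < u by rewrite /u; lra.
have tu : t < u by rewrite /u; lra.
have [i0 hi0] := hu _ tu.
have x01 : 0 <= u / s < 1.
  by rewrite divr_ge0 ?ltW //= ltr_pdivrMr // mul1r /u; lra.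
have A0 := gbound_ge0 hA.
have K0 : 0 < C * A + 1 by rewrite ltr_wpDl // mulr_ge0.
have K1 : 0 < (C * A + 1)^-1 by rewrite invr_gt0.
have [N hN] := linear_expr_small x01 K1.
pose i := maxn i0 N.
have h1 := hi0 i (leq_maxl _ _).
have h2 := hN (b i) (leq_trans (leq_maxr i0 N) (hb i)).
have : 1 < 1 :> R; last by rewrite ltxx.
apply: le_lt_trans h1 _.
rewrite (expr_ratio u (b i) s0).
have y0 : 0 <= (b i)%:R * (u / s) ^+ b i.
  by rewrite mulr_ge0 // exprn_ge0 //; case/andP: x01.
apply: (le_lt_trans (y := C * A * ((b i)%:R * (u / s) ^+ b i))).
  have -> : C * (b i)%:R * cmod (Gcoef q (b i)) * (s ^+ b i * (u / s) ^+ b i) =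
    C * (cmod (Gcoef q (b i)) * s ^+ b i) * ((b i)%:R * (u / s) ^+ b i) by ring.
  by apply: ler_wpM2r => //; apply: ler_wpM2l.
apply: (le_lt_trans (y := (C * A + 1) * ((b i)%:R * (u / s) ^+ b i))).
  by apply: ler_wpM2r => //; rewrite lerDl.
by rewrite -ltr_pdivlMl // mulr1.
Qed.

End small_divisors.

(** * Almost every point of the circle *)

Section almost_every.
Context {R : realType}.
Implicit Types (x y e t : R).

Lemma abs_le_sin x : - pi <= x <= pi -> 1 / 2 <= cos x -> `|x| <= 2 * `|sin x|.
Proof.
wlog x0 : x / 0 <= x.
  move=> H /andP[x1 x2] hc; have [x0|x0] := leP 0 x; first by apply: H; rewrite ?x1.
  have := H (- x); rewrite cosN sinN !normrN; apply => //; first by rewrite oppr_ge0 ltW.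
  by rewrite lerN2 lerNl x2.
move=> /andP[_ xpi] hc; rewrite (ger0_norm x0).
move: x0; rewrite le_eqVlt => /predU1P[<-|x0]; first by rewrite mulr_ge0.
have [|c /[!in_itv]/= /andP[c0 cx] E] := @MVT R sin cos 0 x x0 (fun v _ => is_derive_sin v).
  by apply: continuous_subspaceT => v; exact: continuous_sin.
move: E; rewrite sin0 !subr0 => ->.
have : cos x < cos c.
  by rewrite ltr_cos // in_itv /= ltW //= ?(le_trans _ xpi) // ltW // (lt_trans c0).
move=> h; have c2 : 1 / 2 <= cos c by lra.
rewrite ger0_norm; last by rewrite mulr_ge0 ?ltW //; lra.
have : 1 / 2 * x <= cos c * x by apply: ler_wpM2r => //; exact: ltW.
lra.
Qed.

(** The nearest multiple of [2 pi] is obtained by truncation; within half a turn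
    of it the sine controls the angle. *)
Lemma cis_near1 x e N : 0 <= x < N%:R * (2 * pi) -> e <= 1 / 2 -> cmod (1 - cis x) < e ->
  exists2 m, (m <= N)%N & `|x - m%:R * (2 * pi)| <= 2 * e.
Proof.
move=> /andP[x0 xN] e2 hx; have p0 : 0 < 2 * pi :> R by rewrite mulr_gt0 ?pi_gt0.
have y0 : 0 <= x / (2 * pi) + 1 / 2 by rewrite addr_ge0 ?divr_ge0 // ltW.
have /andP[] := truncn_itv y0; set m := Num.trunc _ => h1 h2.
have xE : x / (2 * pi) * (2 * pi) = x by rewrite divfK // gt_eqF.
exists m.
  rewrite -ltnS -(ltr_nat R) -natr1; apply: le_lt_trans h1 _.
  have : x / (2 * pi) < N%:R by rewrite ltr_pdivrMr.
  lra.
have h3 : m%:R * (2 * pi) <= x + pi.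
  have := ler_wpM2r (ltW p0) h1; rewrite [(x / _ + _) * _]mulrDl xE; lra.
have h4 : x + pi < (m%:R + 1) * (2 * pi).
  move: h2; rewrite -(natr1 m) -(ltr_pM2r p0) [(x / _ + _) * _]mulrDl xE; lra.
set y := x - _.
have yc : cis y = cis x by exact: cis_sub2pi.
have h5 := le_lt_trans (cmod_Re _) hx; have h6 := le_lt_trans (cmod_Im _) hx.
have E1 : complex.Re (1 - cis x) = 1 - cos y.
  by move: yc => [-> _].
have E2 : complex.Im (1 - cis x) = - sin y.
  by move: yc => [_ ->]; rewrite /= sub0r.
rewrite E1 in h5; rewrite E2 normrN in h6.
have : `|y| <= 2 * `|sin y|.
  apply: abs_le_sin; first by rewrite /y; apply/andP; split; lra.
  by move: h5; rewrite ltr_norml => /andP[]; lra.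
lra.
Qed.

(** With [N = n.+1], the angles [x] such that [N x] is within [2 / (N (N + 1))] of the
    [m]-th multiple of [2 pi]. *)
Definition near_root n m : set R :=
  let N := n.+1%:R in let w := 2 / (N * n.+2%:R) / N in
  `[m%:R * (2 * pi) / N - w, m%:R * (2 * pi) / N + w]%classic.

Definition bad n : set R := \big[setU/set0]_(m < n.+2) near_root n m.

Lemma measurable_bad n : measurable (bad n).
Proof. by apply: bigsetU_measurable => m _; exact: measurable_itv. Qed.

(** The angles [x] for which [q ^+ n.+1] is close to [1] are close to [n.+2] angles
    of roots of unity. *)
Lemma bad_contains n x : 0 <= x < 2 * pi ->
  cmod (1 - cis x ^+ n.+1) < (n.+1%:R * n.+2%:R)^-1 -> bad n x.
Proof.
move=> /andP[x0 x1]; rewrite cisX => hx.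
have N0 : 0 < n.+1%:R :> R by rewrite ltr0n.
have e2 : (n.+1%:R * n.+2%:R)^-1 <= 1 / 2 :> R.
  rewrite div1r lef_pV2 ?posrE ?mulr_gt0 ?ltr0n //.
  by rewrite -natrM ler_nat; nia.
have [|m mN hm] := @cis_near1 (n.+1%:R * x) _ n.+1 _ e2 hx.
  by apply/andP; split; [exact: mulr_ge0 (ltW N0) x0|rewrite ltr_pM2l].
rewrite /bad -bigcup_mkord; exists m => /=; first by rewrite ltnS.
rewrite /near_root /= in_itv /= -ler_distl ler_pdivlMr // -[X in _ * X]gtr0_norm //.
by rewrite -normrM mulrBl divfK ?gt_eqF // [x * _]mulrC.
Qed.

(** The arcs number [n.+2] and have length of order [n ^- 3], so the measures are
    summable. *)
Lemma measure_bad n : (lebesgue_measure (bad n) <= (8 / (n.+1%:R * n.+2%:R))%:E)%E.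
Proof.
have H := @Boole_inequality _ R _ lebesgue_measure (near_root n) n.+2
  (fun m _ => measurable_itv _).
apply: le_trans H _.
have N0 : 0 < n.+1%:R :> R by rewrite ltr0n.
have M0 : 0 < n.+2%:R :> R by rewrite ltr0n.
apply: (@le_trans _ _ (\sum_(m < n.+2) (4 / (n.+1%:R * n.+2%:R) / n.+1%:R)%:E)%E).
  apply: lee_sum => m _; rewrite /near_root /= lebesgue_measure_itv /=.
  case: ifP => _; last by rewrite lee_fin !divr_ge0 // mulr_ge0.
  rewrite -EFinD lee_fin; set w := 2 / _ / _.
  have -> : 4 / (n.+1%:R * n.+2%:R) / n.+1%:R = 2 * w by rewrite /w; ring.
  by move: (_ * (2 * pi) / _) => a; lra.
rewrite sumEFin lee_fin sumr_const card_ord -[leLHS]mulr_natl -(natr1 n.+1).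
have : 1 <= n.+1%:R :> R by rewrite ler1n.
move: (n.+1%:R : R) N0 => y y0 y1; have y10 : 0 < y + 1 by lra.
have -> : (y + 1) * (4 / (y * (y + 1)) / y) = (4 / y) / y.
  by field; rewrite !gt_eqF.
have -> : 8 / (y * (y + 1)) = 8 / (y + 1) / y by field; rewrite !gt_eqF.
apply: ler_wpM2r; first by rewrite invr_ge0 ltW.
by rewrite ler_pdivrMr // mulrAC ler_pdivlMr //; lra.
Qed.

(** Borel-Cantelli. *)
Lemma limsup_bad_null : lebesgue_measure (lim_sup_set bad) = 0.
Proof.
apply: lim_sup_set_cvg0; first exact: measurable_bad.
apply: (@le_lt_trans _ _ 8%:E); last by rewrite ltry.
apply: lime_le; first by apply: is_cvg_nneseries => n _ _; exact: measure_ge0.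
near=> N; apply: (@le_trans _ _ (\sum_(0 <= n < N) (8 / (n.+1%:R * n.+2%:R))%:E)%E).
  by apply: lee_sum => n _; exact: measure_bad.
rewrite sumEFin lee_fin.
have -> : \sum_(0 <= n < N) 8 / (n.+1%:R * n.+2%:R) = 8 - 8 / N.+1%:R :> R.
  elim: (N) => [|M IH]; first by rewrite big_geq // divr1 subrr.
  rewrite big_nat_recr //= IH -(natr1 M.+1).
  have : 0 < M.+1%:R :> R by rewrite ltr0n.
  by move: (M.+1%:R : R) => y y0; field; apply/andP; split; rewrite gt_eqF // addr_gt0.
by rewrite gerBl divr_ge0.
Unshelve. all: by end_near.
Qed.

(** Off the limit superior of the bad sets the small divisors decay only
    polynomially. Roots of unity are excluded as well, because they are bad for
    infinitely many [n]. *)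
Lemma Rq_ge1_off_bad x : 0 <= x < 2 * pi -> ~ lim_sup_set bad x ->
  not_root_of_unity (cis x) /\ (1 <= Rq (cis x))%E.
Proof.
move=> hx hbad.
have [n0 hn0] : exists n0, forall n, (n0 <= n)%N -> ~ bad n x.
  apply: contrapT => /forallNP H; apply: hbad => n _.
  have /existsNP[m /not_implyP[nm /contrapT bm]] := H n.
  by exists m.
have low n : (n0 <= n)%N -> (n.+1%:R * n.+2%:R)^-1 <= cmod (1 - cis x ^+ n.+1).
  by move=> /hn0 h; rewrite leNgt; apply/negP => /(bad_contains hx).
have qnr : not_root_of_unity (cis x).
  move=> k k0; apply/eqP => E.
  have := low (k * n0.+1).-1.
  have kn : (0 < k * n0.+1)%N by rewrite muln_gt0 k0.
  rewrite prednK // exprM E expr1n subrr cmod0 => /(_ _) H.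
  have : (n0 <= (k * n0.+1).-1)%N by nia.
  move=> /H; rewrite leNgt invr_gt0 mulr_gt0 ?ltr0n //.
split => //; apply: (@Rq_ge _ _ (cmod_cis x) qnr 1 2 2 n0.+1) => // -[//|k] nk _.
rewrite expr1n; have := low k nk; rewrite -[X in X <= _]div1r ler_pdivrMr; last first.
  by rewrite mulr_gt0 ?ltr0n.
move=> h; apply: le_trans h _; rewrite mulrC; apply: ler_wpM2r; first exact: cmod_ge0.
rewrite expr2 mulrCA; apply: ler_wpM2l => //.
by rewrite -natrM ler_nat; lia.
Qed.

End almost_every.

(** * Points with a prescribed radius of convergence *)

Section liouville.
Context {R : realType}.
Implicit Types (x y t u : R).

(** From [n = \sum_(j < n) (1 - w ^+ j)] and [cmod (1 - w ^+ j) <= j * cmod (1 - w)]. *)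
Lemma root_of_unity_gap (w : R[i]) n : (0 < n)%N -> w ^+ n = 1 -> w != 1 -> cmod w = 1 ->
  2 <= n%:R * cmod (1 - w).
Proof.
move=> n0 wn w1 cw; have w1' : 1 - w != 0 by rewrite subr_eq0 eq_sym.
have c0 : 0 < cmod (1 - w) by rewrite cmod_gt0.
have s0 : \sum_(j < n) w ^+ j = 0.
  apply: (mulfI w1'); rewrite mulr0 -[LHS]opprK -mulNr opprB -subrX1 wn subrr oppr0 //.
have hj j : cmod (1 - w ^+ j) <= j%:R * cmod (1 - w).
  elim: j => [|j IH]; first by rewrite expr0 subrr cmod0 mul0r.
  have -> : 1 - w ^+ j.+1 = (1 - w ^+ j) + w ^+ j * (1 - w) by rewrite exprSr; ring.
  apply: le_trans (cmodD _ _) _; rewrite cmodM cmodX cw expr1n mul1r -(natr1 j) mulrDl mul1r.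
  by rewrite lerD2r.
have E : n%:R = \sum_(j < n) (1 - w ^+ j).
  by rewrite sumrB s0 subr0 sumr_const card_ord.
have h : n%:R <= (\sum_(j < n) j%:R) * cmod (1 - w) :> R.
  rewrite -[leLHS]cmod_nat E big_distrl /=.
  by apply: le_trans (cmod_sum _ _ _) _; apply: ler_sum.
have S m : (\sum_(j < m) j%:R) * 2 = m%:R * (m%:R - 1) :> R.
  elim: m => [|m IH]; first by rewrite big_ord0 !mul0r.
  by rewrite big_ord_recr /= mulrDl IH -(natr1 m); ring.
have np : 0 < n%:R :> R by rewrite ltr0n.
have : n%:R * 2 <= n%:R * ((n%:R - 1) * cmod (1 - w)).
  rewrite mulrA -S mulrAC; apply: ler_wpM2r => //.
rewrite ler_pM2l // => h2; apply: le_trans h2 _; apply: ler_wpM2r; first exact: ltW.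
by rewrite lerBlDr lerDl.
Qed.

(** Evaluate [(X ^ n - 1) / (X - 1)] at [1]. *)
Lemma prod_one_sub_root (z : R[i]) n : (0 < n)%N -> n.-primitive_root z ->
  \prod_(1 <= k < n) (1 - z ^+ k) = n%:R.
Proof.
move=> n0 pz; have := factor_Xn_sub_1 pz; rewrite subrX1 big_ltn // expr0.
move=> /(mulfI (negbT (polyXsubC_eq0 1)))/(congr1 (horner^~ 1)).
rewrite horner_prod horner_sum => E.
transitivity (\prod_(1 <= k < n) ('X - (z ^+ k)%:P).[1]).
  by apply: eq_bigr => k _; rewrite hornerXsubC.
rewrite E (eq_bigr (fun=> 1)) ?sumr_const ?card_ord // => i _.
by rewrite hornerXn expr1n.
Qed.

(** [(1 + x) ^+ n <= 1 / (1 - n x)] with the denominator cleared, the form that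
    goes through the induction. *)
Lemma bernoulli_inv x n : 0 <= x -> (1 + x) ^+ n * (1 - n%:R * x) <= 1.
Proof.
move=> x0; elim: n => [|n IH]; first by rewrite mul0r subr0 mulr1.
apply: le_trans IH; rewrite exprSr -mulrA; apply: ler_wpM2l.
  by rewrite exprn_ge0 // addr_ge0.
rewrite -natr1; have : 0 <= x * x by rewrite mulr_ge0.
have : 0 <= n%:R * x * x by rewrite !mulr_ge0.
lra.
Qed.

End liouville.

Section unit_radius.
Context {R : realType}.

Lemma Rq_rho_eq1 (q : R[i]) : cmod q = 1 -> not_root_of_unity q -> (1 <= Rq q)%E ->
  Rq q = 1%E /\ rho q = 1%E.
Proof.
move=> q1 qnr h; have h1 := rho_le1 q1 qnr; have h2 := rho_ge_Rq q1 qnr.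
by split; apply/eqP; rewrite eq_le ?h1 ?h ?(le_trans h2) ?(le_trans h).
Qed.

Lemma ae_Rq_rho_eq1 : ae_unit_circle (fun q : R[i] =>
  [/\ not_root_of_unity q, ~ calG q, Rq q = 1%E & rho q = 1%E]).
Proof.
exists (lim_sup_set bad); split.
- apply: bigcapT_measurable => n; apply: bigcup_measurable => k _; exact: measurable_bad.
- exact: limsup_bad_null.
move=> x /= H; apply: contrapT => hb; apply: H => hx.
have [qnr R1] := Rq_ge1_off_bad hx hb.
have [E1 E2] := Rq_rho_eq1 (cmod_cis x) qnr R1.
split; [exact: qnr| |exact: E1|exact: E2].
by move=> [_ _]; rewrite ltNge => /negP; apply; exact: R1.
Qed.

End unit_radius.

Section lacunary.
Context {R : realType}.
Implicit Types (x y t u : R).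

Definition hpow n : R := 2^-1 ^+ n.

Lemma hpow_gt0 n : 0 < hpow n.
Proof. by rewrite exprn_gt0 // invr_gt0. Qed.

Lemma hpowD m n : hpow (m + n) = hpow m * hpow n.
Proof. exact: exprD. Qed.

Lemma hpow_le m n : (m <= n)%N -> hpow n <= hpow m.
Proof. by move=> mn; apply: ler_wiXn2l => //; lra. Qed.

Lemma hpowK n : (2 ^ n)%:R * hpow n = 1.
Proof. by rewrite natrX -exprMn mulfV ?expr1n // pnatr_eq0. Qed.

Lemma pi_lt4 : pi < 4 :> R.
Proof. have := @pihalf_lt2 R; lra. Qed.

Variable E : nat -> nat.
Hypothesis hE : forall a, (3 * a + 5 <= E a)%N.

(** Exponents of the number [\sum_i 2 ^- lac i]; a rapidly growing [E] makes it a
    Liouville number, and [E] prescribes how well its partial sums approximate it. *)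
Fixpoint lac i : nat := if i is j.+1 then (lac j + E (lac j))%N else 1%N.

Fixpoint psum_lac i : R := if i is j.+1 then psum_lac j + hpow (lac j.+1) else hpow 1.

Fixpoint num_lac i : nat := if i is j.+1 then (num_lac j * 2 ^ E (lac j) + 1)%N else 1%N.

Lemma lac_gt0 i : (i < lac i)%N.
Proof. by elim: i => //= i IH; have := hE (lac i); lia. Qed.

Lemma lac_expn_gt i : (i < 2 ^ lac i)%N.
Proof. by apply: ltn_trans (lac_gt0 i) _; exact: ltn_expl. Qed.

(** The partial sums are dyadic rationals with odd numerator, see [odd_num_lac]: so
    they are in lowest terms. *)
Lemma psum_lacE i : (2 ^ lac i)%:R * psum_lac i = (num_lac i)%:R.
Proof.
elim: i => [|i IH]; first exact: hpowK.
rewrite [psum_lac _]/= mulrDr hpowK [num_lac _]/= natrD natrM -IH.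
by rewrite [lac i.+1]/= expnD natrM; ring.
Qed.

Lemma odd_num_lac i : odd (num_lac i).
Proof.
case: i => //= i; rewrite oddD oddM oddX.
have -> : (E (lac i) == 0)%N = false by have := hE (lac i); lia.
by rewrite andbF.
Qed.

(** The sum of the series, as the supremum of its partial sums; the remainder is
    at most twice its first term. *)
Lemma lacunary_number : exists x, forall i, psum_lac i <= x <= psum_lac i + 2 * hpow (lac i.+1).
Proof.
pose top i := psum_lac i + 2 * hpow (lac i.+1).
have up i j : psum_lac i <= psum_lac (i + j)%N.
  elim: j => [|j IH]; first by rewrite addn0.
  by rewrite addnS; apply: le_trans IH _; rewrite lerDl ltW // hpow_gt0.
have down i j : top (i + j)%N <= top i.
  elim: j => [|j IH]; first by rewrite addn0.
  rewrite addnS; apply: le_trans IH; move: (i + j)%N => {i} {}j.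
  rewrite /top [psum_lac j.+1]/= -/(lac j.+1).
  have : hpow (lac j.+2) <= hpow (lac j.+1 + 1).
    by apply: hpow_le; have := hE (lac j.+1); rewrite [lac j.+2]/= -/(lac j.+1); lia.
  by rewrite hpowD /hpow expr1; lra.
have le i j : psum_lac i <= top j.
  apply: le_trans (up i j) _; apply: (le_trans (y := top (i + j)%N)).
    by rewrite lerDl mulr_ge0 // ltW // hpow_gt0.
  by rewrite addnC; exact: down.
have S : has_sup [set psum_lac i | i in setT].
  by split; [exists (psum_lac 0), 0%N|exists (top 0%N) => _ [i _ <-]; exact: le].
exists (sup [set psum_lac i | i in setT]) => i; apply/andP; split.
  by apply: ub_le_sup; [case: S|exists i].
by apply: ge_sup; [case: S|move=> _ [j _ <-]; exact: le].
Qed.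

Variable x : R.
Hypothesis hx : forall i, psum_lac i <= x <= psum_lac i + 2 * hpow (lac i.+1).

Let q : R[i] := cis (2 * pi * x).
Let zeta i : R[i] := cis (2 * pi * psum_lac i).

Lemma zeta_prim i : (2 ^ lac i)%N.-primitive_root (zeta i).
Proof.
have l0 := lac_gt0 i; have lE : lac i = (lac i).-1.+1 by lia.
have h : zeta i ^+ (2 ^ (lac i).-1) = -1.
  rewrite /zeta cisX.
  have -> : (2 ^ (lac i).-1)%:R * (2 * pi * psum_lac i) = (num_lac i)%:R * pi :> R.
    by rewrite -psum_lacE [in RHS]lE expnSr natrM; ring.
  by rewrite -cisX cis_pi -signr_odd odd_num_lac expr1.
by rewrite lE; exact: prim_root_half.
Qed.

Lemma q_zeta i k : cmod (q ^+ k - zeta i ^+ k) <= 32 * k%:R * hpow (lac i.+1).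
Proof.
rewrite /q /zeta !cisX; apply: le_trans (cis_lipschitz _ _) _.
have /andP[h1 h2] := hx i.
have -> : k%:R * (2 * pi * x) - k%:R * (2 * pi * psum_lac i) =
  k%:R * (2 * pi) * (x - psum_lac i) by ring.
have kp : 0 <= k%:R * pi :> R by rewrite mulr_ge0 ?pi_ge0.
rewrite ger0_norm; last by rewrite mulr_ge0 ?subr_ge0 // mulr_ge0 // mulr_ge0 ?pi_ge0.
have h3 : x - psum_lac i <= 2 * hpow (lac i.+1) by lra.
have -> : 2 * (k%:R * (2 * pi) * (x - psum_lac i)) = 4 * (k%:R * pi) * (x - psum_lac i) by ring.
apply: le_trans (ler_wpM2l _ h3) _; first by rewrite mulr_ge0.
have h4 : k%:R * pi <= k%:R * 4 :> R by apply: ler_wpM2l => //; rewrite ltW // pi_lt4.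
have -> : 4 * (k%:R * pi) * (2 * hpow (lac i.+1)) = 8 * hpow (lac i.+1) * (k%:R * pi) by ring.
have -> : 32 * k%:R * hpow (lac i.+1) = 8 * hpow (lac i.+1) * (k%:R * 4) by ring.
by apply: ler_wpM2l => //; rewrite mulr_ge0 // ltW // hpow_gt0.
Qed.

Lemma zeta_gap i k : (0 < k < 2 ^ lac i)%N -> 2 * hpow (lac i) <= cmod (1 - zeta i ^+ k).
Proof.
move=> /andP[k0 kb]; have pz := zeta_prim i.
have b0 : (0 < 2 ^ lac i)%N by rewrite expn_gt0.
have := @root_of_unity_gap R (zeta i ^+ k) (2 ^ lac i) b0.
rewrite exprAC (prim_expr_order pz) expr1n cmodX cmod_cis expr1n => /(_ erefl) H.
have {}H : 2 <= (2 ^ lac i)%:R * cmod (1 - zeta i ^+ k).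
  apply: H => //; rewrite -(prim_order_dvd pz); apply/negP => /dvdn_leq; lia.
have := ler_wpM2r (ltW (hpow_gt0 (lac i))) H.
by rewrite mulrAC hpowK mul1r.
Qed.

(** A power of [q] below [2 ^ lac i] stays close to the same power of [zeta i], a
    root of unity of that order different from [1]. *)
Lemma q_gap i k : (0 < k < 2 ^ lac i)%N -> hpow (lac i) <= cmod (1 - q ^+ k).
Proof.
move=> /andP[k0 kb]; have h1 := @zeta_gap i k; rewrite k0 kb in h1.
have {}h1 := h1 isT; have h2 := q_zeta i k.
have h3 : 32 * k%:R * hpow (lac i.+1) <= hpow (lac i).
  apply: (le_trans (y := 32 * (2 ^ lac i)%:R * hpow (lac i + (lac i + 5)))).
    apply: ler_pM; [by rewrite mulr_ge0|exact: ltW (hpow_gt0 _)| |].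
      by apply: ler_wpM2l => //; rewrite ler_nat ltnW.
    by apply: hpow_le; have := hE (lac i); rewrite /=; lia.
  rewrite hpowD mulrA -[32 * _ * _]mulrA hpowK mulr1 addnC hpowD mulrA.
  by rewrite (_ : 32 = (2 ^ 5)%:R) // hpowK mul1r.
have gap (a b c d f : R) : 2 * f <= a -> b <= c -> c <= f -> a <= d + b -> f <= d by lra.
exact: gap h1 h2 h3 (cmod_tri _ _ _).
Qed.

Lemma lac_not_root_of_unity : not_root_of_unity q.
Proof.
move=> k k0; apply/eqP => qk; have := @q_gap k k.
by rewrite k0 lac_expn_gt qk subrr cmod0 leNgt hpow_gt0 => /(_ isT).
Qed.

(** With [b = 2 ^ lac i], the factors [1 - q ^+ k] with [k < b] are close to those of
    the primitive root [zeta i], whose product is [b]; the last factor is as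
    small as [hpow (E (lac i))]. So the coefficient is as large as the inverse of
    the latter, up to the factor [64 b]. *)
Lemma lac_Gcoef i :
  1 <= 64 * (2 ^ lac i)%:R * hpow (E (lac i)) * cmod (Gcoef q (2 ^ lac i)).
Proof.
set b := (2 ^ lac i)%N; set e := hpow (E _).
have b0 : (0 < b)%N by rewrite expn_gt0.
have e0 : 0 < e by exact: hpow_gt0.
have bR : 0 < b%:R :> R by rewrite ltr0n.
have eb : b%:R * hpow (lac i.+1) = e by rewrite [lac _]/= hpowD mulrA hpowK mul1r.
have last_factor : cmod (1 - q ^+ b) <= 32 * e.
  have := q_zeta i b; rewrite (prim_expr_order (zeta_prim i)) cmodC -mulrA eb.
  by [].
(* Relative error of each factor: an error of at most [32 k hpow (lac i) e] against
   a gap of at least [2 hpow (lac i)]. *)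
pose y := 16 * b%:R * e.
have y0 : 0 <= y by rewrite !mulr_ge0 // ltW.
have factor k : (0 < k < b)%N -> cmod (1 - q ^+ k) <= cmod (1 - zeta i ^+ k) * (1 + y).
  move=> kb; have gap := zeta_gap kb; have h := q_zeta i k.
  have h1 := cmod_tri (zeta i ^+ k) 1 (q ^+ k); rewrite (cmodC (zeta i ^+ k)) in h1.
  rewrite mulrDr mulr1; apply: le_trans h1 _; rewrite lerD2l; apply: le_trans h _.
  apply: (le_trans (y := 2 * hpow (lac i) * y)); last by apply: ler_wpM2r.
  rewrite /y [lac i.+1]/= hpowD -/e.
  have -> : 2 * hpow (lac i) * (16 * b%:R * e) = 32 * b%:R * (hpow (lac i) * e) by ring.
  apply: ler_wpM2r; first by rewrite mulr_ge0 // ltW // hpow_gt0.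
  by apply: ler_wpM2l => //; rewrite ler_nat; case/andP: kb => _ /ltnW.
have yb : b%:R * y <= 1 / 2.
  have : e <= hpow (lac i + (lac i + 5)).
    by apply: hpow_le; have := hE (lac i); lia.
  move=> h; have {}h := ler_wpM2l (mulr_ge0 (ltW bR) (ltW bR)) h.
  have E2 : b%:R * b%:R * hpow (lac i + (lac i + 5)) = hpow 5.
    by rewrite !hpowD mulrACA hpowK mul1r mulrA hpowK mul1r.
  rewrite E2 in h; have h5 : 32 * hpow 5 = 1 by rewrite (_ : 32 = (2 ^ 5)%:R) // hpowK.
  rewrite /y; have -> : b%:R * (16 * b%:R * e) = 16 * (b%:R * b%:R * e) by ring.
  lra.
have pow2 : (1 + y) ^+ b <= 2.
  have h := bernoulli_inv b y0.
  have p0 : 0 <= (1 + y) ^+ b by rewrite exprn_ge0 // addr_ge0.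
  have : (1 + y) ^+ b * (1 / 2) <= (1 + y) ^+ b * (1 - b%:R * y) by apply: ler_wpM2l => //; lra.
  lra.
have prod_le : \prod_(1 <= k < b) cmod (1 - q ^+ k) <= b%:R * 2.
  apply: (le_trans (y := \prod_(1 <= k < b) (cmod (1 - zeta i ^+ k) * (1 + y)))).
    by rewrite !big_nat; apply: ler_prod => k kb; rewrite cmod_ge0 /= factor.
  rewrite big_split /= -cmod_prod prod_one_sub_root ?zeta_prim // cmod_nat.
  apply: ler_wpM2l => //; rewrite prodr_const_nat; apply: le_trans pow2.
  by apply: ler_weXn2l; [rewrite lerDl|lia].
have full : cmod (qfact_inv q b)^-1 <= 64 * b%:R * e.
  rewrite invrK big_nat_recr //= cmodM cmod_prod.
  have -> : 64 * b%:R * e = b%:R * 2 * (32 * e) by ring.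
  by apply: ler_pM => //; [apply: prodr_ge0 => k _|]; exact: cmod_ge0.
rewrite cmod_Gcoef ?cmod_cis //.
have g0 : 0 < cmod (qfact_inv q b).
  rewrite cmod_gt0 invr_eq0 big_nat prodf_seq_neq0; apply/allP => k _; apply/implyP.
  by move=> /andP[k0 _]; rewrite subr_eq0 eq_sym; exact: lac_not_root_of_unity.
by move: full; rewrite cmodV -[leLHS]mul1r ler_pdivrMr.
Qed.

Lemma lac_between k : (1 < k)%N -> exists i, (2 ^ lac i <= k < 2 ^ lac i.+1)%N.
Proof.
move=> k1; have ex : exists i, (k < 2 ^ lac i)%N.
  by exists k; exact: lac_expn_gt.
case: (ex_minnP ex) => -[|i] ki mini; first by move: ki; rewrite /= expn1; lia.
exists i; rewrite ki andbT leqNgt; apply/negP => /mini; lia.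
Qed.

Lemma lac_Rq_le t : 0 <= t ->
  (forall u, t < u -> exists a0, forall a, (a0 <= a)%N -> hpow (E a) <= u ^+ (2 ^ a)) ->
  (Rq q <= t%:E)%E.
Proof.
move=> t0 hu; apply: (@Rq_le _ q t 64 (fun i => 2 ^ lac i)%N) => //.
  by move=> i; exact: ltnW (lac_expn_gt i).
move=> u /hu[a0 ha0]; exists a0 => i i0; apply: le_trans (lac_Gcoef i) _.
rewrite -mulrA [hpow _ * _]mulrC mulrA; apply: ler_wpM2l.
  by rewrite !mulr_ge0 // cmod_ge0.
by apply: ha0; have := lac_gt0 i; lia.
Qed.

(** If [b <= k < b'] for consecutive [b = 2 ^ lac i] and [b' = 2 ^ lac i.+1], then
    [cmod (1 - q ^+ k)] is at least [1 / b'], which the hypothesis compares with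
    [t ^+ b], and [t ^+ k <= t ^+ b]. *)
Lemma lac_Rq_ge t : 0 < t <= 1 ->
  (forall a, t ^+ (2 ^ a) <= 64 * ((2 ^ a)%:R ^+ 3 * hpow (E a))) -> (t%:E <= Rq q)%E.
Proof.
move=> /andP[t0 t1] ht.
apply: (@Rq_ge _ q (cmod_cis _) lac_not_root_of_unity t 4 64 2) => // k k2 _.
have [i /andP[ik ki]] := lac_between k2.
have gap : hpow (lac i.+1) <= cmod (1 - q ^+ k) by apply: q_gap; lia.
have k4 : (2 ^ lac i)%:R ^+ 4 <= k%:R ^+ 4 :> R by rewrite lerXn2r ?nnegrE // ler_nat.
apply: (le_trans (y := t ^+ (2 ^ lac i))).
  by apply: ler_wiXn2l => //; exact: ltW.
apply: le_trans (ht (lac i)) _; rewrite -mulrA; apply: ler_wpM2l => //.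
apply: (le_trans (y := (2 ^ lac i)%:R ^+ 4 * hpow (lac i.+1))).
  rewrite [lac i.+1]/= hpowD.
  have -> (b h e : R) : b ^+ 4 * (h * e) = b ^+ 3 * (b * h * e) by ring.
  by rewrite hpowK mul1r.
by apply: ler_pM => //; rewrite ?exprn_ge0 // ltW // hpow_gt0.
Qed.

End lacunary.

Section all_radii.
Context {R : realType}.
Implicit Types (t u : R).

Let half01 : 0 <= (2^-1 : R) < 1.
Proof. by apply/andP; split; lra. Qed.

Lemma dyadic_below t : 0 < t <= 1 -> exists e, t / 2 <= hpow e <= t.
Proof.
move=> /andP[t0 t1].
have ex : exists e, hpow e <= t.
  have [N hN] := @expr_small R 2^-1 t half01 t0.
  by exists N; apply/ltW/hN.
case: (ex_minnP ex) => -[|e] he mine; first by exists 0%N; rewrite he /hpow expr0; lra.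
exists e.+1; rewrite he andbT leNgt; apply/negP => h.
have : hpow e <= t by rewrite /hpow exprS in h; rewrite /hpow; lra.
by move=> /mine; rewrite ltnn.
Qed.

(** The exponents are chosen so that [hpow (E a)] is comparable with [t ^+ 2 ^ a], up
    to powers of [2 ^ a]; for [t = 0] it is smaller than every geometric
    sequence in [2 ^ a]. *)
Lemma all_radii t : 0 <= t <= 1 ->
  exists q : R[i], [/\ cmod q = 1, not_root_of_unity q & Rq q = t%:E].
Proof.
move=> /andP[]; rewrite le_eqVlt => /predU1P[<- _|t0 t1].
  pose E a := (3 * a + 5 + 2 ^ a * 2 ^ a)%N.
  have hE a : (3 * a + 5 <= E a)%N by rewrite leq_addr.
  have [x hx] := @lacunary_number R E hE.
  have le0 : (Rq (cis (2 * pi * x)) <= 0%:E)%E.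
    apply: (lac_Rq_le hE hx) => // u u0.
    have [N hN] := @expr_small R 2^-1 u half01 u0.
    exists N => a Na; rewrite /E hpowD; apply: (le_trans (y := hpow (2 ^ a) ^+ (2 ^ a))).
      by rewrite /hpow -exprM ler_piMl ?exprn_ge0 // exprn_ile1 //; lra.
    apply: lerXn2r; rewrite ?nnegrE; [exact: ltW (hpow_gt0 _)|exact: ltW|apply: ltW].
    by apply: hN; rewrite (leq_trans Na) // ltnW // ltn_expl.
  exists (cis (2 * pi * x)); split; [exact: cmod_cis|exact: (lac_not_root_of_unity hE hx)|].
  by apply/eqP; rewrite eq_le le0 /= radius_ge0.
have tb a : 0 < t ^+ (2 ^ a) <= 1 by rewrite exprn_gt0 // exprn_ile1 // ltW.
have [e he] := boolp.choice (fun a => dyadic_below (tb a)).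
pose E a := (3 * a + 5 + e a)%N.
have hE a : (3 * a + 5 <= E a)%N by rewrite leq_addr.
have [x hx] := @lacunary_number R E hE.
exists (cis (2 * pi * x)); split; [exact: cmod_cis|exact: (lac_not_root_of_unity hE hx)|].
apply/eqP; rewrite eq_le; apply/andP; split.
  apply: (lac_Rq_le hE hx); first exact: ltW.
  move=> u tu; exists 0%N => a _; apply: (le_trans (y := hpow (e a))).
    by apply: hpow_le; rewrite leq_addl.
  case/andP: (he a) => _ h; apply: le_trans h _.
  by apply: lerXn2r; rewrite ?nnegrE ?ltW // (lt_trans t0).
apply: (lac_Rq_ge hE hx); first by rewrite t0.
move=> a; case/andP: (he a) => h _.
have -> : 64 * ((2 ^ a)%:R ^+ 3 * hpow (E a)) = 2 * hpow (e a) :> R.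
  have -> : hpow (E a) = hpow a ^+ 3 * hpow 5 * hpow (e a) :> R.
    by rewrite /E (hpowD _ (e a)) (hpowD (3 * a)) mulnC /hpow -exprM.
  have E3 (b y f g : R) : 64 * (b ^+ 3 * (y ^+ 3 * f * g)) = 2 * ((b * y) ^+ 3 * (32 * f) * g) by ring.
  by rewrite E3 hpowK (_ : 32 = (2 ^ 5)%:R) // hpowK expr1n !mul1r.
lra.
Qed.

End all_radii.

(** * The theorem *)

Theorem theorem2p2 (R : realType) :
  (forall q : R[i], `|q| = 1 -> not_root_of_unity q ->
             
    ([/\ (exists h, meromorphic_continuation (Hq q) (rho q) h),
         (forall h, meromorphic_continuation (Hq q) (rho q) h ->
            natural_boundary h (rho q)),
         (rho q <= 1)%E,
         (maxe (Rq q) ((2 + cmod (1 + q))^-1)%:E <= rho q)%E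
       & ((4^-1)%:E <= maxe (Rq q) ((2 + cmod (1 + q))^-1)%:E)%E])
    /\
                              
    ((0 < Rq q)%E -> natural_boundary (Gq q) (Rq q))
    /\
                              
    (~ calG q -> Rq q = 1%E /\ rho q = 1%E))
  /\
                             
  (forall t : R, 0 <= t <= 1 ->
    exists q : R[i], [/\ `|q| = 1, not_root_of_unity q & Rq q = t%:E])
  /\
                             
  ae_unit_circle (fun q : R[i] =>
    [/\ not_root_of_unity q, ~ calG q, Rq q = 1%E & rho q = 1%E]).
Proof.
have cmodP (q : R[i]) : `|q| = 1 -> cmod q = 1 by rewrite normE => -[].
have Pcmod (q : R[i]) : cmod q = 1 -> `|q| = 1 by rewrite normE => ->.
split; last split.
- move=> q /[dup] qn /cmodP q1 qnr; split; last split.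
  + split.
    * exact: continuation_exists.
    * by move=> h; exact: Hq_natural_boundary.
    * exact: rho_le1.
    * by rewrite ge_max rho_ge_Rq // rho_ge_jradius.
    * by rewrite le_max [X in _ || X](_ : _ = true) ?orbT // lee_fin; exact: jradius_ge4.
  + exact: Gq_natural_boundary.
  + move=> qG; apply: Rq_rho_eq1 => //; rewrite leNgt; apply/negP => R1.
    by apply: qG; split.
- by move=> t /all_radii[q [q1 qnr Rt]]; exists q; split; [exact: Pcmod| |].
- exact: ae_Rq_rho_eq1.
Qed.
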